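(* Let $2<p<\infty$. The fundamental gap $\Gamma(V)=\lambda_2(V)-\lambda_1(V)$ attains its minimum over the class $S_p$, i.e. there is $V^*\in S_p$ with $\Gamma(V^* )=\inf_{V\in S_p}\Gamma(V)$.
   Context: Let $\alpha_1,\alpha_2\in(0,\frac12)$, $\Omega=\{(x,y)\in\mathbb R^2: 0<x<1,\ 0<y<1\}$, $M>0$ a constant, and $S_p=\{V\in L^p(\Omega): V\ge 0 \text{ a.e.},\ \|V\|_{L^p(\Omega)}\le M\}$. All functions are real valued and identified a.e. $\mathcal H^1(\Omega)=\{u\in L^2(\Omega): y^{\alpha_1}\partial_xu\in L^2(\Omega),\ x^{\alpha_2}\partial_yu\in L^2(\Omega)\}$ (distributional derivatives), with norm $\left(\|u\|_{L^2}^2+\|y^{\alpha_1}\partial_xu\|_{L^2}^2+\|x^{\alpha_2}\partial_yu\|_{L^2}^2\right)^{1/2}$; $\mathcal H_0^1(\Omega)$ is the closure of $C_0^\infty(\Omega)$ in $\mathcal H^1(\Omega)$. For $V\in S_p$, $H_0(\Omega)=\{u\in\mathcal H_0^1(\Omega): \iint_\Omega Vu^2\,dxdy<\infty\}$. For $V\in S_p$, $\lambda_1(V)\le\lambda_2(V)\le\cdots$ are the eigenvalues, repeated according to multiplicity, of the problem $-(y^{2\alpha_1}\partial_x^2u+x^{2\alpha_2}\partial_y^2u)+Vu=\lambda u$ in $\Omega$, $u=0$ on $\partial\Omega$, understood weakly: $0\ne u\in H_0(\Omega)$ and $$\iint_\Omega y^{2\alpha_1}\partial_xu\,\partial_xv+x^{2\alpha_2}\partial_yu\,\partial_yv+Vuv\,dxdy=\lambda\iint_\Omega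 uv\,dxdy\quad\text{for all } v\in H_0(\Omega).$$ *)

(* Defs.v *)
From HB Require Import structures.
From mathcomp Require Export all_boot all_order all_algebra.
From mathcomp Require Export all_classical all_reals all_analysis.

Set Implicit Arguments.
Unset Strict Implicit.
Unset Printing Implicit Defensive.

Import Order.TTheory GRing.Theory Num.Theory.
Import numFieldNormedType.Exports.

Local Open Scope classical_set_scope.
Local Open Scope ring_scope.

(* A function on Omega is represented by any measurable function on the whole
   plane; integrating against [muO], the plane Lebesgue measure restricted to
   Omega, makes its values outside Omega irrelevant.  Functions are not
   quotiented: the Sobolev-type notions and the classes of potentials below do
   not distinguish measurable functions that are muO-a.e. equal. *)

Section Domain.
Context {R : realType}.

Definition Omega : set (R * R) := `]0, 1[ `*` `]0, 1[.

Lemma measurable_Omega : measurable Omega.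
Proof. by apply: measurableX; exact: measurable_itv. Qed.

Definition muO : {measure set (measurableTypeR R * measurableTypeR R)
    -> \bar R} :=
  mrestr (@lebesgue_measure R \x @lebesgue_measure R)%E measurable_Omega.

Definition ex : R * R := (1, 0).
Definition ey : R * R := (0, 1).

Definition partial (e : R * R) (f : R * R -> R) : R * R -> R :=
  fun z => 'D_e f z.

(* All iterated partial derivatives, in any order, exist and are continuous. *)
Definition smooth (f : R * R -> R) : Prop :=
  forall s : seq bool,
    let g := foldr (fun b => partial (if b then ex else ey)) f s in
    [/\ continuous g, forall z, derivable g z ex & forall z, derivable g z ey].

Definition test_function (phi : R * R -> R) : Prop :=
  [/\ smooth phi, compact (closure [set z | phi z != 0]) &
      closure [set z | phi z != 0] `<=` Omega].

Definition locally_integrable_Omega (w : R * R -> R) : Prop :=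
  measurable_fun setT w /\
  forall K, compact K -> K `<=` Omega -> muO.-integrable K (EFin \o w).

Definition weak_derivative (e : R * R) (u w : R * R -> R) : Prop :=
  locally_integrable_Omega w /\
  forall phi, test_function phi ->
    \int[muO]_z (u z * partial e phi z) = - \int[muO]_z (w z * phi z).

(* A representative of the distributional derivative of [u] along [e]; zero
   when that distribution is not a locally integrable function. *)
Definition wderiv (e : R * R) (u : R * R -> R) : R * R -> R :=
  xget (cst 0) [set w | weak_derivative e u w].

End Domain.

Section Problem.
Context {R : realType}.
Variables a1 a2 : R.
Implicit Types (u v V : R * R -> R).

(* As the weights are smooth and positive in Omega and their inverses are
   locally bounded there, y^a1 d_x u in L^2 forces the distribution d_x u to be
   a locally integrable function; hence [weak_derivative] is general enough. *)
Definition H1 u : Prop :=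
  [/\ u \in Lfun muO 2%:E,
      (exists2 w, weak_derivative ex u w &
         (fun z => z.2 `^ a1 * w z) \in Lfun muO 2%:E) &
      (exists2 w, weak_derivative ey u w &
         (fun z => z.1 `^ a2 * w z) \in Lfun muO 2%:E)].

Definition H1norm u : \bar R :=
  (('N[muO]_2%:E[EFin \o u] ^+ 2
    + 'N[muO]_2%:E[EFin \o (fun z => z.2 `^ a1 * wderiv ex u z)%R] ^+ 2
    + 'N[muO]_2%:E[EFin \o (fun z => z.1 `^ a2 * wderiv ey u z)%R] ^+ 2) `^ 2^-1)%E.

Definition H10 u : Prop :=
  H1 u /\
  forall eps : R, 0 < eps ->
    exists2 phi, test_function phi & (H1norm (u \- phi)%R < eps%:E)%E.

Definition H0 V u : Prop :=
  H10 u /\ (\int[muO]_z (V z * u z ^+ 2)%:E < +oo)%E.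

(* Zero is included: [in_eigenspace V lam] is the whole lam-eigenspace; nonzero
   members are singled out by [lin_indep]. *)
Definition in_eigenspace V (lam : R) u : Prop :=
  H0 V u /\
  forall v, H0 V v ->
    \int[muO]_z (z.2 `^ (2 * a1) * wderiv ex u z * wderiv ex v z
               + z.1 `^ (2 * a2) * wderiv ey u z * wderiv ey v z
               + V z * u z * v z)
    = lam * \int[muO]_z (u z * v z).

Definition lin_indep n (u : 'I_n -> R * R -> R) : Prop :=
  forall c : 'I_n -> R,
    {ae muO, forall z, \sum_(i < n) c i * u i z = 0} -> forall i, c i = 0.

Definition multiplicity_ge V (lam : R) (n : nat) : Prop :=
  exists2 u : 'I_n -> R * R -> R,
    lin_indep u & forall i, in_eigenspace V lam (u i).

(* [lam] lists all the eigenvalues in nondecreasing order, each one as many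
   times as its multiplicity; lambda_k is [lam k.-1]. *)
Definition eigenvalue_sequence V (lam : R^nat) : Prop :=
  nondecreasing_seq lam /\
  forall (mu : R) (n : nat),
    multiplicity_ge V mu n <-> (`I_n #<= lam @^-1` [set mu])%card.

Definition fundamental_gap V (g : R) : Prop :=
  exists2 lam, eigenvalue_sequence V lam & g = lam 1%N - lam 0%N.

Definition S_class (p M : R) : set (R * R -> R) :=
  [set V | [/\ V \in Lfun muO p%:E,
               {ae muO, forall z, 0 <= V z} &
               ('N[muO]_p%:E[EFin \o V] <= M%:E)%E]].

End Problem.

(* Main.v *)
From HB Require Import structures.
Require Import Defs.
From mathcomp Require Import measurable_realfun ring lra.
Import Order.TTheory GRing.Theory Num.Theory.
Import numFieldNormedType.Exports.
Local Open Scope classical_set_scope.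
Local Open Scope ring_scope.
Set Implicit Arguments.
Unset Strict Implicit.
Unset Printing Implicit Defensive.

(** The gap [lambda_2 - lambda_1] is lower semicontinuous for the weak topology
    of L2 on potentials, and the class of potentials is weakly compact; so a
    weak limit of a minimizing sequence is a minimizer.

    Since [p > 2], the class is bounded in L2, and it is convex and stable under
    L2 limits. A minimizing sequence is therefore followed along an ultrafilter:
    its weak limit exists ([weak_limit]) and is moreover a strong limit of
    convex combinations, so it is in the class ([admissible_closed]).

    Everything about one potential is deduced from the energy
    [a(u) = |y^a1 d_x u|^2 + |x^a2 d_y u|^2] and the mass [m(u) = |u|^2] on the
    closure of the test functions. Because [2 * a1 < 1] and [2 * a2 < 1], a test
    function satisfies [(phi z - phi z')^2 <= C * r^g * (h z + h z')] with
    [g > 0] when [z] and [z'] share a cell of size [r], where the integral of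
    [h] is [a(phi)] ([tf_oscillation]). Summing over a grid gives the Rellich
    property [m <= eps * a + (finitely many squared functionals)]
    ([sobolev_rellich]), from which the eigenvalues are built by successive
    minimization of the Rayleigh quotient ([eigenbasis_exists]); the multiplicity
    condition determines the first two of them ([lists_multiplicities_first_two]).

    The same slices give [int phi^4 <= a_x(phi) * a_y(phi)] ([tf_quartic]). With
    [p > 2] this bounds the potential form by [K * m + eps * a], with [K] depending
    only on [eps], [p] and [M] ([potential_infinitesimal]). Two consequences
    follow: a potential of the class does not change the form domain ([H0_H10]),
    and weak convergence of potentials makes their forms converge uniformly on
    sets of bounded energy ([perturbation_cvg_bounded]).

    Lower semicontinuity of the gap ([gap_stability]) does not go through
    convergence of eigenfunctions. The second eigenvalue of the limit is tested on a combination
    of the first two eigenfunctions of the n-th potential that is orthogonal to the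
    first eigenfunction of the limit, and the first eigenvalue of the n-th
    potential is tested on that eigenfunction of the limit. *)

(** * Positive semidefinite forms *)

(** Definiteness is left out: functions are not identified when they agree almost
    everywhere, so the mass is only a seminorm. *)
Record psd {R : realType} {X : lmodType R} (b : X -> X -> R) : Prop := Psd {
  psdC : forall u v, b u v = b v u;
  psdP : forall c u v w, b (c *: u + v) w = c * b u w + b v w;
  psd_ge0 : forall u, 0 <= b u u }.

Definition seminorm {R : realType} {X : lmodType R} (b : X -> X -> R) (u : X) :=
  Num.sqrt (b u u).

Section Psd.
Context {R : realType} {X : lmodType R}.
Implicit Types (b : X -> X -> R) (u v w : X).

Section OneForm.
Variables (b : X -> X -> R) (hb : psd b).

Lemma psdDl u v w : b (u + v) w = b u w + b v w.
Proof. by rewrite -[u in LHS]scale1r psdP// mul1r. Qed.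

Lemma psd0l w : b 0 w = 0.
Proof. by have := psdDl 0 0 w; rewrite addr0; lra. Qed.

Lemma psdZl c u w : b (c *: u) w = c * b u w.
Proof. by rewrite -[_ *: _]addr0 psdP// psd0l addr0. Qed.

Lemma psdNl u w : b (- u) w = - b u w.
Proof. by rewrite -scaleN1r psdZl mulN1r. Qed.

Lemma psdBl u v w : b (u - v) w = b u w - b v w.
Proof. by rewrite psdDl psdNl. Qed.

Lemma psdDr u v w : b w (u + v) = b w u + b w v.
Proof. by rewrite psdC// psdDl !(psdC hb w). Qed.

Lemma psdZr c u w : b w (c *: u) = c * b w u.
Proof. by rewrite psdC// psdZl (psdC hb w). Qed.

Lemma psdBr u v w : b w (u - v) = b w u - b w v.
Proof. by rewrite psdC// psdBl !(psdC hb w). Qed.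

Lemma psdNr u w : b w (- u) = - b w u.
Proof. by rewrite psdC// psdNl (psdC hb w). Qed.

Lemma psd_suml I (r : seq I) (P : pred I) (F : I -> X) w :
  b (\sum_(i <- r | P i) F i) w = \sum_(i <- r | P i) b (F i) w.
Proof.
apply: (big_morph (fun u => b u w)); last exact: psd0l.
by move=> u v; rewrite psdDl.
Qed.

Lemma psd_cauchy_schwarz_sqr u v : b u v ^+ 2 <= b u u * b v v.
Proof.
have H t s : 0 <= t ^+ 2 * b u u - 2 * t * s * b u v + s ^+ 2 * b v v.
  have := psd_ge0 hb (t *: u - s *: v).
  rewrite !(psdBl, psdBr, psdZl, psdZr) (psdC hb v u).
  by move=> h; rewrite (le_trans h)// le_eqVlt; apply/orP; left; apply/eqP; ring.
have u0 := psd_ge0 hb u; have v0 := psd_ge0 hb v.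
have [v1|v1] := eqVneq (b v v) 0.
  rewrite v1 mulr0; have [->|] := eqVneq (b u v) 0; first by rewrite expr0n.
  move=> uv0; have := H 1 ((b u u + 1) / (2 * b u v)).
  rewrite v1 mulr0 addr0 expr1n !mul1r mulr1.
  have -> : 2 * ((b u u + 1) / (2 * b u v)) * b u v = b u u + 1 by field.
  by lra.
have vp : 0 < b v v by rewrite lt_neqAle eq_sym v1.
have := H (b v v) (b u v).
set x := b u v; set y := b v v in vp *; set z := b u u => h.
have : 0 <= y * (z * y - x ^+ 2) by nra.
by rewrite pmulr_rge0// subr_ge0.
Qed.

Lemma seminorm_ge0 u : 0 <= seminorm b u. Proof. exact: sqrtr_ge0. Qed.

Lemma sqr_seminorm u : seminorm b u ^+ 2 = b u u.
Proof. by rewrite sqr_sqrtr// psd_ge0. Qed.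

Lemma psd_cauchy_schwarz u v : `|b u v| <= seminorm b u * seminorm b v.
Proof.
rewrite -ler_sqr ?nnegrE ?normr_ge0 ?mulr_ge0 ?seminorm_ge0//.
by rewrite exprMn !sqr_seminorm -normrX ger0_norm ?sqr_ge0 ?psd_cauchy_schwarz_sqr.
Qed.

Lemma seminormD u v : seminorm b (u + v) <= seminorm b u + seminorm b v.
Proof.
rewrite -ler_sqr ?nnegrE ?addr_ge0 ?seminorm_ge0//.
rewrite sqrrD !sqr_seminorm psdDl !psdDr (psdC hb v u).
have := le_trans (ler_norm _) (psd_cauchy_schwarz u v); lra.
Qed.

Lemma seminormZ c u : seminorm b (c *: u) = `|c| * seminorm b u.
Proof.
by rewrite /seminorm psdZl psdZr mulrA -expr2 sqrtrM ?sqr_ge0// sqrtr_sqr.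
Qed.

Lemma seminormN u : seminorm b (- u) = seminorm b u.
Proof. by rewrite -scaleN1r seminormZ normrN1 mul1r. Qed.

Lemma seminormB u v : seminorm b (u - v) = seminorm b (v - u).
Proof. by rewrite -seminormN opprB. Qed.

Lemma ler_seminormB u v : `|seminorm b u - seminorm b v| <= seminorm b (u - v).
Proof.
rewrite ler_norml; apply/andP; split.
  by have := seminormD (v - u) u; rewrite subrK seminormB; lra.
by have := seminormD (u - v) v; rewrite subrK; lra.
Qed.

Lemma psd_parallelogram u v :
  b (u + v) (u + v) + b (u - v) (u - v) = 2 * b u u + 2 * b v v.
Proof. by rewrite !(psdDl, psdDr, psdNl, psdNr) (psdC hb v u); ring. Qed.

Lemma ler_sqr_psdB u v : `|b u u - b v v| <= seminorm b (u - v) * (seminorm b u + seminorm b v).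
Proof.
rewrite -!sqr_seminorm subr_sqr normrM ler_pM// ?ler_seminormB//.
by rewrite ger0_norm// addr_ge0 ?seminorm_ge0.
Qed.

Lemma psd_null u v : b u u = 0 -> b u v = 0.
Proof.
move=> u0; apply/eqP; rewrite -normr_eq0 eq_le normr_ge0 andbT.
by apply: le_trans (psd_cauchy_schwarz _ _) _; rewrite /seminorm u0 sqrtr0 mul0r.
Qed.

End OneForm.

Lemma psdD b1 b2 : psd b1 -> psd b2 -> psd (fun u v => b1 u v + b2 u v).
Proof.
move=> h1 h2; split=> [u v|c u v w|u]; first by rewrite (psdC h1) (psdC h2).
  by rewrite (psdP h1) (psdP h2); ring.
by rewrite addr_ge0// psd_ge0.
Qed.

Lemma ler_seminorm b1 b2 C u : psd b2 -> 0 <= C -> b1 u u <= C * b2 u u ->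
  seminorm b1 u <= Num.sqrt C * seminorm b2 u.
Proof.
by move=> h2 C0 h; rewrite /seminorm -sqrtrM//; exact: ler_wsqrtr.
Qed.

Definition fcauchy b (x : X^nat) := forall e : R, 0 < e ->
  exists N, forall i j, (N <= i)%N -> (N <= j)%N -> seminorm b (x i - x j) < e.

Definition fcvg b (x : X^nat) (l : X) := forall e : R, 0 < e ->
  exists N, forall i, (N <= i)%N -> seminorm b (x i - l) < e.

Lemma fcvg_le b1 b2 C x l : psd b2 -> 0 <= C -> (forall u, b1 u u <= C * b2 u u) ->
  fcvg b2 x l -> fcvg b1 x l.
Proof.
move=> h2 C0 le h e e0.
have s0 : 0 < Num.sqrt C + 1 by rewrite ltr_wpDl// sqrtr_ge0.
have [N hN] := h (e / (Num.sqrt C + 1)) (divr_gt0 e0 s0).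
exists N => i Ni; apply: le_lt_trans (ler_seminorm h2 C0 (le _)) _.
have h0 := seminorm_ge0 b2 (x i - l).
apply: (@le_lt_trans _ _ ((Num.sqrt C + 1) * seminorm b2 (x i - l))).
  by rewrite ler_wpM2r// lerDl ler01.
by rewrite mulrC -ltr_pdivlMr// hN.
Qed.

Lemma fcauchy_le b1 b2 C x : psd b2 -> 0 <= C -> (forall u, b1 u u <= C * b2 u u) ->
  fcauchy b2 x -> fcauchy b1 x.
Proof.
move=> h2 C0 le h e e0.
have s0 : 0 < Num.sqrt C + 1 by rewrite ltr_wpDl// sqrtr_ge0.
have [N hN] := h (e / (Num.sqrt C + 1)) (divr_gt0 e0 s0).
exists N => i j Ni Nj; apply: le_lt_trans (ler_seminorm h2 C0 (le _)) _.
have h0 := seminorm_ge0 b2 (x i - x j).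
apply: (@le_lt_trans _ _ ((Num.sqrt C + 1) * seminorm b2 (x i - x j))).
  by rewrite ler_wpM2r// lerDl ler01.
by rewrite mulrC -ltr_pdivlMr// hN.
Qed.

Lemma fcvg_seminorm b x l : psd b -> fcvg b x l ->
  (fun n => seminorm b (x n)) @ \oo --> seminorm b l.
Proof.
move=> hb h; apply/cvgrPdist_lt => e /h[N hN]; near=> n.
apply: le_lt_trans (ler_seminormB hb _ _) _; rewrite seminormB//.
by apply: hN; near: n; exact: nbhs_infty_ge.
Unshelve. all: by end_near. Qed.

Lemma fcvg_psd b x l : psd b -> fcvg b x l ->
  (fun n => b (x n) (x n)) @ \oo --> b l l.
Proof.
move=> hb /(fcvg_seminorm hb) h.
under eq_fun do rewrite -(sqr_seminorm hb).
by rewrite -(sqr_seminorm hb); rewrite expr2; under eq_fun do rewrite expr2; exact: cvgM.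
Qed.

Lemma fcvg_psdl b x l w : psd b -> fcvg b x l -> (fun n => b (x n) w) @ \oo --> b l w.
Proof.
move=> hb h; apply/cvgrPdist_lt => e e0.
have w0 : 0 < seminorm b w + 1 by rewrite ltr_wpDl// seminorm_ge0.
have [N hN] := h (e / (seminorm b w + 1)) (divr_gt0 e0 w0).
near=> n; rewrite -psdBl//; apply: le_lt_trans (psd_cauchy_schwarz hb _ _) _.
have nN : (N <= n)%N by near: n; exact: nbhs_infty_ge.
have := hN n nN; rewrite ltr_pdivlMr// seminormB//; apply: le_lt_trans.
by rewrite ler_wpM2l ?seminorm_ge0// lerDl.
Unshelve. all: by end_near. Qed.

End Psd.

Section Ultra.
Context {R : realType} {I : Type} (U : set_system I) {UF : UltraFilter U}.

(** Ultrafilters replace the extraction of subsequences: one limit along [U] serves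
    all bounded sequences at once. *)
Lemma ultra_cvg_bounded (x : I -> R) (C : R) : (forall i, `|x i| <= C) ->
  exists l : R, x @ U --> l.
Proof.
move=> hC; have PU : ProperFilter U := ultra_proper; have := @segment_compact R (- C) C.
rewrite compact_ultra => /(_ (x @ U)) [| |l [_ ?]]; last by exists l.
  split; last first.
    move=> G PG sub; apply/seteqP; split=> // A GA.
    have [|] := in_ultra_setVsetC (x @^-1` A) UF; first by [].
    move=> UA; have /sub GA' : (x @ U) (~` A) by [].
    case: (@filter_not_empty _ G PG).
    rewrite -(setICr A); exact: filterI.
  exact: fmap_proper_filter.
rewrite /fmap /=; apply: filterE => i /=; by rewrite in_itv/= -ler_norml.
Qed.

End Ultra.

(** * Compactness and minimization of the Rayleigh quotient *)

Lemma rows_dependent (F : fieldType) (k n : nat) (A : 'M[F]_(n, k)) :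
  (k < n)%N -> exists2 c : 'rV[F]_n, c != 0 & c *m A = 0.
Proof.
move=> kn; exists (nz_row (kermx A)).
  rewrite nz_row_eq0 -mxrank_eq0 mxrank_ker -lt0n subn_gt0.
  by rewrite (leq_ltn_trans (rank_leq_col A)).
apply/eqP; rewrite -sub_kermx; exact: nz_row_sub.
Qed.

Section Spectral.
Context {R : realType} {X : lmodType R}.
Implicit Types (m a q : X -> X -> R) (u v w : X).

Definition functional (l : X -> R) := forall c u v, l (c *: u + v) = c * l u + l v.

(** A quantitative form of the compactness of [m] relative to [a]: up to a small
    part of the energy, [m] is controlled by finitely many bounded functionals. *)
Definition rellich m a := forall e : R, 0 < e ->
  exists I : finType, exists2 l : I -> X -> R,
    forall i, functional (l i) /\ exists C, forall u, l i u ^+ 2 <= C * a u u &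
    forall u, m u u <= e * a u u + \sum_i l i u ^+ 2.

(** Independence modulo the null space of [m]. *)
Definition independent m n (f : 'I_n -> X) := forall c : 'I_n -> R,
  m (\sum_i c i *: f i) (\sum_i c i *: f i) = 0 -> forall i, c i = 0.

(** [es_null] makes the null space of [m] also null for [a], so that both forms
    live on the same quotient. *)
Record energy_space m a : Prop := EnergySpace {
  es_m : psd m;
  es_a : psd a;
  es_poincare : exists2 C, 0 <= C & forall u, m u u <= C * a u u;
  es_null : forall u, m u u = 0 -> a u u = 0;
  es_complete : forall x : X^nat, fcauchy a x -> exists l, fcvg a x l;
  es_rellich : rellich m a;
  es_infinite : forall n, exists f : 'I_n -> X, independent m f }.

Definition eigenvector m a (mu : R) u := forall v, a u v = mu * m u v.

Definition mult_ge m a (mu : R) (n : nat) :=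
  exists2 f : 'I_n -> X, independent m f & forall i, eigenvector m a mu (f i).

Lemma functionalB l u v : functional l -> l (u - v) = l u - l v.
Proof.
move=> hl; rewrite -scaleN1r addrC hl; ring.
Qed.

(** The finitely many functionals converge along the ultrafilter, so they vary
    little on some set of the ultrafilter; the rest of [m] is a small part of the
    bounded energy. *)
Lemma rellich_ultra m a (U : set_system nat) {UF : UltraFilter U} (x : X^nat) C :
  psd m -> psd a -> rellich m a ->
  (forall n, a (x n) (x n) <= C) ->
  forall e : R, 0 < e -> exists2 A, U A &
    forall i j, A i -> A j -> m (x i - x j) (x i - x j) < e.
Proof.
move=> hm ha hr hC e e0.
have C0 : 0 <= C by apply: le_trans (hC 0%N); exact: psd_ge0.
have d0 : 0 < e / (8 * (C + 1)) by rewrite divr_gt0// mulr_gt0// ltr_wpDl.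
have [I0 [l hl hle]] := hr _ d0; pose r := #|I0|.
have cv k : exists y : R, (fun n => l k (x n)) @ U --> y.
  have [_ [K hK]] := hl k.
  have K0 n : `|l k (x n)| <= Num.sqrt (`|K| * C).
    rewrite -sqrtr_sqr ler_wsqrtr//; apply: le_trans (hK _) _.
    apply: le_trans (_ : `|K| * a (x n) (x n) <= _).
      by rewrite ler_wpM2r ?psd_ge0// ler_norm.
    by rewrite ler_wpM2l.
  exact: ultra_cvg_bounded K0.
pose y k := projT1 (cid (cv k)).
have hy k : (fun n => l k (x n)) @ U --> y k := projT2 (cid (cv k)).
(* [r] functionals, each varying by at most [2 d], contribute at most [e / 2]. *)
pose d : R := Num.sqrt (e / (8 * (r%:R + 1))).
have dd : 0 < d by rewrite sqrtr_gt0 divr_gt0// mulr_gt0// ltr_wpDl.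
exists [set n | forall k : I0, `|y k - l k (x n)| < d].
  apply: filter_forall => k.
  by move/cvgrPdist_lt: (hy k) => /(_ _ dd).
move=> i j Ai Aj; apply: le_lt_trans (hle _) _.
have aij : a (x i - x j) (x i - x j) <= 4 * C.
  have := psd_parallelogram ha (x i) (x j).
  have := psd_ge0 ha (x i + x j); have := hC i; have := hC j; lra.
have lij (k : I0) : l k (x i - x j) ^+ 2 <= 4 * d ^+ 2.
  have [hk _] := hl k; rewrite functionalB//.
  have h1 := Ai k; have h2 := Aj k.
  have -> : 4 * d ^+ 2 = (2 * d) ^+ 2 by ring.
  rewrite -real_normK ?num_real//; apply: lerXn2r; rewrite ?nnegrE ?normr_ge0//.
    by rewrite mulr_ge0// ltW.
  have -> : l k (x i) - l k (x j) = (y k - l k (x j)) - (y k - l k (x i)) by ring.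
  by apply: le_trans (ler_normB _ _) _; lra.
have s1 : \sum_(k : I0) l k (x i - x j) ^+ 2 <= r%:R * (4 * d ^+ 2).
  apply: le_trans (ler_sum _ (fun k _ => lij k)) _.
  by rewrite sumr_const -[leLHS]mulr_natl.
rewrite sqr_sqrtr in s1; last by rewrite divr_ge0// ?ltW// mulr_gt0// ltr_wpDl.
have r0 : (0 : R) <= r%:R by rewrite ler0n.
have s2 : r%:R * (4 * (e / (8 * (r%:R + 1)))) < e / 2.
  rewrite (_ : _ * _ = (e / 2) * (r%:R / (r%:R + 1))); last by field; lra.
  by rewrite gtr_pMr ?divr_gt0// ltr_pdivrMr ?mul1r ?ltrDl// ltr_wpDl.
have s3 : e / (8 * (C + 1)) * a (x i - x j) (x i - x j) <= e / 2.
  apply: le_trans (ler_wpM2l (ltW d0) aij) _.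
  rewrite [leLHS](_ : _ = (e / 2) * (C / (C + 1))); last first.
    by field; rewrite gt_eqF// ltr_wpDl.
  by rewrite ger_pMr ?divr_gt0// ler_pdivrMr ?mul1r ?lerDl// ltr_wpDl.
lra.
Qed.

Definition closed_subspace a (N : set X) :=
  (forall c u v, N u -> N v -> N (c *: u + v)) /\
  forall (x : X^nat) l, (forall n, N (x n)) -> fcvg a x l -> N l.

Lemma rellich_subsequence m a (x : X^nat) C :
  psd m -> psd a -> rellich m a -> (forall n, a (x n) (x n) <= C) ->
  exists2 s : nat -> nat, (forall n, (n <= s n)%N) & fcauchy m (x \o s).
Proof.
move=> hm ha hr hC.
have [U [UU sU]] := ultraFilterLemma (_ : ProperFilter (\oo : set_system nat)).
have PU : ProperFilter U := ultra_proper.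
have /choice[A hA] (k : nat) : exists A, U A /\ forall i j, A i -> A j ->
    m (x i - x j) (x i - x j) < k.+1%:R^-1 ^+ 2.
  have [|A UA h] := rellich_ultra hm ha hr hC (e := k.+1%:R^-1 ^+ 2).
    by rewrite exprn_gt0// invr_gt0.
  by exists A.
(* A diagonal choice: [s k] lies in all of [A 0], ..., [A k]. *)
have /choice[s hs] (k : nat) : exists n, (k <= n)%N /\ forall j, (j <= k)%N -> A j n.
  have : U ([set n | (k <= n)%N] `&` [set n | forall j : 'I_k.+1, A j n]).
    apply: filterI; first by apply: sU; exact: nbhs_infty_ge.
    by apply: filter_forall => j; have [] := hA j.
  move=> /filter_ex[n [kn h]]; exists n; split=> // j jk.
  exact: (h (Ordinal (_ : (j < k.+1)%N))).
exists s; first by move=> n; have [] := hs n.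
move=> e e0; have [N hN] : exists N : nat, N.+1%:R^-1 < e.
  by have [N _ h] := near_infty_natSinv_lt (PosNum e0); exists N; exact: h (leqnn N).
exists N => i j Ni Nj /=; apply: lt_trans hN.
rewrite -[ltRHS]ger0_norm ?invr_ge0// -sqrtr_sqr ltr_sqrt ?exprn_gt0 ?invr_gt0//.
have [_ hi] := hs i; have [_ hj] := hs j; have [_ h] := hA N.
by apply: h; [exact: hi|exact: hj].
Qed.

(** The parallelogram law turns a minimizing sequence that is Cauchy for [m]
    into a Cauchy sequence for the energy [a]: compactness is only ever used in
    its strong form. *)
Lemma rayleigh_min m a (N : set X) : energy_space m a -> closed_subspace a N ->
  (exists2 u, N u & m u u != 0) ->
  exists e, [/\ N e, m e e = 1 & forall u, N u -> a e e * m u u <= a u u].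
Proof.
move=> [hm ha [C C0 hC] _ hcompl hrel _] [linN clN] [u0 Nu0 mu0].
have N0 : N 0 by have := linN (-1) _ _ Nu0 Nu0; rewrite scaleN1r addNr.
have NZ c u : N u -> N (c *: u).
  by move=> Nu; have := linN c _ _ Nu N0; rewrite addr0.
have unit_of u : N u -> m u u != 0 -> let v := (seminorm m u)^-1 *: u in
    [/\ N v, m v v = 1 & a u u = m u u * a v v].
  move=> Nu mu /=; split; first exact: NZ.
    rewrite (psdZl hm) (psdZr hm) mulrA -invfM -expr2 sqr_seminorm//.
    by rewrite mulVf.
  rewrite (psdZl ha) (psdZr ha) (mulrA (seminorm m u)^-1) -invfM -expr2 sqr_seminorm//.
  by rewrite mulrA divff ?mul1r.
pose S := [set a u u | u in [set u | N u /\ m u u = 1]].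
pose lam := inf S.
have Sinf : has_inf S.
  split; first by have [N1 m1 _] := unit_of _ Nu0 mu0; eexists; exists ((seminorm m u0)^-1 *: u0).
  by exists 0 => _ [u _ <-]; exact: psd_ge0.
have lamle u : N u -> lam * m u u <= a u u.
  move=> Nu; have [->|mu] := eqVneq (m u u) 0; first by rewrite mulr0 psd_ge0.
  have [N1 m1 ->] := unit_of _ Nu mu.
  rewrite mulrC ler_wpM2l ?psd_ge0//; apply: ge_inf; last by exists ((seminorm m u)^-1 *: u).
  by have [] := Sinf.
have lam0 : 0 <= lam.
  by apply: lb_le_inf; [by have [] := Sinf|move=> _ [u _ <-]; exact: psd_ge0].
have /choice[x hx] (n : nat) : exists u, [/\ N u, m u u = 1 & a u u < lam + n.+1%:R^-1].
  have n0 : 0 < n.+1%:R^-1 :> R by rewrite invr_gt0.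
  have [_ [u [Nu mu] <-] h] := inf_adherent n0 Sinf.
  by exists u.
have [s sn scau] : exists2 s : nat -> nat, (forall n, (n <= s n)%N) & fcauchy m (x \o s).
  apply: (@rellich_subsequence m a x (lam + 1)) => // n.
  have [_ _ /ltW/le_trans] := hx n; apply.
  by rewrite lerD2l invf_le1// ler1n.
pose y := x \o s.
have hy n : [/\ N (y n), m (y n) (y n) = 1 & a (y n) (y n) <= lam + n.+1%:R^-1].
  have [h1 h2 h3] := hx (s n); split=> //; apply: (le_trans (ltW h3)).
  by rewrite lerD2l lef_pV2 ?posrE// ler_nat ltnS.
have ycau : fcauchy a y.
  move=> e e0.
  pose d := e ^+ 2 / 8.
  have d0 : 0 < d by rewrite divr_gt0// exprn_gt0.
  have [N1 _ h1] := near_infty_natSinv_lt (PosNum d0).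
  have l0 : 0 < Num.sqrt (e ^+ 2 / (2 * (lam + 1))).
    by rewrite sqrtr_gt0 divr_gt0 ?exprn_gt0// mulr_gt0// ltr_wpDl.
  have [N2 h2] := scau _ l0.
  exists (maxn N1 N2) => i j; rewrite !geq_max => /andP[i1 i2] /andP[j1 j2].
  rewrite -[ltRHS]gtr0_norm// -sqrtr_sqr ltr_sqrt ?exprn_gt0//.
  have := psd_parallelogram ha (y i) (y j).
  have := psd_parallelogram hm (y i) (y j).
  have [Ni mi ai] := hy i; have [Nj mj aj] := hy j; rewrite mi mj => pm pa.
  have := lamle (y i + y j); rewrite -[X in X + _]scale1r => /(_ (linN _ _ _ Ni Nj)).
  rewrite scale1r => la.
  have /= di := h1 _ i1; have /= dj := h1 _ j1.
  have : seminorm m (y i - y j) < _ := h2 _ _ i2 j2; rewrite ltr_sqrt; last first.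
    by rewrite divr_gt0 ?exprn_gt0// mulr_gt0// ltr_wpDl.
  rewrite ltr_pdivlMr ?mulr_gt0// ?ltr_wpDl// => dm.
  have m0 : 0 <= m (y i - y j) (y i - y j) by exact: psd_ge0.
  have : lam * m (y i + y j) (y i + y j) = 4 * lam - lam * m (y i - y j) (y i - y j).
    by rewrite -(subrK (m (y i - y j) (y i - y j)) (m (y i + y j) (y i + y j))); nra.
  rewrite /d in di dj; move: pm pa la dm m0 di dj ai aj.
  move: (m (y i - y j) (y i - y j)) (a (y i - y j) (y i - y j)) (m (y i + y j) (y i + y j))
    (a (y i + y j) (y i + y j)) (a (y i) (y i)) (a (y j) (y j)) (i.+1%:R^-1) (j.+1%:R^-1) (e ^+ 2).
  clear -lam0; clearbody lam => D aD P aP ai aj ri rj e2 pm pa la dm m0 di dj hai haj hP.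
  have : lam * D * 2 <= D * (2 * (lam + 1)) by nra.
  by lra.
have [e he] := hcompl _ ycau.
have me : fcvg m y e by exact: (fcvg_le ha C0 hC he).
exists e; split.
- by apply: clN he => n; have [] := hy n.
- have := fcvg_psd hm me; rewrite (_ : (fun n => _) = cst 1); last first.
    by apply/funext => n; have [] := hy n.
  by move=> /(@norm_cvg_unique _ _) h; apply: h; exact: cvg_cst.
- move=> u Nu; apply: le_trans (lamle _ Nu); rewrite ler_wpM2r ?psd_ge0//.
  have h1 := fcvg_psd ha he.
  have h2 : (fun n => lam + n.+1%:R^-1) @ \oo --> lam + 0.
    by apply: cvgD; [exact: cvg_cst|exact: cvg_harmonic].
  rewrite addr0 in h2; apply: ler_cvg_to h1 h2 _.
  by near=> n; have [] := hy n.
Unshelve. all: by end_near. Qed.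

End Spectral.

(** * Eigenvalues and their multiplicities *)

Section Eigenbasis.
Context {R : realType} {X : lmodType R}.
Implicit Types (m a q : X -> X -> R) (u v w : X).

Record eigenbasis m a (lam : R^nat) (e : X^nat) : Prop := Eigenbasis {
  eb_ortho : forall i j, m (e i) (e j) = (i == j)%:R;
  eb_eigen : forall k, eigenvector m a (lam k) (e k);
  eb_min : forall k u, (forall i, (i < k)%N -> m u (e i) = 0) ->
    lam k * m u u <= a u u;
  eb_nondecreasing : nondecreasing_seq lam;
  eb_unbounded : forall L, exists k, L < lam k }.

Definition orthogonal m (s : seq X) := [set u | forall x, x \in s -> m u x = 0].

(** Minimizers are chosen by a default-valued choice operator so that the
    recursion below is a plain iteration; [rayleigh_minimizerP] shows that the
    default is never used. *)
Definition rayleigh_minimizer m a (s : seq X) : X :=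
  xget 0 [set e | [/\ orthogonal m s e, m e e = 1 &
    forall u, orthogonal m s u -> a e e * m u u <= a u u]].

(** The list of the first [n] eigenfunctions, the most recent first. *)
Definition minimizers m a n := iter n (fun s => rayleigh_minimizer m a s :: s) [::].

Lemma mem_minimizers m a n x :
  x \in minimizers m a n <->
  exists2 i, (i < n)%N & x = rayleigh_minimizer m a (minimizers m a i).
Proof.
elim: n => [|n IH] in x *; first by split=> [//|[]].
rewrite /minimizers iterS -/(minimizers m a n) inE; split.
  by case/orP=> [/eqP->|/IH[i ni ->]]; [exists n|exists i => //; rewrite ltnS ltnW].
move=> [i]; rewrite ltnS leq_eqVlt => /orP[/eqP->->|ni ->]; first by rewrite eqxx.
by apply/orP; right; rewrite -/(minimizers m a i); apply/IH; exists i.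
Qed.

Lemma orthonormal_independent m n (f : 'I_n -> X) : psd m ->
  (forall i j, m (f i) (f j) = (i == j)%:R) -> independent m f.
Proof.
move=> hm hf c h i; have := psd_null hm (f i) h; rewrite psd_suml//.
rewrite (bigD1 i)//= big1 ?addr0; last first.
  by move=> j ji; rewrite psdZl// hf (negbTE ji) mulr0.
by rewrite psdZl// hf eqxx mulr1.
Qed.

(** More vectors than linear conditions leave a nontrivial combination. *)
Lemma independent_combination m n k (f : 'I_n -> X) (l : 'I_k -> X) : psd m ->
  independent m f -> (k < n)%N -> exists c : 'I_n -> R,
    let u := \sum_i c i *: f i in m u u != 0 /\ forall j, m u (l j) = 0.
Proof.
move=> hm hf kn.
have [c c0 cA] := rows_dependent (\matrix_(i, j) m (f i) (l j)) kn.
exists (fun i => c 0 i); split.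
  apply: contra_neq c0 => /hf h; apply/rowP => i; rewrite mxE; exact: h.
move=> j; rewrite psd_suml//; move/rowP: cA => /(_ j); rewrite !mxE => cA; rewrite -[RHS]cA.
by apply: eq_bigr => i _; rewrite psdZl// !mxE.
Qed.

Lemma rayleigh_minimizerP m a s : energy_space m a ->
  let e := rayleigh_minimizer m a s in
  [/\ orthogonal m s e, m e e = 1 & forall u, orthogonal m s u -> a e e * m u u <= a u u].
Proof.
move=> es; have [hm ha [C C0 hC] _ _ _ hinf] := es.
have [|] := pselect (exists e, [/\ orthogonal m s e, m e e = 1 &
    forall u, orthogonal m s u -> a e e * m u u <= a u u]).
  by move=> [e he]; exact: (@xgetPex _ 0 [set e | _] (ex_intro _ e he)).
case; apply: (rayleigh_min es).
  split=> [c u v hu hv x xs|x l hx xl y ys]; first by rewrite psdP// hu// hv// mulr0 addr0.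
  have /(fcvg_psdl (w := y) hm) := fcvg_le ha C0 hC xl.
  rewrite (_ : (fun n => _) = cst 0); last by apply/funext => n; rewrite hx.
  by move=> /(@norm_cvg_unique _ _) h; apply: h; exact: cvg_cst.
have [f hf] := hinf (size s).+1.
have [c [mu hu]] := independent_combination (fun j : 'I_(size s) => s`_j) hm hf (ltnSn _).
exists (\sum_i c i *: f i) => // x xs.
have := xs; rewrite -index_mem => xs'.
by have := hu (Ordinal xs'); rewrite /= nth_index.
Qed.

(** Euler-Lagrange: the first variation of the Rayleigh quotient vanishes. *)
Lemma rayleigh_stationary m a (s : seq X) e : psd m -> psd a ->
  orthogonal m s e -> m e e = 1 ->
  (forall u, orthogonal m s u -> a e e * m u u <= a u u) ->
  forall v, orthogonal m s v -> a e v = a e e * m e v.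
Proof.
move=> hm ha se me hmin v sv.
have h t : 0 <= 2 * t * (a e v - a e e * m e v) + t ^+ 2 * (a v v - a e e * m v v).
  have /hmin : orthogonal m s (t *: v + e).
    by move=> x xs; rewrite psdP// sv// se// mulr0 addr0.
  rewrite !(psdDl hm, psdDr hm, psdZl hm, psdZr hm, psdDl ha, psdDr ha, psdZl ha, psdZr ha).
  rewrite (psdC hm v e) (psdC ha v e) me; lra.
have g0 := hmin _ sv; rewrite -subr_ge0 in g0.
apply/eqP; rewrite -subr_eq0; apply/eqP.
move: (a e v - _) (a v v - _) g0 h => b g g0 h.
(* Any [t] of sign opposite to [b] and small enough works; dividing by [g + 1]
   avoids the case [g = 0]. *)
have := h (- b / (g + 1)).
have -> : 2 * (- b / (g + 1)) * b + (- b / (g + 1)) ^+ 2 * g =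
    - (b ^+ 2 * (g + 2) / (g + 1) ^+ 2) by field; rewrite gt_eqF// ltr_wpDl.
rewrite oppr_ge0 => h'.
have : b ^+ 2 * (g + 2) <= 0.
  have g1 : 0 < (g + 1) ^+ 2 by rewrite exprn_gt0// ltr_wpDl.
  by rewrite -(@ler_pM2r _ ((g + 1) ^+ 2)^-1) ?mul0r// invr_gt0.
have b0 := sqr_ge0 b => h2; have : b ^+ 2 = 0 by nra.
by move/eqP; rewrite sqrf_eq0 => /eqP.
Qed.

(** Each eigenfunction minimizes the Rayleigh quotient on the orthogonal of the
    previous ones. The eigenvalues are unbounded because an orthonormal sequence of
    bounded energy would have a Cauchy subsequence for [m]. *)
Lemma eigenbasis_exists m a : energy_space m a -> exists lam e, eigenbasis m a lam e.
Proof.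
move=> es; have [hm ha [C C0 hC] _ _ hrel _] := es.
pose e n := rayleigh_minimizer m a (minimizers m a n).
pose lam n := a (e n) (e n).
have orthE n u : orthogonal m (minimizers m a n) u <-> forall i, (i < n)%N -> m u (e i) = 0.
  split=> [h i ni|h x /mem_minimizers[i ni ->]]; last exact: h.
  by apply: h; apply/mem_minimizers; exists i.
have eP n : [/\ orthogonal m (minimizers m a n) (e n), m (e n) (e n) = 1 &
    forall u, orthogonal m (minimizers m a n) u -> lam n * m u u <= a u u].
  exact: rayleigh_minimizerP.
have ortho_lt i j : (i < j)%N -> m (e j) (e i) = 0.
  by move=> ij; have [/orthE/(_ _ ij)] := eP j.
have ortho i j : m (e i) (e j) = (i == j)%:R.
  have [->|] := eqVneq i j; first by have [] := eP j.
  by rewrite neq_ltn => /orP[ij|ji]; [rewrite (psdC hm) ortho_lt|rewrite ortho_lt].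
have stat n v : orthogonal m (minimizers m a n) v -> a (e n) v = lam n * m (e n) v.
  by have [h1 h2 h3] := eP n; exact: rayleigh_stationary.
have eig n : eigenvector m a (lam n) (e n).
  elim/ltn_ind: n => n IH v.
  pose p := \sum_(i < n) m v (e i) *: e i.
  have hp : orthogonal m (minimizers m a n) (v - p).
    apply/orthE => i ni; rewrite psdBl// psd_suml//.
    rewrite (bigD1 (Ordinal ni))//= big1 ?addr0; last first.
      by move=> j ji; rewrite psdZl// ortho (negbTE (ji : (j : nat) != i)) mulr0.
    by rewrite psdZl// ortho eqxx mulr1 subrr.
  have ap : a p (e n) = 0.
    rewrite psd_suml// big1// => i _; rewrite psdZl// (IH i)// ortho ltn_eqF//.
    by rewrite !mulr0.
  have mp : m p (e n) = 0.
    by rewrite psd_suml// big1// => i _; rewrite psdZl// ortho ltn_eqF// mulr0.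
  have := stat _ _ hp; rewrite (psdBr ha) (psdBr hm) (psdC ha _ p) ap (psdC hm _ p) mp; lra.
have nd : nondecreasing_seq lam.
  apply/nondecreasing_seqP => n; have [_ _ h] := eP n.
  have := h (e n.+1); have [_ -> _] := eP n.+1; rewrite mulr1; apply.
  by apply/orthE => i ni; apply: ortho_lt; exact: ltnW.
exists lam, e; split=> //.
- by move=> k u /orthE; have [_ _] := eP k; exact.
- move=> L; apply: contrapT => /forallNP h.
  have [|s sn scau] := @rellich_subsequence _ _ m a e L hm ha hrel.
    by move=> n; rewrite -/(lam n) leNgt; apply/negP/h.
  have [N hN] := scau 1 ltr01.
  have := hN N (s N).+1 (leqnn _) (leqW (sn N)).
  rewrite /= -(@ltr_pXn2r _ 2)// ?nnegrE ?seminorm_ge0// sqr_seminorm//.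
  have ne : s N != s (s N).+1 by rewrite ltn_eqF.
  rewrite (psdBl hm) !(psdBr hm) !ortho !eqxx (negbTE ne) [s _.+1 == _]eq_sym (negbTE ne) expr1n /=; lra.
Qed.

Lemma card_leP_nat n (A : set nat) :
  (`I_n #<= A)%card <-> exists2 f : nat -> nat, set_fun `I_n A f & set_inj `I_n f.
Proof. by rewrite -injfunPex; split=> [/pcard_leP//|h]; apply/pcard_leP. Qed.

(** If an eigenspace had more dimensions than indices listing its eigenvalue, one of
    its vectors would be orthogonal to the listed eigenfunctions, hence to all
    eigenfunctions before a larger eigenvalue [lam k0], contradicting minimality. *)
Lemma eigenbasis_mult m a lam e : psd m -> psd a -> eigenbasis m a lam e ->
  forall mu n, mult_ge m a mu n <-> (`I_n #<= lam @^-1` [set mu])%card.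
Proof.
move=> hm ha [ortho eig hmin nd unb] mu n; split; last first.
  move=> /card_leP_nat[f hf finj]; exists (fun i : 'I_n => e (f i)).
    apply: orthonormal_independent => // i j; rewrite ortho; congr (_%:R).
    have [->|ij] := eqVneq i j; first by rewrite eqxx.
    apply/eqP; rewrite eqb0; apply: contra ij => /eqP h; apply/eqP/val_inj.
    by apply: finj; rewrite // inE /=.
  by move=> i v; have /= <- := hf i (ltn_ord i); exact: eig.
move=> [f hf feig].
have [k0 hk0] := unb mu.
pose K := [set k : 'I_k0 | lam k == mu]%SET.
have [nK|Kn] := leqP n #|K|.
  apply/card_leP_nat.
  pose s := [seq val k | k <- enum K].
  have ss : size s = #|K| by rewrite size_map -cardE.
  exists (nth 0%N s).
    move=> i /= ni; have : nth 0%N s i \in s by rewrite mem_nth// ss (leq_trans ni).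
    by move=> /mapP[k]; rewrite mem_enum inE => /eqP hk ->.
  move=> i j; rewrite !inE /= => ni nj /eqP; rewrite nth_uniq ?ss ?(leq_trans _ nK)//.
    by move/eqP.
  by rewrite map_inj_uniq ?enum_uniq//; exact: val_inj.
have [c [mu0 hu]] := independent_combination (fun j : 'I_#|K| => e (enum_val j)) hm hf Kn.
set u := \sum_i _ in mu0 hu.
have ueig : eigenvector m a mu u.
  move=> v; rewrite !psd_suml// mulr_sumr; apply: eq_bigr => i _.
  by rewrite !psdZl// feig; ring.
have : lam k0 * m u u <= a u u.
  apply: hmin => k kk0; have [lk|lk] := eqVneq (lam k) mu.
    have kK : Ordinal kk0 \in K by rewrite inE lk.
    by have := hu (enum_rank_in kK (Ordinal kk0)); rewrite enum_rankK_in.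
  have := ueig (e k); rewrite psdC// eig (psdC hm (e k)) => /eqP.
  by rewrite -subr_eq0 -mulrBl mulf_eq0 subr_eq0 (negbTE lk) => /eqP.
rewrite ueig ler_pM2r; first by rewrite leNgt hk0.
by rewrite lt_neqAle eq_sym mu0 psd_ge0.
Qed.

End Eigenbasis.

Section FirstTwo.
Context {R : realType}.

(** Only the multiplicity function [mg] enters, so that two lists attached to the
    same problem can be compared without their eigenfunctions. *)
Definition lists_multiplicities (mg : R -> nat -> Prop) (lam : R^nat) :=
  nondecreasing_seq lam /\
  forall mu n, mg mu n <-> (`I_n #<= lam @^-1` [set mu])%card.

(** Every value of one list occurs in the other at least as many times, and a
    nondecreasing list takes its least values first. *)
Lemma lists_multiplicities_le mg (lam lam' : R^nat) :
  lists_multiplicities mg lam -> lists_multiplicities mg lam' ->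
  lam' 0%N <= lam 0%N /\ lam' 1%N <= lam 1%N.
Proof.
move=> [nd h] [nd' h'].
have one k : exists j, lam' j = lam k.
  have : mg (lam k) 1%N.
    apply/h/card_leP_nat; exists (fun=> k) => // i j; rewrite !inE /= !ltnS !leqn0.
    by move=> /eqP-> /eqP->.
  by move=> /h'/card_leP_nat[f hf _]; exists (f 0%N); exact: hf.
have [j0 e0] := one 0%N; have [j1 e1] := one 1%N.
split; first by rewrite -e0 nd'.
have [l01|l01] := eqVneq (lam 0%N) (lam 1%N); last first.
  rewrite -e1 nd'// lt0n; apply: contra l01 => /eqP j10.
  by rewrite eq_le nd//= -e1 j10 -e0 nd'.
have : mg (lam 1%N) 2%N.
  apply/h/card_leP_nat; exists id => //.
  by case=> [|[|]].
move=> /h'/card_leP_nat[f hf finj].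
have f0 := hf 0%N isT; have f1 := hf 1%N isT.
have f01 : f 0%N != f 1%N by apply/eqP => /finj; rewrite !inE/= => /(_ isT isT).
have : (0 < f 0%N)%N || (0 < f 1%N)%N.
  by move: f01; case: (f 0%N) (f 1%N) => [|?] [|?].
by case/orP => h1; [rewrite -f0|rewrite -f1]; apply: nd'.
Qed.

Lemma lists_multiplicities_first_two mg (lam lam' : R^nat) :
  lists_multiplicities mg lam -> lists_multiplicities mg lam' ->
  lam 0%N = lam' 0%N /\ lam 1%N = lam' 1%N.
Proof.
move=> h h'; have [h0 h1] := lists_multiplicities_le h h'.
have [h0' h1'] := lists_multiplicities_le h' h.
by split; apply/eqP; rewrite eq_le ?h0 ?h1 ?h0' ?h1'.
Qed.

End FirstTwo.

(** * Stability of the gap under perturbation of the form *)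

Section GapStability.
Context {R : realType} {X : lmodType R}.
Implicit Types (m a q : X -> X -> R) (u v w : X).

(** The constant [K] does not depend on the perturbation in [Q]: this uniformity
    is what survives along a sequence of perturbations. *)
Definition uniformly_infinitesimal m a (Q : set (X -> X -> R)) :=
  forall eps : R, 0 < eps -> exists2 K, 0 <= K &
    forall q u, Q q -> q u u <= K * m u u + eps * a u u.

Variables (m a : X -> X -> R) (Q : set (X -> X -> R)).
Hypotheses (es : energy_space m a) (Qpsd : forall q, Q q -> psd q)
  (Qinf : uniformly_infinitesimal m a Q).

Let hm : psd m. Proof. by case: es. Qed.
Let ha : psd a. Proof. by case: es. Qed.

Lemma perturbation_bound : exists2 C, 0 <= C & forall q u, Q q -> q u u <= C * a u u.
Proof.
have [_ _ [C C0 hC] _ _ _ _] := es.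
have [K K0 hK] := Qinf ltr01.
exists (K * C + 1); first by rewrite addr_ge0// mulr_ge0.
move=> q u /(hK _ u); have := ler_wpM2l K0 (hC u); lra.
Qed.

(** The perturbed energy is equivalent to the original one. *)
Lemma energy_spaceD q : Q q -> energy_space m (fun u v => a u v + q u v).
Proof.
move=> qQ; have [_ _ [C C0 hC] hnull hcompl hrel hinf] := es.
have hq := Qpsd qQ; have haq := psdD ha hq.
have [D D0 /(_ q _ qQ) hD] := perturbation_bound.
have le1 u : a u u <= 1 * (a u u + q u u) by rewrite mul1r lerDl psd_ge0.
split=> //.
- by exists C => // u; apply: le_trans (hC u) _; rewrite ler_wpM2l// -[leRHS]mul1r le1.
- move=> u /hnull au; have := hD u; have := psd_ge0 hq u; rewrite au mulr0; lra.
- move=> x /(fcauchy_le haq ler01 le1)/hcompl[l xl]; exists l.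
  apply: (fcvg_le ha (_ : 0 <= 1 + D)) xl; first by rewrite addr_ge0.
  by move=> u; have := hD u; lra.
- move=> e e0; have [r [l hl h]] := hrel e e0; exists r, l.
    move=> i; have [hli [K hK]] := hl i; split=> //; exists `|K| => u.
    apply: le_trans (hK u) _; apply: le_trans (_ : `|K| * a u u <= _).
      by rewrite ler_wpM2r ?psd_ge0// ler_norm.
    by rewrite ler_wpM2l// -[leRHS]mul1r le1.
  move=> u; apply: le_trans (h u) _; rewrite lerD2r ler_wpM2l ?(ltW e0)//.
  by rewrite -[leRHS]mul1r le1.
Qed.

Variables (U : set_system nat) (UF : UltraFilter U).
Variables (q_ : nat -> X -> X -> R) (q : X -> X -> R).
Hypotheses (Qq_ : forall n, Q (q_ n)) (Qq : Q q)
  (qcvg : forall u, (fun n => q_ n u u) @ U --> q u u).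

Let hq_ n : psd (q_ n). Proof. exact: Qpsd. Qed.
Let hq : psd q. Proof. exact: Qpsd. Qed.

(** Pointwise convergence of the perturbations is uniform on bounded sets of the
    energy, because those are totally bounded for [m] and the perturbations are
    controlled by [m] up to an arbitrarily small part of the energy. *)
Lemma perturbation_cvg_bounded (x : X^nat) L : (forall n, a (x n) (x n) <= L) ->
  (fun n => q_ n (x n) (x n) - q (x n) (x n)) @ U --> (0 : R).
Proof.
move=> hL; have PU : ProperFilter U := @ultra_proper _ _ UF.
have [_ _ [C C0 hC] _ _ hrel _] := es.
have [D D0 hD] := perturbation_bound.
have L0 : 0 <= L by apply: le_trans (hL 0%N); exact: psd_ge0.
apply/cvgrPdist_lt => e e0.
pose eta := e ^+ 2 / (64 * (D * L + 1)).
have DL : 0 < D * L + 1 by rewrite ltr_wpDl// mulr_ge0.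
have eta0 : 0 < eta by rewrite divr_gt0 ?exprn_gt0// mulr_gt0.
have [|K K0 hK] := @Qinf (eta / (8 * (L + 1))).
  by rewrite divr_gt0// mulr_gt0// ltr_wpDl.
have [|A UA hA] := rellich_ultra (UF := UF) hm ha hrel hL (e := eta / (2 * (K + 1))).
  by rewrite divr_gt0// mulr_gt0// ltr_wpDl.
(* On [A] the points are so close that every form of [Q], and not only the
   forms at hand, sees them as nearly equal. *)
have small p i j : Q p -> A i -> A j -> p (x i - x j) (x i - x j) <= eta.
  move=> Qp Ai Aj; apply: le_trans (hK p _ Qp) _.
  have aij : a (x i - x j) (x i - x j) <= 4 * L.
    have := psd_parallelogram ha (x i) (x j).
    have := psd_ge0 ha (x i + x j); have := hL i; have := hL j; lra.
  have s1 : eta / (8 * (L + 1)) * a (x i - x j) (x i - x j) <= eta / 2.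
    rewrite mulrAC ler_pdivrMr ?mulr_gt0// ?ltr_wpDl//.
    by have := ler_wpM2l (ltW eta0) aij; lra.
  have s2 : K * m (x i - x j) (x i - x j) <= eta / 2.
    have := ltW (hA _ _ Ai Aj); rewrite ler_pdivlMr ?mulr_gt0// ?ltr_wpDl//.
    by have := psd_ge0 hm (x i - x j); nra.
  lra.
have close p i j : Q p -> A i -> A j -> `|p (x i) (x i) - p (x j) (x j)| <= e / 4.
  move=> Qp Ai Aj; have hp := Qpsd Qp.
  apply: le_trans (ler_sqr_psdB hp _ _) _.
  have b k : seminorm p (x k) <= Num.sqrt (D * L).
    rewrite ler_wsqrtr//; apply: le_trans (hD _ _ Qp) _.
    by rewrite ler_wpM2l.
  apply: (@le_trans _ _ (Num.sqrt eta * (2 * Num.sqrt (D * L + 1)))).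
    have DL1 : Num.sqrt (D * L) <= Num.sqrt (D * L + 1) by rewrite ler_wsqrtr// lerDl.
    apply: ler_pM; rewrite ?addr_ge0 ?seminorm_ge0 ?ler_wsqrtr ?small//.
    have := b i; have := b j; lra.
  rewrite mulrCA -sqrtrM ?(ltW eta0)// /eta.
  rewrite (_ : _ / _ * _ = (e / 8) ^+ 2); last by field; rewrite gt_eqF.
  by rewrite sqrtr_sqr ger0_norm; [lra|rewrite divr_ge0// ltW].
have [k Ak] := filter_ex UA.
have e4 : 0 < e / 4 by rewrite divr_gt0.
move/cvgrPdist_lt: (@qcvg (x k)) => /(_ _ e4) hk.
apply: (filterS2 _ _ UA hk) => n An /= hkn.
have h1 := close _ n k (Qq_ n) An Ak; have h2 := close _ n k Qq An Ak.
rewrite sub0r normrN.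
move: h1 h2 hkn; rewrite !ler_norml !ltr_norml => /andP[? ?] /andP[? ?] /andP[? ?].
by apply/andP; split; lra.
Qed.

(** A plane contains a unit vector orthogonal to any given vector. *)
Lemma orthogonal_combination u v w : m u u = 1 -> m v v = 1 -> m u v = 0 ->
  exists s t, [/\ s ^+ 2 + t ^+ 2 = 1, m (s *: u + t *: v) w = 0 &
     m (s *: u + t *: v) (s *: u + t *: v) = 1].
Proof.
move=> mu mv muv.
have nrm s t : s ^+ 2 + t ^+ 2 = 1 -> m (s *: u + t *: v) (s *: u + t *: v) = 1.
  move=> <-; rewrite !(psdDl hm, psdDr hm, psdZl hm, psdZr hm) (psdC hm v) mu mv muv; ring.
pose r := m u w ^+ 2 + m v w ^+ 2.
have [r0|r0] := eqVneq r 0.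
  exists 1, 0; split; rewrite ?nrm//; rewrite ?expr1n ?expr0n ?addr0//.
  rewrite scale1r scale0r addr0; apply/eqP; rewrite -sqrf_eq0; apply/eqP.
  by move: r0; rewrite /r; have := sqr_ge0 (m u w); have := sqr_ge0 (m v w); lra.
have rp : 0 < r by rewrite lt_neqAle eq_sym r0 addr_ge0 ?sqr_ge0.
have st : (m v w / Num.sqrt r) ^+ 2 + (- m u w / Num.sqrt r) ^+ 2 = 1.
  rewrite !expr_div_n sqr_sqrtr ?ltW// -mulrDl sqrrN addrC divff//.
exists (m v w / Num.sqrt r), (- m u w / Num.sqrt r); split; rewrite ?nrm//.
by rewrite (psdDl hm) !(psdZl hm); move: (Num.sqrt r)^-1 => z; ring.
Qed.

Lemma eigen_combination b lam e s t : psd b -> eigenbasis m b lam e ->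
  b (s *: e 0%N + t *: e 1%N) (s *: e 0%N + t *: e 1%N) =
  s ^+ 2 * lam 0%N + t ^+ 2 * lam 1%N.
Proof.
move=> hb [ortho eig _ _ _].
rewrite !(psdDl hb, psdDr hb, psdZl hb, psdZr hb) !eig !ortho /=; ring.
Qed.

(** Let [x n] be a combination of the first two eigenfunctions of [a + q_ n] that is
    orthogonal to [e 0]. Testing [lam 1] on [x n] and [lam_ n 0] on [e 0] bounds
    [lam 1 - lam 0] by the n-th gap, up to the errors [q_ n - q] at [x n] and at
    [e 0], which tend to zero. *)
Lemma gap_stability (lam_ : nat -> R^nat) (e_ : nat -> X^nat) lam e G :
  (forall n, eigenbasis m (fun u v => a u v + q_ n u v) (lam_ n) (e_ n)) ->
  eigenbasis m (fun u v => a u v + q u v) lam e ->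
  (fun n => lam_ n 1%N - lam_ n 0%N) @ U --> G -> lam 1%N - lam 0%N <= G.
Proof.
move=> eb_ eb gapG; have PU : ProperFilter U := @ultra_proper _ _ UF.
have [_ _ [C C0 hC] _ _ _ _] := es.
have [D D0 hD] := perturbation_bound.
have haq := psdD ha hq; have haq_ n := psdD ha (hq_ n).
(* The n-th second eigenvalues stay below [L], by testing on the span of [e 0]
   and [e 1]; this bounds the energy of [x n]. *)
pose L := 2 * (1 + D) * (a (e 0%N) (e 0%N) + a (e 1%N) (e 1%N)).
have mono n : lam_ n 0%N <= lam_ n 1%N by apply: (eb_nondecreasing (eb_ n)).
have lam1L n : lam_ n 1%N <= L.
  have [s [t [st ort nrm]]] := orthogonal_combination (e_ n 0%N) (eb_ortho eb 0 0)
    (eb_ortho eb 1 1) (eb_ortho eb 0 1).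
  have := eb_min (eb_ n) (k := 1%N) (u := s *: e 0%N + t *: e 1%N).
  rewrite nrm mulr1 => /(_ _)/le_trans; apply; first by case.
  set u := s *: _; set v := t *: _.
  have au0 := psd_ge0 ha (e 0%N); have av0 := psd_ge0 ha (e 1%N).
  have s0 := sqr_ge0 s; have t0 := sqr_ge0 t.
  have := hD _ (u + v) (Qq_ n); have := psd_parallelogram ha u v; have := psd_ge0 ha (u - v).
  have auE : a u u = s ^+ 2 * a (e 0%N) (e 0%N) by rewrite /u (psdZl ha) (psdZr ha) mulrA.
  have avE : a v v = t ^+ 2 * a (e 1%N) (e 1%N) by rewrite /v (psdZl ha) (psdZr ha) mulrA.
  have aul : a u u <= a (e 0%N) (e 0%N) by rewrite auE; nra.
  have avl : a v v <= a (e 1%N) (e 1%N) by rewrite avE; nra.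
  have aw0 := psd_ge0 ha (u + v).
  rewrite /L; nra.
pose st_ n := orthogonal_combination (e 0%N) (eb_ortho (eb_ n) 0 0)
    (eb_ortho (eb_ n) 1 1) (eb_ortho (eb_ n) 0 1).
have /choice[x hx] n : exists u, [/\ m u u = 1, m u (e 0%N) = 0 &
    a u u + q_ n u u <= lam_ n 1%N].
  have [s [t [st ort nrm]]] := st_ n.
  exists (s *: e_ n 0%N + t *: e_ n 1%N); split=> //.
  rewrite (eigen_combination s t (haq_ n) (eb_ n)).
  have l1E : lam_ n 1%N = (s ^+ 2 + t ^+ 2) * lam_ n 1%N by rewrite st mul1r.
  have := mulr_ge0 (sqr_ge0 s) (_ : 0 <= lam_ n 1%N - lam_ n 0%N).
  by rewrite subr_ge0 mono => /(_ isT); move: l1E; rewrite mulrBr mulrDl; lra.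
have axL n : a (x n) (x n) <= L.
  by have [_ _ h] := hx n; have := lam1L n; have := psd_ge0 (hq_ n) (x n); lra.
have c1 := perturbation_cvg_bounded axL.
have c2 := @qcvg (e 0%N).
have key n : lam 1%N - lam 0%N <= (lam_ n 1%N - lam_ n 0%N) -
    (q_ n (x n) (x n) - q (x n) (x n)) + (q_ n (e 0%N) (e 0%N) - q (e 0%N) (e 0%N)).
  have [mx ox ax] := hx n.
  have h1 : lam 1%N * m (x n) (x n) <= a (x n) (x n) + q (x n) (x n).
    by apply: (eb_min eb); case.
  have h0 : lam_ n 0%N * m (e 0%N) (e 0%N) <= a (e 0%N) (e 0%N) + q_ n (e 0%N) (e 0%N).
    exact: (eb_min (eb_ n)).
  have := eb_eigen eb 0%N (e 0%N); rewrite (eb_ortho eb) /= => h.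
  by move: h1 h0; rewrite mx (eb_ortho eb) /=; lra.
have cv : (fun n => (lam_ n 1%N - lam_ n 0%N) - (q_ n (x n) (x n) - q (x n) (x n)) +
    (q_ n (e 0%N) (e 0%N) - q (e 0%N) (e 0%N))) @ U --> G - 0 + (q (e 0%N) (e 0%N) - q (e 0%N) (e 0%N)).
  apply: cvgD; first exact: cvgB.
  by apply: cvgB => //; exact: cvg_cst.
rewrite subr0 subrr addr0 in cv.
apply: (ler_cvg_to (cvg_cst _) cv); exact: nearW.
Qed.

End GapStability.

(** * Weak limits as strong limits of convex combinations *)

Section WeakLimit.
Context {R : realType} {X : lmodType R}.

(** Repeated midpoints suffice here: convexity is used through the parallelogram law
    and through functionals, which only see midpoints. *)
Inductive midhull (v : X^nat) (A : set nat) : X -> Prop :=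
| midhull_base n : A n -> midhull v A (v n)
| midhull_mid x y : midhull v A x -> midhull v A y -> midhull v A (2^-1 *: (x + y)).

Lemma sub_midhull v (A B : set nat) : A `<=` B -> midhull v A `<=` midhull v B.
Proof.
move=> AB x; elim=> [n /AB|y z _ hy _ hz]; first exact: midhull_base.
exact: midhull_mid.
Qed.

Variables (b : X -> X -> R) (hb : psd b).
Hypothesis complete : forall x : X^nat, fcauchy b x -> exists l, fcvg b x l.

Variables (U : set_system nat) (UF : UltraFilter U) (v : X^nat) (C : R).
Hypothesis vC : forall n, b (v n) (v n) <= C.

Let dist2 A := inf [set b x x | x in midhull v A].

Let dist2_le A x : midhull v A x -> dist2 A <= b x x.
Proof.
move=> Ax; apply: ge_inf; last by exists x.
by exists 0 => _ [y _ <-]; exact: psd_ge0.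
Qed.

Let dist2_adh A e : U A -> 0 < e -> exists2 x, midhull v A x & b x x < dist2 A + e.
Proof.
have PU : ProperFilter U := @ultra_proper _ _ UF.
move=> /filter_ex[n An] e0.
have [|_ [x Ax <-] h] := @inf_adherent _ [set b x x | x in midhull v A] _ e0.
  split; first by exists (b (v n) (v n)); exists (v n) => //; exact: midhull_base.
  by exists 0 => _ [y _ <-]; exact: psd_ge0.
by exists x.
Qed.

Let dist2_mono A B : U A -> A `<=` B -> dist2 B <= dist2 A.
Proof.
move=> UA AB; apply/ler_addgt0Pr => e e0.
have [x Ax /ltW] := dist2_adh UA e0; apply: le_trans; apply: dist2_le.
exact: sub_midhull Ax.
Qed.

(** Among the elements of the hulls of the tails, those of almost minimal norm
    form a Cauchy family by the parallelogram law; their limit is the weak limit,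
    and it comes with a strongly convergent sequence of convex combinations. *)
Lemma weak_limit : exists V : X,
  (forall f, (fun n => b (v n) f) @ U --> b V f) /\
  exists2 W : X^nat, fcvg b W V & forall j, midhull v setT (W j).
Proof.
have PU : ProperFilter U := @ultra_proper _ _ UF.
pose S := [set dist2 A | A in U].
have Ssup : has_sup S.
  split; first by exists (dist2 setT); exists setT => //; exact: filterT.
  exists C => _ [A UA <-]; have [n An] := filter_ex UA.
  exact: le_trans (dist2_le (midhull_base v An)) (vC n).
pose d := sup S.
have dS A : U A -> dist2 A <= d by move=> UA; apply: ub_le_sup; [exact: Ssup.2|exists A].
have j0 (j : nat) : 0 < j.+1%:R^-1 :> R by rewrite invr_gt0.
have /choice[A hA] j : exists A, U A /\ d - j.+1%:R^-1 < dist2 A.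
  by have [_ [A UA <-] h] := sup_adherent (j0 j) Ssup; exists A.
(* A decreasing sequence of sets of the ultrafilter whose hulls nearly realize the
   supremum of the distances to 0. *)
pose B j : set nat := [set n | forall i : 'I_j.+1, A i n].
have UB j : U (B j) by apply: filter_forall => i; have [] := hA i.
have BB i j : (i <= j)%N -> B j `<=` B i.
  by move=> ij n h k; exact: (h (widen_ord (ij : (i.+1 <= j.+1)%N) k)).
have dB j : d - j.+1%:R^-1 < dist2 (B j).
  apply: lt_le_trans (proj2 (hA j)) _; apply: dist2_mono => // n h.
  exact: (h ord_max).
have /choice[W hW] j : exists x, midhull v (B j) x /\ b x x <= d + j.+1%:R^-1.
  have [x Bx /ltW h] := dist2_adh (UB j) (j0 j); exists x; split=> //.
  by apply: le_trans h _; rewrite lerD2r dS.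
have close j x t : midhull v (B j) x -> b x x <= d + t -> t <= j.+1%:R^-1 ->
    b (W j - x) (W j - x) <= 8 * j.+1%:R^-1.
  move=> Bx xt tj; have [BW hWj] := hW j.
  have := dist2_le (midhull_mid BW Bx); rewrite (psdZl hb) (psdZr hb).
  move: (dB j) (psd_parallelogram hb (W j) x) hWj xt tj.
  move: (dist2 _) (b (W j + x) _) (b (W j - x) _) (b (W j) _) (b x x) (j.+1%:R^-1) => dd b0 b1 b2 b3 r.
  lra.
have sqrt_small (e : R) : 0 < e -> exists N, forall j, (N <= j)%N ->
    Num.sqrt (8 * j.+1%:R^-1) < e.
  move=> e0; have e8 : 0 < e ^+ 2 / 8 by rewrite divr_gt0// exprn_gt0.
  have [N _ h] := near_infty_natSinv_lt (PosNum e8).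
  exists N => j Nj; have hj : j.+1%:R^-1 < e ^+ 2 / 8 := h _ Nj.
  rewrite -[ltRHS]gtr0_norm// -sqrtr_sqr ltr_sqrt ?exprn_gt0//.
  by rewrite mulrC -ltr_pdivlMr.
have Wcau : fcauchy b W.
  move=> e e0; have [N hN] := sqrt_small _ e0; exists N.
  suff h i j : (N <= i)%N -> (i <= j)%N -> seminorm b (W i - W j) < e.
    by move=> i j Ni Nj; have [ij|/ltnW ji] := leqP i j;
      [exact: h|rewrite seminormB// h].
  move=> Ni ij; apply: le_lt_trans (hN i Ni).
  rewrite ler_wsqrtr//; have [BWj hWj] := hW j.
  apply: close hWj _; first exact: sub_midhull (BB _ _ ij) _ BWj.
  by rewrite lef_pV2 ?posrE// ler_nat.
have [V WV] := complete Wcau.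
exists V; split; last first.
  by exists W => // j; have [h _] := hW j; apply: sub_midhull h.
move=> f.
have [l hl] : exists l : R, (fun n => b (v n) f) @ U --> l.
  apply: (@ultra_cvg_bounded _ _ _ _ _ (Num.sqrt C * seminorm b f)) => n.
  apply: le_trans (psd_cauchy_schwarz hb _ _) _.
  by rewrite ler_wpM2r ?seminorm_ge0// ler_wsqrtr.
suff -> : b V f = l by [].
apply/eqP; rewrite -subr_eq0 -normr_le0; apply/ler_addgt0Pr => e e0; rewrite add0r.
have e3 : 0 < e / 3 by rewrite divr_gt0.
have f1 : 0 < seminorm b f + 1 by rewrite ltr_wpDl// seminorm_ge0.
have e3f : 0 < e / 3 / (seminorm b f + 1) by rewrite divr_gt0.
move/cvgrPdist_lt: (fcvg_psdl (w := f) hb WV) => /(_ _ e3)[N1 _ h1].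
have [N2 h2] := sqrt_small _ e3f.
pose j := maxn N1 N2.
have /= g1 := h1 j (leq_maxl _ _); have /= g2 := h2 j (leq_maxr _ _).
move/cvgrPdist_lt: hl => /(_ _ e3) UA'.
(* Near-minimal elements of the hull of a smaller set are close to [W j], and on
   that set every [b (v n) f] is already close to [l]. *)
have UBA : U (B j `&` [set n | `|l - b (v n) f| < e / 3]) by exact: filterI.
have [x hx hxd] := dist2_adh UBA (j0 j).
have xl : `|l - b x f| <= e / 3.
  move: hx; elim=> [n [_ /ltW]//|y z _ hy _ hz].
  rewrite (psdZl hb) (psdDl hb).
  have -> : l - 2^-1 * (b y f + b z f) = 2^-1 * (l - b y f) + 2^-1 * (l - b z f) by field.
  apply: le_trans (ler_normD _ _) _; rewrite !normrM ger0_norm ?invr_ge0//; lra.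
have hxB : midhull v (B j) x by apply: sub_midhull hx; exact: subIsetl.
have hxd' : b x x <= d + j.+1%:R^-1.
  by apply: le_trans (ltW hxd) _; rewrite lerD2r dS.
have cl := close _ _ _ hxB hxd' (lexx _).
have g3 : `|b (W j) f - b x f| <= e / 3.
  rewrite -psdBl//; apply: le_trans (psd_cauchy_schwarz hb _ _) _.
  have : seminorm b (W j - x) <= e / 3 / (seminorm b f + 1).
    by apply: le_trans (ltW g2); exact: ler_wsqrtr.
  rewrite ler_pdivlMr//; have := seminorm_ge0 b (W j - x); lra.
have -> : b V f - l = (b V f - b (W j) f) + (b (W j) f - b x f) - (l - b x f) by ring.
apply: le_trans (ler_normB _ _) _; have := ler_normD (b V f - b (W j) f) (b (W j) f - b x f).
lra.
Qed.

End WeakLimit.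

(** * Real-valued integrals and square-summable functions *)

Section Integrals.
Context d (T : measurableType d) (R : realType) (mu : {measure set T -> \bar R}).
Implicit Types f g h : T -> R.

Definition summable f := mu.-integrable setT (EFin \o f).

Lemma summable_measurable f : summable f -> measurable_fun setT f.
Proof. by move=> /measurable_int/measurable_EFinP. Qed.

Lemma summableD f g : summable f -> summable g -> summable (fun x => f x + g x).
Proof. by move=> hf hg; have := integrableD measurableT hf hg. Qed.

Lemma summableZ c f : summable f -> summable (fun x => c * f x).
Proof. by move=> hf; have := integrableZl measurableT c hf. Qed.

Lemma summableB f g : summable f -> summable g -> summable (fun x => f x - g x).
Proof. by move=> hf hg; have := integrableB measurableT hf hg. Qed.

Lemma summable_le f g : measurable_fun setT f -> summable g ->
  (forall x, `|f x| <= g x) -> summable f.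
Proof.
move=> mf hg fg; apply: (le_integrable measurableT _ _ hg).
  exact/measurable_EFinP.
by move=> x _ /=; rewrite lee_fin (le_trans (fg x))// ler_norm.
Qed.

Lemma summable_norm f : summable f -> summable (fun x => `|f x|).
Proof. exact: integrable_norm. Qed.

Lemma RintD f g : summable f -> summable g ->
  \int[mu]_x (f x + g x) = \int[mu]_x f x + \int[mu]_x g x.
Proof. by move=> hf hg; exact: RintegralD. Qed.

Lemma RintB f g : summable f -> summable g ->
  \int[mu]_x (f x - g x) = \int[mu]_x f x - \int[mu]_x g x.
Proof. by move=> hf hg; exact: RintegralB. Qed.

Lemma RintZ c f : summable f -> \int[mu]_x (c * f x) = c * \int[mu]_x f x.
Proof. by move=> hf; exact: RintegralZl. Qed.

Lemma Rint_ge0 f : (forall x, 0 <= f x) -> 0 <= \int[mu]_x f x.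
Proof. by move=> h; apply: Rintegral_ge0. Qed.

Lemma Rint_le f g : summable f -> summable g -> (forall x, f x <= g x) ->
  \int[mu]_x f x <= \int[mu]_x g x.
Proof. by move=> hf hg fg; apply: le_Rintegral. Qed.

Lemma Rint_eq f g : f =1 g -> \int[mu]_x f x = \int[mu]_x g x.
Proof. by move=> fg; apply: eq_Rintegral => x _. Qed.

Lemma Rint_ae f g : measurable_fun setT f -> measurable_fun setT g ->
  {ae mu, forall x, f x = g x} -> \int[mu]_x f x = \int[mu]_x g x.
Proof.
move=> mf mg fg; congr fine; apply: ae_eq_integral => //; try exact/measurable_EFinP.
by apply: filterS fg => x -> _.
Qed.

Lemma summable_ae f g : measurable_fun setT f -> summable g ->
  {ae mu, forall x, f x = g x} -> summable f.
Proof.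
move=> mf /integrableP[mg ig] fg; apply/integrableP; split; first exact/measurable_EFinP.
rewrite (_ : (\int[mu]_x _)%E = (\int[mu]_x `|(EFin \o g) x|)%E)//.
apply: ae_eq_integral => //.
- by apply: measurableT_comp => //; exact/measurable_EFinP.
- by apply: measurableT_comp.
- by apply: filterS fg => x /= -> _.
Qed.

Lemma EFin_Rint f : summable f -> (\int[mu]_x f x)%:E = (\int[mu]_x (f x)%:E)%E.
Proof. by move=> hf; rewrite fineK//; exact: integrable_fin_num. Qed.

Lemma summable_ge0P f : measurable_fun setT f -> (forall x, 0 <= f x) ->
  summable f <-> (\int[mu]_x (f x)%:E < +oo)%E.
Proof.
move=> mf f0; split=> [/integrableP[_]|h].
  by under eq_integral do rewrite /= ger0_norm//.
apply/integrableP; split; first exact/measurable_EFinP.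
by under eq_integral do rewrite /= ger0_norm//.
Qed.

Lemma Rint0_ae f : summable f -> (forall x, 0 <= f x) ->
  \int[mu]_x f x = 0 -> {ae mu, forall x, f x = 0}.
Proof.
move=> hf f0 h; have mf := summable_measurable hf.
have : ae_eq mu setT (EFin \o f) (cst 0%E).
  apply/ae_eq_integral_abs => //; first exact/measurable_EFinP.
  under eq_integral do rewrite /= ger0_norm//.
  by rewrite -EFin_Rint// h.
by apply: filterS => x /(_ I) /= [].
Qed.

Definition square_summable f := measurable_fun setT f /\ summable (fun x => f x ^+ 2).

Lemma Lfun2P f : f \in Lfun mu 2%:E <-> square_summable f.
Proof.
split=> [h|[mf hf]].
  split; last exact: Lfun2_integrable_sqr.
  by move: h; rewrite inE => /andP[/[!inE]].
rewrite inE; apply/andP; split; rewrite inE//=.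
rewrite /finite_norm unlock poweR_lty//.
move/integrableP: hf => [_]; apply: le_lt_trans.
rewrite le_eqVlt; apply/orP; left; apply/eqP; apply: eq_integral => x _ /=.
by rewrite powR_mulrn// normrX.
Qed.

Lemma sqr_Lnorm2 f : measurable_fun setT f ->
  ('N[mu]_2%:E[EFin \o f] ^+ 2 = \int[mu]_x (f x ^+ 2)%:E)%E.
Proof.
move=> mf.
have sqrE (x : \bar R) : (0 <= x -> x ^+ 2 = x `^ 2)%E.
  case: x => [r| |]//; last by rewrite poweRyr// expeS expe1 mulyy.
  by rewrite lee_fin poweR_EFin => r0; rewrite powR_mulrn.
rewrite sqrE ?Lnorm_ge0// poweR_Lnorm//.
by apply: eq_integral => x _ /=; rewrite powR_mulrn// real_normK// num_real.
Qed.

Lemma square_summableP c f g : square_summable f -> square_summable g ->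
  square_summable (fun x => c * f x + g x).
Proof.
move=> /Lfun2P hf /Lfun2P hg; apply/Lfun2P.
by have [_ h] := @Lfun_submod_closed _ T R mu 2%:E (lee1n 2); exact: (h c f g hf hg).
Qed.

Lemma square_summableB f g : square_summable f -> square_summable g ->
  square_summable (fun x => f x - g x).
Proof.
move=> hf hg; have := square_summableP (-1) hg hf; congr square_summable.
by apply/funext => x; rewrite mulN1r addrC.
Qed.

Lemma square_summableM f g : square_summable f -> square_summable g ->
  summable (fun x => f x * g x).
Proof.
move=> [mf hf] [mg hg]; apply: (summable_le (g := fun x => f x ^+ 2 + g x ^+ 2)).
- exact: measurable_funM.
- exact: summableD.
- move=> x; rewrite normrM -[f x ^+ 2]real_normK ?num_real//.
  rewrite -[g x ^+ 2]real_normK ?num_real//.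
  have := normr_ge0 (f x); have := normr_ge0 (g x).
  have := sqr_ge0 (`|f x| - `|g x|); nra.
Qed.

Lemma square_summable_le f g : measurable_fun setT f -> square_summable g ->
  (forall x, `|f x| <= `|g x|) -> square_summable f.
Proof.
move=> mf [mg hg] fg; split=> //; apply: (summable_le _ hg).
  exact: measurable_funX.
by move=> x; rewrite normrX -[g x ^+ 2]real_normK ?num_real// lerXn2r ?nnegrE.
Qed.

Lemma square_summable_ae f g : measurable_fun setT f -> square_summable g ->
  {ae mu, forall x, f x = g x} -> square_summable f.
Proof.
move=> mf [mg hg] fg; split=> //; apply: (summable_ae _ hg).
  exact: measurable_funX.
by apply: filterS fg => x ->.
Qed.

End Integrals.

Section FiniteIntegrals.
Context d (T : measurableType d) (R : realType) (mu : {measure set T -> \bar R}).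
Hypothesis muT : (mu setT < +oo)%E.
Implicit Types f g h : T -> R.

Lemma summable_bounded f C : measurable_fun setT f -> (forall x, `|f x| <= C) ->
  summable mu f.
Proof.
move=> mf hC; apply: measurable_bounded_integrable => //.
exists C; split; first exact: num_real.
by move=> M CM x _ /=; rewrite (le_trans (hC x))// ltW.
Qed.

Lemma summable_cst c : summable mu (fun=> c).
Proof. by apply: (@summable_bounded _ `|c|) => //; exact: measurable_cst. Qed.

Lemma square_summable_bounded f C : measurable_fun setT f -> (forall x, `|f x| <= C) ->
  square_summable mu f.
Proof.
move=> mf hC; split=> //; apply: (@summable_bounded _ (C ^+ 2)).
  exact: measurable_funX.
by move=> x; rewrite normrX lerXn2r ?nnegrE// (le_trans _ (hC x)).
Qed.

Lemma square_summable_summable f : square_summable mu f -> summable mu f.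
Proof.
move=> hf; have h1 : square_summable mu (fun=> 1 : R).
  by apply: (@square_summable_bounded _ 1) => [|x]; [exact: measurable_cst|rewrite normr1].
by have := square_summableM hf h1; rewrite (_ : (fun x => _) = f)//; apply/funext => x; rewrite mulr1.
Qed.

End FiniteIntegrals.

(** * Completeness of L2 *)

Section Riesz_Fischer.
Context d (T : measurableType d) (R : realType) (mu : {measure set T -> \bar R}).
Implicit Types f g h : T -> R.

(** The sum of the absolute increments has a finite integral, hence is finite almost
    everywhere. *)
Lemma ae_cvg_summable_increments (y : nat -> T -> R) :
  (forall k, summable mu (y k)) ->
  (forall k, \int[mu]_x `|y k.+1 x - y k x| <= 1 / (2 ^ k.+1)%:R) ->
  {ae mu, forall x, cvgn (y ^~ x)}.
Proof.
move=> sy hy.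
pose D k x := `|y k.+1 x - y k x|.
have D0 k x : 0 <= D k x by exact: normr_ge0.
have sD k : summable mu (D k) by exact: (summable_norm (summableB (sy k.+1) (sy k))).
have mD k : measurable_fun setT (EFin \o D k).
  by apply/measurable_EFinP; exact: summable_measurable (sD k).
pose G x := (\sum_(k <oo) (D k x)%:E)%E.
have G0 x : (0 <= G x)%E by apply: nneseries_ge0 => k _ _; rewrite lee_fin.
have iG : mu.-integrable setT G.
  apply/integrableP; split.
    have h := @ge0_emeasurable_sum _ _ _ setT (fun k x => (D k x)%:E) xpredT.
    by apply: h => [k x _ _|k _]; [rewrite lee_fin; exact: D0|exact: mD].
  under eq_integral do rewrite gee0_abs ?G0//.
  rewrite integral_nneseries//; last by move=> k x _; rewrite lee_fin.
  apply: (@le_lt_trans _ _ 1%:E); last exact: ltry.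
  apply: le_trans (epsilon_trick0 xpredT ler01); apply: lee_nneseries.
    by move=> k _ _; apply: integral_ge0 => x _; rewrite lee_fin.
  by move=> k _; rewrite -(EFin_Rint (sD k)) lee_fin; exact: hy.
have := integrable_ae measurableT iG; apply: filterS => x /(_ I) Gx.
have c1 : cvgn [normed series (telescope (y ^~ x))].
  apply: nondecreasing_is_cvgn.
    by apply/nondecreasing_seqP => n; rewrite /normed_series_of !seriesEnat/= big_nat_recr//= lerDl.
  exists (fine (G x)) => _ [n _ <-]; rewrite -lee_fin fineK//.
  rewrite /normed_series_of seriesEnat/= -sumEFin.
  by apply: (nneseries_lim_ge (u_ := fun k => (D k x)%:E)) => k _; rewrite lee_fin D0.
have /normed_cvg c2 := c1.
rewrite (_ : y ^~ x = (fun n => y 0%N x + series (telescope (y ^~ x)) n)).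
  by apply: is_cvgD => //; exact: is_cvg_cst.
by apply/funext => n; rewrite -eq_sum_telescope.
Qed.

Hypothesis muT : (mu setT < +oo)%E.

(** Fatou for squares, with the conclusion that the limit is square summable. *)
Lemma fatou_sqr (y : nat -> T -> R) h c : (forall n, measurable_fun setT (y n)) ->
  measurable_fun setT h -> (forall n, square_summable mu (y n)) ->
  {ae mu, forall x, y ^~ x @ \oo --> h x} ->
  (\forall n \near \oo, \int[mu]_x (y n x ^+ 2) <= c) ->
  square_summable mu h /\ \int[mu]_x (h x ^+ 2) <= c.
Proof.
move=> my mh sy yh hc.
have mh2 : measurable_fun setT (fun x => h x ^+ 2) by exact: measurable_funX.
have le : (\int[mu]_x (h x ^+ 2)%:E <= c%:E)%E.
  have := @fatou _ _ _ mu setT measurableT (fun n x => (y n x ^+ 2)%:E).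
  move=> /(_ _ _)/le_trans.
  have -> : (\int[mu]_x (h x ^+ 2)%:E = \int[mu]_x limn_einf (fun n => (y n x ^+ 2)%:E))%E.
    apply: ae_eq_integral => //; first exact/measurable_EFinP.
      apply: measurableT_comp => //; apply: measurable_fun_limn_esup => n.
      by apply: measurableT_comp => //; apply/measurable_EFinP; exact: measurable_funX.
    apply: filterS yh => x yx _.
    have c1 : (fun n => (y n x ^+ 2)%:E) @ \oo --> (h x ^+ 2)%:E.
      apply: cvg_EFin; first exact: nearW.
      by rewrite expr2; under eq_fun do rewrite /= expr2; exact: cvgM.
    by have [-> _] := cvg_limn_einf_sup c1.
  apply => //.
  - by move=> n; apply/measurable_EFinP; exact: measurable_funX.
  - by move=> n x _; rewrite lee_fin sqr_ge0.
  apply: le_trans (limn_einf_sup _) _; rewrite limn_esup_lim.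
  apply: lime_le; first exact: is_cvg_esups.
  have [N _ hN] := hc; near=> n.
  apply: ge_ereal_sup => _ [k /= nk <-].
  rewrite -EFin_Rint ?lee_fin; last by have [] := sy k.
  apply: hN => /=; apply: leq_trans nk; near: n; exact: nbhs_infty_ge.
have sh : summable mu (fun x => h x ^+ 2).
  apply/(summable_ge0P mu mh2); first by move=> x; exact: sqr_ge0.
  by apply: le_lt_trans le _; exact: ltry.
by split=> //; rewrite -lee_fin EFin_Rint.
Unshelve. all: by end_near. Qed.

(** A subsequence with fast decaying L2 increments has summable L1 increments, as
    the measure is finite; it converges almost everywhere, and Fatou identifies its
    limit as the L2 limit of the whole sequence. *)
Lemma Riesz_Fischer (f : nat -> T -> R) : (forall n, square_summable mu (f n)) ->
  (forall e : R, 0 < e -> exists N, forall i j, (N <= i)%N -> (N <= j)%N ->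
    \int[mu]_x ((f i x - f j x) ^+ 2) < e) ->
  exists g, [/\ square_summable mu g,
    forall e : R, 0 < e -> exists N, forall i, (N <= i)%N ->
      \int[mu]_x ((f i x - g x) ^+ 2) < e &
    exists2 s : nat -> nat, (forall n, (n <= s n)%N) &
      {ae mu, forall x, (fun n => f (s n) x) @ \oo --> g x}].
Proof.
move=> sf fcau.
pose m0 : R := fine (mu setT).
have m00 : 0 <= m0 by exact: fine_ge0.
(* Weights of Young's inequality [2 |h| <= c h^2 + 1 / c], chosen to make both
   integrals at most [2 ^ - (k + 2)]. *)
pose c k : R := (m0 + 1) * (2 ^ k.+1)%:R.
have p2 k : 0 < (2 ^ k.+1)%:R :> R by rewrite ltr0n expn_gt0.
have c0 k : 0 < c k by rewrite mulr_gt0// ltr_wpDl.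
have /choice[t ht] k : exists N, forall i j, (N <= i)%N -> (N <= j)%N ->
    \int[mu]_x ((f i x - f j x) ^+ 2) < (c k * (2 ^ k.+1)%:R)^-1.
  by apply: fcau; rewrite invr_gt0 mulr_gt0.
pose s k := (k + \sum_(i < k.+1) t i)%N.
have st k j : (j <= k)%N -> (t j <= s k)%N.
  move=> jk; rewrite /s (bigD1 (Ordinal (jk : (j < k.+1)%N)))//= addnCA.
  exact: leq_addr.
have sk k : (k <= s k)%N by exact: leq_addr.
have L1 h k : square_summable mu h -> \int[mu]_x (h x ^+ 2) <= (c k * (2 ^ k.+1)%:R)^-1 ->
    \int[mu]_x `|h x| <= 1 / (2 ^ k.+1)%:R.
  move=> sh hh; have [mh ih] := sh.
  apply: (@le_trans _ _ (\int[mu]_x ((c k / 2) * h x ^+ 2 + (c k)^-1 / 2))).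
    apply: Rint_le.
    - by apply: summable_norm; exact: square_summable_summable.
    - by apply: summableD; [exact: summableZ|exact: summable_cst].
    - move=> x; rewrite -[h x ^+ 2]real_normK ?num_real//.
      have := sqr_ge0 (c k * `|h x| - 1); have := c0 k.
      move: `|h x| (c k) => a b b0 hab.
      rewrite -(@ler_pM2l _ (2 * b)) ?mulr_gt0//.
      have -> : 2 * b * (b / 2 * a ^+ 2 + b^-1 / 2) = b ^+ 2 * a ^+ 2 + 1.
        by field; rewrite gt_eqF.
      lra.
  rewrite (RintD (summableZ _ ih) (summable_cst muT _)) (RintZ _ ih).
  rewrite Rintegral_cst//= -/m0.
  have h1 : c k / 2 * \int[mu]_x (h x ^+ 2) <= 1 / (2 ^ k.+1)%:R / 2.
    apply: le_trans (ler_wpM2l _ hh) _; first by rewrite divr_ge0// ltW.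
    by rewrite le_eqVlt; apply/orP; left; apply/eqP; field; rewrite !gt_eqF.
  have h2 : (c k)^-1 / 2 * m0 <= 1 / (2 ^ k.+1)%:R / 2.
    have -> : (c k)^-1 / 2 * m0 = m0 / (m0 + 1) * (1 / (2 ^ k.+1)%:R / 2).
      by rewrite /c; field; rewrite !gt_eqF// ltr_wpDl.
    apply: ler_piMl; first by rewrite !divr_ge0// ltW.
    by rewrite ler_pdivrMr ?mul1r ?lerDl// ltr_wpDl.
  lra.
have sB i j : square_summable mu (fun x => f i x - f j x) by exact: square_summableB.
have ae_cv : {ae mu, forall x, cvgn (fun n => f (s n) x)}.
  apply: (ae_cvg_summable_increments (y := fun n => f (s n))) => k.
    exact: square_summable_summable.
  apply: (L1 (fun x => f (s k.+1) x - f (s k) x)) => //.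
  by apply/ltW/ht; [rewrite st|rewrite st].
pose g x := fine (limn_esup (fun n => (f (s n) x)%:E)).
have mf n : measurable_fun setT (f n) by have [] := sf n.
have mg : measurable_fun setT g.
  apply: measurableT_comp => //; apply: measurable_fun_limn_esup => n.
  exact/measurable_EFinP.
have ae_g : {ae mu, forall x, (fun n => f (s n) x) @ \oo --> g x}.
  apply: filterS ae_cv => x cx.
  suff -> : g x = limn (fun n => f (s n) x) by [].
  have c1 : (fun n => (f (s n) x)%:E) @ \oo --> (limn (fun n => f (s n) x))%:E.
    by apply: cvg_EFin => //; exact: nearW.
  by rewrite /g; have [_ ->] := cvg_limn_einf_sup c1.
have close e : 0 < e -> exists N, forall i, (N <= i)%N ->
    square_summable mu (fun x => f i x - g x) /\ \int[mu]_x ((f i x - g x) ^+ 2) <= e.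
  move=> e0; have [N hN] := fcau e e0; exists N => i Ni.
  apply: (@fatou_sqr (fun n x => f i x - f (s n) x)) => //.
  - by move=> n; exact: measurable_funB.
  - exact: measurable_funB.
  - by apply: filterS ae_g => x cx; apply: cvgB => //; exact: cvg_cst.
  - near=> n; apply/ltW/hN => //; apply: leq_trans (sk n); near: n; exact: nbhs_infty_ge.
exists g; split; last by exists s.
- have [N hN] := close 1 ltr01; have [h _] := hN N (leqnn _).
  have := square_summableB (sf N) h; congr square_summable.
  by apply/funext => x; rewrite subKr.
- move=> e e0; have e2 : 0 < e / 2 by rewrite divr_gt0.
  have [N hN] := close _ e2; exists N => i /hN[_ h]; apply: le_lt_trans h _; lra.
Unshelve. all: by end_near. Qed.

End Riesz_Fischer.

(** * The space L2 as a space with a form *)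

Section PullbackForm.
Context d (T : measurableType d) (R : realType) (mu : {measure set T -> \bar R}).

(** All forms of the proof arise this way: [i] is a multiplication by a weight or a
    potential, or a weighted weak derivative, and is only linear almost
    everywhere. *)
Lemma psd_pullback (X : lmodType R) (i : X -> T -> R) :
  (forall u, square_summable mu (i u)) ->
  (forall c u v, {ae mu, forall x, i (c *: u + v) x = c * i u x + i v x}) ->
  psd (fun u v => \int[mu]_x (i u x * i v x)).
Proof.
move=> si li; split.
- by move=> u v; apply: Rint_eq => x; rewrite mulrC.
- move=> c u v w; have [mu_ _] := si u; have [mv _] := si v; have [mw _] := si w.
  have sum1 := square_summableM (si u) (si w); have sum2 := square_summableM (si v) (si w).
  transitivity (\int[mu]_x (c * (i u x * i w x) + i v x * i w x)).
    apply: Rint_ae.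
    - by apply: measurable_funM => //; have [] := si (c *: u + v).
    - by apply: summable_measurable; apply: summableD sum2; exact: summableZ.
    - by apply: filterS (li c u v) => x ->; ring.
  by rewrite (RintD (summableZ c sum1) sum2) (RintZ c sum1).
- by move=> u; apply: Rint_ge0 => x; rewrite -expr2 sqr_ge0.
Qed.

Definition L2 := LfunType mu (lee1n 2).

Lemma L2_square_summable (f : L2) : square_summable mu f.
Proof. by apply/Lfun2P; exact: LfunP. Qed.

Definition toL2 f (sf : square_summable mu f) : L2 := Lfun_Sub (lee1n 2) ((Lfun2P mu f).2 sf).

Definition inner (f g : L2) : R := \int[mu]_x (f x * g x).

Lemma inner_psd : psd inner.
Proof.
apply: (@psd_pullback L2 (fun f => (f : T -> R))).
  exact: L2_square_summable.
by move=> c u v; apply: nearW.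
Qed.

Lemma Rint_cauchy_schwarz f g : square_summable mu f -> square_summable mu g ->
  (\int[mu]_x (f x * g x)) ^+ 2 <= \int[mu]_x (f x ^+ 2) * \int[mu]_x (g x ^+ 2).
Proof.
move=> sf sg; have := psd_cauchy_schwarz_sqr inner_psd (toL2 sf) (toL2 sg).
have e h : \int[mu]_x (h x ^+ 2) = \int[mu]_x (h x * h x).
  by apply: Rint_eq => x; rewrite expr2.
by rewrite !e.
Qed.

Hypothesis muT : (mu setT < +oo)%E.

Lemma inner_complete (x : nat -> L2) : fcauchy inner x -> exists l, fcvg inner x l /\
  exists2 s : nat -> nat, (forall n, (n <= s n)%N) &
    {ae mu, forall z, (fun n => x (s n) z) @ \oo --> l z}.
Proof.
have innerE (f g : L2) : inner (f - g) (f - g) = \int[mu]_z ((f z - g z) ^+ 2).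
  by apply: Rint_eq => z; rewrite expr2.
move=> xcau.
have [|e e0|g [sg cg [s sn aes]]] := @Riesz_Fischer _ _ _ mu muT (fun n => (x n : T -> R)).
- by move=> n; exact: L2_square_summable.
- have e1 : 0 < Num.sqrt e by rewrite sqrtr_gt0.
  have [N hN] := xcau _ e1; exists N => i j Ni Nj.
  by have := hN i j Ni Nj; rewrite ltr_sqrt// innerE.
exists (toL2 sg); split; last by exists s.
move=> e e0; have [N hN] := cg _ (exprn_gt0 2 e0).
exists N => i Ni; rewrite -[ltRHS]gtr0_norm// -sqrtr_sqr ltr_sqrt ?exprn_gt0//.
by rewrite innerE; exact: hN.
Qed.

End PullbackForm.

(** * Integration over the unit square *)

Section Dominated.
Context d (T : measurableType d) (R : realType) (mu : {measure set T -> \bar R}).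

Lemma Rint_dominated (f_ : nat -> T -> R) (f g : T -> R) :
  (forall n, measurable_fun setT (f_ n)) -> measurable_fun setT f ->
  summable mu g -> (forall x, f_ ^~ x @ \oo --> f x) ->
  (forall n x, `|f_ n x| <= g x) ->
  summable mu f /\ (fun n => \int[mu]_x f_ n x) @ \oo --> \int[mu]_x f x.
Proof.
move=> mf_ mf hg cf fg.
have := @dominated_convergence _ _ _ mu setT measurableT (fun n => EFin \o f_ n)
  (EFin \o f) (EFin \o g).
case=> //.
- by move=> n; exact/measurable_EFinP.
- exact/measurable_EFinP.
- by apply: nearW => x _; apply: cvg_EFin; [exact: nearW|exact: cf].
- by apply: nearW => x n _ /=; rewrite lee_fin.
move=> sf _ cv; split=> //.
by apply: fine_cvg; rewrite EFin_Rint//.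
Qed.

End Dominated.

Section Plane.
Context {R : realType}.
Local Notation plane := (measurableTypeR R * measurableTypeR R)%type.

(** An open set of the plane is a countable union of rational rectangles. *)
Lemma open_measurable2 (O : set (R * R)) : open O -> measurable (O : set plane).
Proof.
move=> oO.
pose rect (a b c d : rat) : set plane :=
  `]ratr a, ratr b[%classic `*` `]ratr c, ratr d[%classic.
pose F a b c d := if `[< rect a b c d `<=` O >] then rect a b c d else set0.
have -> : O = \bigcup_a \bigcup_b \bigcup_c \bigcup_d F a b c d.
  apply/seteqP; split=> [[x y] Oxy|z [a _ [b _ [c _ [d _]]]]]; last first.
    by rewrite /F; case: ifPn => [/asboolP h /h|].
  have [e /= e0 he] : nbhs_ball (x, y) O by rewrite nbhs_ballE; exact: oO.
  have lt1 (t : R) : t - e < t by rewrite ltrBlDr ltrDl.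
  have lt2 (t : R) : t < t + e by rewrite ltrDl.
  have [a ha] := rat_in_itvoo (lt1 x); have [b hb] := rat_in_itvoo (lt2 x).
  have [c hc] := rat_in_itvoo (lt1 y); have [d hd] := rat_in_itvoo (lt2 y).
  move: ha hb hc hd; rewrite !in_itv/= => /andP[a1 a2] /andP[b1 b2] /andP[c1 c2] /andP[d1 d2].
  exists a => //; exists b => //; exists c => //; exists d => //.
  have Fr : rect a b c d `<=` O.
    move=> [s t] [/=]; rewrite !in_itv/= => /andP[s1 s2] /andP[t1 t2].
    by apply: he; split=> /=; rewrite /ball/= ltr_norml; apply/andP; split; lra.
  rewrite /F (asboolT Fr); split=> /=; rewrite in_itv/=; apply/andP; split=> //.
apply: bigcupT_measurable_rat => a; apply: bigcupT_measurable_rat => b.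
apply: bigcupT_measurable_rat => c; apply: bigcupT_measurable_rat => d.
by rewrite /F; case: ifP => // _; apply: measurableX; exact: measurable_itv.
Qed.

Lemma continuous_measurable2 (f : R * R -> R) : continuous f ->
  measurable_fun (setT : set plane) f.
Proof.
move=> /continuousP cf; apply: (measurability _ (RGenOpens.measurableE R)).
move=> _ [_ [a [b ->]] <-]; rewrite setTI; apply: open_measurable2.
exact/cf/interval_open.
Qed.

(** Working with a probability on the line makes the restriction of the plane measure
    to the square a genuine product measure ([muOE]). *)
Definition unif : probability (measurableTypeR R) R := uniform_prob (@ltr01 R).

Lemma unifE (A : set R) : measurable A -> unif A = lebesgue_measure (A `&` `]0, 1[).
Proof.
move=> mA.
have -> : unif A = lebesgue_measure (A `&` `[0, 1]).
  transitivity (\int[lebesgue_measure]_(x in A) (uniform_pdf 0 1 x)%:E)%E; first by [].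
  rewrite integral_uniform_pdf (eq_integral (fun=> 1%:E)); last first.
    move=> x; rewrite inE => -[_] /=; rewrite in_itv/= /uniform_pdf => ->.
    by rewrite subr0 invr1.
  by rewrite integral_cst ?mul1e//; apply: measurableI => //; exact: measurable_itv.
have mI : measurable (A `&` `]0, 1[) by apply: measurableI => //; exact: measurable_itv.
have mI' : measurable (A `&` `[0, 1]) by apply: measurableI => //; exact: measurable_itv.
apply/eqP; rewrite eq_le; apply/andP; split; last first.
  apply: le_measure; rewrite ?inE//; apply: setIS.
  exact: subset_itv_oo_cc.
have m01 : measurable ([set 0] `|` [set 1] : set R) by apply: measurableU.
have mU : measurable ((A `&` `]0, 1[) `|` ([set 0] `|` [set 1])) by apply: measurableU.
apply: (@le_trans _ _ (lebesgue_measure ((A `&` `]0, 1[) `|` ([set 0] `|` [set 1])))).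
  apply: le_measure; rewrite ?inE//.
  move=> x [Ax]; rewrite /= in_itv/= !le_eqVlt => /andP[/orP[/eqP<-|x0] /orP[/eqP x1|x1]];
    try (by right; left); try (by right; right).
  by left; split=> //=; rewrite in_itv/= x0.
apply: le_trans (measureU2 _ _ _) _ => //.
rewrite -[leRHS]adde0 leeD2l//; apply: le_trans (measureU2 _ _ _) _ => //.
have h (a : R) : ((@lebesgue_measure R) [set a] <= 0)%E by rewrite lebesgue_measure_set1.
by apply: le_trans (leeD (h 0) (h 1)) _; rewrite adde0.
Qed.

Lemma muOE (A : set plane) : measurable A -> muO A = (unif \x unif)%E A.
Proof.
move=> mA; apply/esym; apply: product_measure_unique => // B C mB mC.
transitivity (lebesgue_measure (B `&` `]0%R, 1%R[) * lebesgue_measure (C `&` `]0%R, 1%R[))%E;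
  last by congr (_ * _)%E; apply/esym; exact: unifE.
transitivity ((@lebesgue_measure R \x @lebesgue_measure R)%E
    ((B `*` C) `&` Omega)); first by [].
rewrite /Omega -setXI product_measure1E//; apply: measurableI => //; exact: measurable_itv.
Qed.

Lemma muO_setT : muO (setT : set plane) = 1%:E.
Proof.
rewrite muOE// -setXTT product_measure1E//.
have h : unif setT = 1%E by exact: probability_setT.
by rewrite [X in (X * _)%E]h [X in (_ * X)%E]h mule1.
Qed.

Lemma muO_lty : (muO (setT : set plane) < +oo)%E.
Proof. by rewrite muO_setT ltry. Qed.

Lemma ae_Omega : {ae (@muO R), forall z : plane, Omega z}.
Proof.
exists (~` Omega); split; first by apply: measurableC; exact: measurable_Omega.
  by rewrite /muO /= /mrestr setICl measure0.
by [].
Qed.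

Lemma muO_integral (f : plane -> \bar R) :
  (\int[muO]_z f z = \int[(unif \x unif)%E]_z f z)%E.
Proof. by apply: eq_measure_integral => A mA _; exact: muOE. Qed.

Lemma muO_tonelli1 (f : plane -> \bar R) : measurable_fun setT f ->
  (forall z, (0 <= f z)%E) ->
  (\int[muO]_z f z = \int[unif]_x \int[unif]_y f (x, y))%E.
Proof. by move=> mf f0; rewrite muO_integral fubini_tonelli1. Qed.

Lemma muO_tonelli2 (f : plane -> \bar R) : measurable_fun setT f ->
  (forall z, (0 <= f z)%E) ->
  (\int[muO]_z f z = \int[unif]_y \int[unif]_x f (x, y))%E.
Proof. by move=> mf f0; rewrite muO_integral fubini_tonelli2. Qed.

Lemma unif_integral (f : R -> \bar R) : measurable_fun setT f ->
  (forall x, (0 <= f x)%E) ->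
  (\int[unif]_x f x = \int[lebesgue_measure]_(x in `[0%R, 1%R]) f x)%E.
Proof. by move=> mf f0; rewrite integral_uniform// subr0 invr1 mul1e. Qed.

End Plane.

(** * Smooth bumps on the line *)

Section SmoothLine.
Context {R : realType}.
Implicit Types (f g : R -> R) (P : {poly R}).

Fixpoint times_differentiable n f : Prop :=
  if n is m.+1 then exists2 f' : R -> R, (forall x : R, is_derive x (1 : R) f (f' x)) & times_differentiable m f'
  else True.

Definition smooth1 f := forall n, times_differentiable n f.

Lemma times_differentiable_pred n f : times_differentiable n.+1 f -> times_differentiable n f.
Proof. by elim: n f => [//|n IH] f [f' df] /IH; exists f'. Qed.

Lemma times_differentiableD n f g : times_differentiable n f -> times_differentiable n g ->
  times_differentiable n (fun x => f x + g x).
Proof.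
elim: n f g => [//|n IH] f g [f' df hf] [g' dg hg].
exists (fun x => f' x + g' x); last exact: IH.
move=> x; exact: (is_deriveD (df x) (dg x)).
Qed.

Lemma times_differentiable_cst n (c : R) : times_differentiable n (fun=> c).
Proof. by elim: n c => [//|n IH] c; exists (fun=> 0) => // x; exact: is_derive_cst. Qed.

Lemma times_differentiableM n f g : times_differentiable n f -> times_differentiable n g ->
  times_differentiable n (fun x => f x * g x).
Proof.
elim: n f g => [//|n IH] f g hf hg.
have := times_differentiable_pred hf; have := times_differentiable_pred hg.
case: hf hg => [f' df hf'] [g' dg hg'] hg hf.
exists (fun x => f x * g' x + g x * f' x).
  by move=> x; exact: (is_deriveM (df x) (dg x)).
by apply: times_differentiableD; apply: IH.
Qed.

Lemma times_differentiable_affine n f (a b : R) : times_differentiable n f ->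
  times_differentiable n (fun x => f (a * x + b)).
Proof.
elim: n f => [//|n IH] f [f' df hf].
exists (fun x => f' (a * x + b) * a).
  move=> x; apply: (@is_derive1_comp _ f (fun x => a * x + b)) => //.
  have h := is_deriveD (is_deriveZ a (is_derive_id x 1)) (is_derive_cst b x 1).
  by have := h; rewrite scaler1 addr0.
apply: times_differentiableM; [exact: IH|exact: times_differentiable_cst].
Qed.

Lemma smooth1_derive f : smooth1 f ->
  (forall x : R, is_derive x (1 : R) f ('D_1 f x)) /\ smooth1 (fun x => 'D_1 f x).
Proof.
move=> hf; split.
  by have [f' df _] := hf 1%N; move=> x; have [h ->] := df x; have [] := df x.
move=> n; have [f' df hf'] := hf n.+1.
rewrite (_ : (fun x => _) = f')//; apply/funext => x; exact: derive_val.
Qed.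

(** The family [P (1/t) exp (-1/t)] is stable under differentiation and every
    member is [O (t ^ 2)] at [0], which makes [exp (-1/t)] smooth across [0]. *)
Definition flat P (t : R) := if 0 < t then P.[t^-1] * expR (- t^-1) else 0.

Lemma expr_le_expR k (s : R) : 0 < s -> s ^+ k <= k`!%:R * expR s.
Proof.
move=> s0; case: k => [|k].
  by rewrite expr0 mul1r; have := expR_ge1Dx s; lra.
have := expR_ge1Dxn k (ltW s0) => h.
rewrite mulrC -ler_pdivrMr ?ltr0n ?fact_gt0//; lra.
Qed.

(** The exponential dominates every polynomial. *)
Lemma horner_le_expR P k : exists2 C : R, 0 <= C &
  forall s, 0 < s -> `|P.[s]| * s ^+ k <= C * expR s.
Proof.
elim/poly_ind: P k => [|p c IH] k.
  by exists 0 => // s _; rewrite horner0 normr0 !mul0r.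
have [C C0 hC] := IH k.+1.
exists (C + `|c| * k`!%:R); first by rewrite addr_ge0// mulr_ge0.
move=> s s0; rewrite hornerMXaddC.
have sk : 0 <= s ^+ k by rewrite exprn_ge0// ltW.
apply: le_trans (ler_wpM2r sk (ler_normD _ _)) _.
rewrite mulrDl mulrDl normrM (gtr0_norm s0) -mulrA -exprS lerD ?hC//.
by rewrite -mulrA ler_wpM2l// expr_le_expR.
Qed.

Lemma flat_le P : exists2 C : R, 0 <= C & forall t, `|flat P t| <= C * t ^+ 2.
Proof.
have [C C0 hC] := horner_le_expR P 2.
exists C => // t; rewrite /flat; case: ifPn => [t0|_]; last first.
  by rewrite normr0 mulr_ge0// sqr_ge0.
have s0 : 0 < t^-1 by rewrite invr_gt0.
have := hC _ s0; rewrite normrM (gtr0_norm (expR_gt0 _)) expRN.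
rewrite -ler_pdivlMr ?exprn_gt0// => h.
rewrite ler_pdivrMr ?expR_gt0//; apply: le_trans h _.
by rewrite -exprVn invrK mulrAC.
Qed.

Lemma flat_derive P (t : R) : is_derive t (1 : R) (flat P) (flat ('X^2 * (P - P^`())) t).
Proof.
have [t0|t0|t0] := ltgtP t 0.
- rewrite {2}/flat ltNge ltW//=.
  apply: (@near_eq_is_derive _ _ _ (fun=> 0)).
  have := lt_nbhsl t0; apply: filterS => x /= x0.
  by rewrite /flat ltNge ltW.
- rewrite {2}/flat t0.
  have tn : t != 0 by rewrite gt_eqF.
  apply: (@near_eq_is_derive _ _ _ ((horner P \o (fun y => y^-1)) * (expR \o (fun y => - y^-1)))).
    by have := lt_nbhsr t0; apply: filterS => x /= x0; rewrite /flat x0.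
  have D1 : is_derive t (1 : R) (fun y : R => y^-1) (- t ^- 2).
    by have := is_deriveV tn (is_derive_id t 1); rewrite scaler1.
  have D2 := is_derive1_comp (is_derive_poly P t^-1) D1.
  have D3 := @is_derive1_comp _ expR (fun y => - y^-1) t _ _ (is_derive_expR _) (is_deriveN D1).
  have := is_deriveM D2 D3; congr is_derive.
  rewrite /= !hornerE /= -exprVn opprK /GRing.scale /=; ring.
- rewrite t0 {2}/flat ltxx.
  have [C C0 hC] := flat_le P.
  have cv : (fun h => h^-1 *: ((flat P \o shift 0) (h *: 1) - flat P 0)) @ 0^' --> (0 : R).
    apply/cvgr0Pnorm_lt => e e0.
    have d0 : 0 < e / (C + 1) by rewrite divr_gt0// ltr_wpDl.
    near=> h.
    have hn : h != 0 by near: h; exact: nbhs_dnbhs_neq.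
    have he : `|h| < e / (C + 1).
      near: h; apply: dnbhs0_lt => //.
    rewrite /= addr0 {2}/flat ltxx subr0 scaler1 normrZ normfV.
    rewrite mulrC ltr_pdivrMr ?normr_gt0//.
    apply: le_lt_trans (hC h) _; rewrite -[h ^+ 2]real_normK ?num_real//.
    have nh : 0 < `|h| by rewrite normr_gt0.
    rewrite expr2 mulrA ltr_pM2r//.
    move: he; rewrite ltr_pdivlMr ?ltr_wpDl//; nra.
  by split; [exact: cvgP cv|exact: cvg_lim cv].
Unshelve. all: by end_near. Qed.

Lemma flat_smooth P : smooth1 (flat P).
Proof.
move=> n; elim: n P => [//|n IH] P; exists (flat ('X^2 * (P - P^`()))) => // x.
exact: flat_derive.
Qed.

(** The factor [n.+1] steepens the bump, so that the bumps tend pointwise to the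
    indicator of the open interval. *)
Definition bump (n : nat) (a b t : R) :=
  flat 1 (n.+1%:R * t + - (n.+1%:R * a)) * flat 1 (- n.+1%:R * t + n.+1%:R * b).

Lemma bumpE n a b t : bump n a b t = flat 1 (n.+1%:R * (t - a)) * flat 1 (n.+1%:R * (b - t)).
Proof. by rewrite /bump; congr (flat 1 _ * flat 1 _); ring. Qed.

Lemma bump_smooth n a b : smooth1 (bump n a b).
Proof.
move=> k; apply: times_differentiableM; apply: times_differentiable_affine; exact: flat_smooth.
Qed.

Lemma flat1E t : flat 1 t = if 0 < t then expR (- t^-1) else 0.
Proof. by rewrite /flat hornerC mul1r. Qed.

Lemma flat1_itv t : 0 <= flat 1 t <= 1.
Proof.
rewrite flat1E; case: ifPn => [t0|_]; last by rewrite lexx ler01.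
by rewrite expR_ge0 /= -expR0 ler_expR oppr_le0 invr_ge0 ltW.
Qed.

Lemma bump_itv n a b t : 0 <= bump n a b t <= 1.
Proof.
have /andP[h1 h2] := flat1_itv (n.+1%:R * t + - (n.+1%:R * a)).
have /andP[h3 h4] := flat1_itv (- n.+1%:R * t + n.+1%:R * b).
by rewrite /bump mulr_ge0//= mulr_ile1.
Qed.

Lemma bump_out n a b t : ~~ (a < t < b) -> bump n a b t = 0.
Proof.
have n0 : 0 < n.+1%:R :> R by rewrite ltr0n.
rewrite negb_and -!leNgt => /orP[ta|bt]; rewrite bumpE !flat1E.
  by rewrite pmulr_rgt0// subr_gt0 ltNge ta mul0r.
by rewrite [X in _ * (if X then _ else _)]pmulr_rgt0// subr_gt0 [t < b]ltNge bt/= mulr0.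
Qed.

Lemma bump_gt0 n a b t : a < t < b -> 0 < bump n a b t.
Proof.
have n0 : 0 < n.+1%:R :> R by rewrite ltr0n.
have flat0 u : 0 < u -> 0 < flat 1 (n.+1%:R * u).
  by move=> u0; rewrite flat1E pmulr_rgt0// u0 expR_gt0.
by move=> /andP[at_ tb]; rewrite bumpE mulr_gt0// flat0 ?subr_gt0.
Qed.

Lemma bump_cvg a b t : a < t < b -> (fun n => bump n a b t) @ \oo --> (1 : R).
Proof.
move=> /andP[at_ tb].
have flat_cvg u : 0 < u -> (fun n => flat 1 (n.+1%:R * u)) @ \oo --> (1 : R).
  move=> u0; rewrite (_ : (fun n => _) = (fun n => expR (- (u^-1 * n.+1%:R^-1)))); last first.
    by apply/funext => n; rewrite flat1E pmulr_rgt0 ?ltr0n// u0 invfM mulrC.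
  rewrite [X in _ --> X](_ : _ = expR (- (u^-1 * 0))); last by rewrite mulr0 oppr0 expR0.
  apply: continuous_cvg; first exact: continuous_expR.
  by apply: cvgN; apply: cvgM; [exact: cvg_cst|exact: cvg_harmonic].
rewrite -[X in _ --> X]mulr1.
rewrite (_ : (fun n => _) = (fun n => flat 1 (n.+1%:R * (t - a)) * flat 1 (n.+1%:R * (b - t)))); last first.
  by apply/funext => n; rewrite bumpE.
by apply: cvgM; apply: flat_cvg; rewrite subr_gt0.
Qed.

End SmoothLine.

(** * Calculus on the unit interval *)

Section OneDimCalculus.
Context {R : realType}.
Local Notation U := (@unif R).
Implicit Types (f : R -> R).

Lemma unif_lty : (U setT < +oo)%E.
Proof. by rewrite [X in (X < _)%E](_ : _ = 1%E) ?ltry//; exact: probability_setT. Qed.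

Lemma is_derive_continuous f (f' : R -> R) : (forall u : R, is_derive u (1 : R) f (f' u)) ->
  continuous f.
Proof.
move=> df u; apply/differentiable_continuous/derivable1_diffP.
by have [] := df u.
Qed.

(** The derivative is split as a difference of two nonnegative derivatives, to which
    the theorem for nonnegative integrals applies. *)
Lemma unif_FTC f (f' : R -> R) C s x : (forall u : R, is_derive u (1 : R) f (f' u)) ->
  continuous f' -> (forall u, `|f' u| <= C) -> 0 <= s -> s < x -> x <= 1 ->
  \int[U]_u (f' u * \1_(`[s, x]%classic : set R) u) = f x - f s.
Proof.
move=> df cf' hC s0 sx x1.
have mI : measurable_fun setT (\1_(`[s, x]%classic : set R) : R -> R).
  by apply: measurable_indic; exact: measurable_itv.
have mf' : measurable_fun setT f' by exact: continuous_measurable_fun.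
have I01 u : 0 <= (\1_(`[s, x]%classic : set R) u : R) <= 1.
  by rewrite indicE; case: (_ \in _); rewrite lexx ler01.
have nonneg (g g' : R -> R) : (forall u : R, is_derive u (1 : R) g (g' u)) ->
    continuous g' -> (forall u, 0 <= g' u) ->
    \int[U]_u (g' u * \1_(`[s, x]%classic : set R) u) = g x - g s.
  move=> dg cg' g'0; rewrite /Rintegral unif_integral; last 2 first.
  - apply/measurable_EFinP; apply: measurable_funM => //; exact: continuous_measurable_fun.
  - by move=> u; rewrite lee_fin mulr_ge0//; case/andP: (I01 u).
  have -> : (\int[lebesgue_measure]_(u in `[0%R, 1%R]) (g' u * \1_(`[s, x]%classic : set R) u)%:E =
      \int[lebesgue_measure]_(u in `[s, x]) (g' u)%:E)%E.
    rewrite integral_mkcond [RHS]integral_mkcond; apply: eq_integral => u _.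
    rewrite !patchE indicE; case: ifPn => h1; case: ifPn => h2; rewrite ?mulr1 ?mulr0//.
    case/negP: h1; move: h2; rewrite !inE /= !in_itv/= => /andP[? ?].
    by apply/andP; split; lra.
  rewrite (@continuous_FTC2 _ g' g) ?EFinB//.
  - exact: continuous_subspaceT.
  - have cg := is_derive_continuous dg.
    split; first by move=> u _; have [] := dg u.
      by apply: cvg_at_right_filter; exact: cg.
    by apply: cvg_at_left_filter; exact: cg.
  - by move=> u _; rewrite derive1E; have [_ ->] := dg u.
have C0 : 0 <= C by apply: le_trans (hC 0).
have bnd (h : R -> R) D : measurable_fun setT h -> (forall u, `|h u| <= D) ->
    summable U (fun u => h u * \1_(`[s, x]%classic : set R) u).
  move=> mh hD; apply: (summable_bounded unif_lty (C := D)); first exact: measurable_funM.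
  move=> u; rewrite normrM; apply: le_trans (hD u); apply: ler_piMr => //.
  by have /andP[h0 h1] := I01 u; rewrite ger0_norm.
(* Adding [C] makes the derivative nonnegative. *)
have dC : forall u : R, is_derive u (1 : R) (fun t => C * t) C.
  by move=> u; have := is_deriveZ C (is_derive_id u (1 : R)); rewrite scaler1.
have e1 := nonneg (fun t => f t + C * t) (fun t => f' t + C).
have e2 := nonneg (fun t => C * t) (fun=> C) dC (fun u => cvg_cst _) (fun=> C0).
have sC : summable U (fun u => C * \1_(`[s, x]%classic : set R) u).
  by apply: (bnd (fun=> C) C) => // u; rewrite ger0_norm.
have sf' : summable U (fun u => f' u * \1_(`[s, x]%classic : set R) u) by exact: bnd.
have : \int[U]_u ((f' u + C) * \1_(`[s, x]%classic : set R) u) = f x + C * x - (f s + C * s).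
  apply: (e1 (fun u => is_deriveD (df u) (dC u))) => u.
  - by apply: cvgD; [exact: cf'|exact: cvg_cst].
  - by have := hC u; rewrite ler_norml => /andP[? ?]; lra.
rewrite (@Rint_eq _ _ _ U _ (fun u => f' u * \1_(`[s, x]%classic : set R) u + C * \1_(`[s, x]%classic : set R) u)); last first.
  by move=> u; rewrite mulrDl.
by rewrite (RintD sf' sC) e2; lra.
Qed.

(** Cauchy-Schwarz for the integral of the derivative between the two points. *)
Lemma unif_oscillation f (f' : R -> R) C s x : (forall u : R, is_derive u (1 : R) f (f' u)) ->
  continuous f' -> (forall u, `|f' u| <= C) -> 0 <= s <= 1 -> 0 <= x <= 1 ->
  (f x - f s) ^+ 2 <= `|x - s| * \int[U]_u (f' u ^+ 2).
Proof.
move=> df cf' hC.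
have mf' : measurable_fun setT f' by exact: continuous_measurable_fun.
wlog sx : s x / s < x.
  move=> h hs hx; have [sx|xs|->] := ltgtP s x; first exact: h.
    by rewrite -sqrrN opprB distrC; exact: h.
  by rewrite subrr expr0n mulr_ge0// Rint_ge0// => u; rewrite sqr_ge0.
move=> /andP[s0 _] /andP[_ x1]; rewrite -(unif_FTC df cf' hC s0 sx x1).
have mI : measurable_fun setT (\1_(`[s, x]%classic : set R) : R -> R).
  by apply: measurable_indic; exact: measurable_itv.
have sI : square_summable U (\1_(`[s, x]%classic : set R) : R -> R).
  apply: (square_summable_bounded unif_lty (C := 1)) => // u.
  by rewrite indicE; case: (_ \in _); rewrite ?normr1 ?normr0.
have sf : square_summable U f' by exact: (square_summable_bounded unif_lty (C := C)).
apply: le_trans (Rint_cauchy_schwarz sf sI) _.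
rewrite mulrC ler_wpM2r ?Rint_ge0// => [u|]; first exact: sqr_ge0.
have dI : forall u : R, is_derive u (1 : R) (fun t : R => t) 1 by move=> u; exact: is_derive_id.
have n1 (u : R) : `|1 : R| <= 1 by rewrite normr1.
rewrite gtr0_norm ?subr_gt0// -(unif_FTC dI (fun u => cvg_cst _) n1 s0 sx x1).
rewrite le_eqVlt; apply/orP; left; apply/eqP; apply: Rint_eq => u.
by rewrite indicE mul1r; case: (_ \in _); rewrite ?expr1n ?expr0n.
Qed.

Lemma unif_FTC0 f (f' : R -> R) C : (forall u : R, is_derive u (1 : R) f (f' u)) ->
  continuous f' -> (forall u, `|f' u| <= C) -> f 0 = f 1 -> \int[U]_u f' u = 0.
Proof.
move=> df cf' hC f01.
have mf' : measurable_fun setT f' by exact: continuous_measurable_fun.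
rewrite -(subrr (f 1)) -[in X in _ - X]f01 -(unif_FTC df cf' hC (lexx 0) ltr01 (lexx 1)).
apply: Rint_ae => //.
  by apply: measurable_funM => //; apply: measurable_indic; exact: measurable_itv.
exists (~` `[0, 1]%classic); split; first by apply: measurableC; exact: measurable_itv.
  apply: (eq_trans (unifE _)); first by apply: measurableC; exact: measurable_itv.
  rewrite (_ : _ `&` _ = set0) ?measure0//.
  apply/seteqP; split=> // u [h1 h2]; apply: h1; exact: subset_itv_oo_cc h2.
move=> u /= h; apply: contra_not h; rewrite indicE => h.
by rewrite mem_set// mulr1.
Qed.


End OneDimCalculus.

(** * Test functions *)

Section TestFunctions.
Context {R : realType}.
Implicit Types (f g phi psi : R * R -> R) (b c : R -> R).

(** Statements about partial derivatives are made once for both directions. *)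
Definition coordinate (e : R * R) := e = ex \/ e = ey.

Lemma slice_exE f x y :
  (fun h : R => h^-1 *: ((f \o shift (x, y)) (h *: ex) - f (x, y))) =
  (fun h : R => h^-1 *: (((fun s => f (s, y)) \o shift x) (h *: (1 : R)) - f (x, y))).
Proof.
apply/funext => h; congr (_ *: (f _ - _)).
by rewrite /shift /=; congr pair; rewrite /= scaler0 add0r.
Qed.

Lemma slice_eyE f x y :
  (fun h : R => h^-1 *: ((f \o shift (x, y)) (h *: ey) - f (x, y))) =
  (fun h : R => h^-1 *: (((fun s => f (x, s)) \o shift y) (h *: (1 : R)) - f (x, y))).
Proof.
apply/funext => h; congr (_ *: (f _ - _)).
by rewrite /shift /=; congr pair; rewrite /= scaler0 add0r.
Qed.

Lemma is_derive_slice_ex f x y d : is_derive (x, y) ex f d <->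
  is_derive x (1 : R) (fun s => f (s, y)) d.
Proof.
by split=> -[h1 h2]; split; move: h1 h2; rewrite /derivable /derive slice_exE.
Qed.

Lemma is_derive_slice_ey f x y d : is_derive (x, y) ey f d <->
  is_derive y (1 : R) (fun s => f (x, s)) d.
Proof.
by split=> -[h1 h2]; split; move: h1 h2; rewrite /derivable /derive slice_eyE.
Qed.

Definition iterated_partial f (s : seq bool) :=
  foldr (fun d => partial (if d then ex else ey)) f s.

Lemma smoothP f : smooth f <-> forall s, [/\ continuous (iterated_partial f s),
  forall z, derivable (iterated_partial f s) z ex &
  forall z, derivable (iterated_partial f s) z ey].
Proof. by []. Qed.

Lemma partialP (e : R * R) (k : R) f g z : derivable f z e -> derivable g z e ->
  partial e (fun z => k * f z + g z) z = k * partial e f z + partial e g z.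
Proof.
move=> df dg; have := is_deriveD (is_deriveZ k (derivableP df)) (derivableP dg).
by case=> _ h; exact: h.
Qed.

Lemma smooth_linear (k : R) f g : smooth f -> smooth g -> smooth (fun z => k * f z + g z).
Proof.
move=> /smoothP sf /smoothP sg; apply/smoothP => s.
have -> : iterated_partial (fun z => k * f z + g z) s =
    (fun z => k * iterated_partial f s z + iterated_partial g s z).
  elim: s => [//|d s IH] /=; rewrite IH; apply/funext => z.
  have [_ fx fy] := sf s; have [_ gx gy] := sg s.
  by case: d; rewrite partialP.
have [cf fx fy] := sf s; have [cg gx gy] := sg s; split.
- by move=> z; apply: cvgD; [apply: cvgM; [exact: cvg_cst|exact: cf]|exact: cg].
- by move=> z; have [] := is_deriveD (is_deriveZ k (derivableP (fx z))) (derivableP (gx z)).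
- by move=> z; have [] := is_deriveD (is_deriveZ k (derivableP (fy z))) (derivableP (gy z)).
Qed.

Definition tensor b c (z : R * R) : R := b z.1 * c z.2.

Lemma tensor_partial b c : smooth1 b -> smooth1 c ->
  (forall z, is_derive z ex (tensor b c) (tensor (fun x => 'D_1 b x) c z)) /\
  (forall z, is_derive z ey (tensor b c) (tensor b (fun x => 'D_1 c x) z)).
Proof.
move=> /smooth1_derive[db _] /smooth1_derive[dc _]; split=> -[x y].
  apply/is_derive_slice_ex; rewrite /tensor /=.
  have -> : 'D_1 b x * c y = b x *: 0 + c y *: 'D_1 b x by rewrite scaler0 add0r mulrC.
  exact: (is_deriveM (db x) (is_derive_cst (c y) x (1 : R))).
apply/is_derive_slice_ey; rewrite /tensor /=.
have -> : b x * 'D_1 c y = b x *: 'D_1 c y + c y *: 0 by rewrite scaler0 addr0.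
exact: (is_deriveM (is_derive_cst (b x) y (1 : R)) (dc y)).
Qed.

Lemma smooth1_continuous b : smooth1 b -> continuous b.
Proof. by move=> /smooth1_derive[db _]; exact: is_derive_continuous db. Qed.

(** Iterated partial derivatives of a tensor product are again tensor products. *)
Lemma tensor_smooth b c : smooth1 b -> smooth1 c -> smooth (tensor b c).
Proof.
move=> sb sc; apply/smoothP => s.
have [b' [c' [-> sb' sc']]] : exists b' c',
    [/\ iterated_partial (tensor b c) s = tensor b' c', smooth1 b' & smooth1 c'].
  elim: s => [|d s [b' [c' [IH sb' sc']]]]; first by exists b, c.
  have [hx hy] := tensor_partial sb' sc'.
  case: d => /=; rewrite IH.
    exists (fun x => 'D_1 b' x), c'; split=> //; last by have [] := smooth1_derive sb'.
    by apply/funext => z; have [] := hx z.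
  exists b', (fun x => 'D_1 c' x); split=> //; last by have [] := smooth1_derive sc'.
  by apply/funext => z; have [] := hy z.
have [hx hy] := tensor_partial sb' sc'; split.
- move=> z; apply: cvgM.
    by apply: continuous_comp; [exact: cvg_fst|exact: (smooth1_continuous sb')].
  by apply: continuous_comp; [exact: cvg_snd|exact: (smooth1_continuous sc')].
- by move=> z; have [] := hx z.
- by move=> z; have [] := hy z.
Qed.

Definition support f := closure [set z : R * R | f z != 0].

Lemma support_sub f (K : set (R * R)) : compact K -> (forall z, ~ K z -> f z = 0) ->
  support f `<=` K /\ compact (support f).
Proof.
move=> cK fK.
have clK : closed K by apply: compact_closed => //; exact: norm_hausdorff.
have sub : support f `<=` K.
  move=> z /(closureS (B := K)) h; rewrite ((closure_id K).1 clK); apply: h => t /= ft.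
  by apply: contrapT => /fK t0; rewrite t0 eqxx in ft.
by split=> //; apply: (subclosed_compact _ cK sub); exact: closed_closure.
Qed.

Lemma test_function_linear (k : R) phi psi : test_function phi -> test_function psi ->
  test_function (fun z => k * phi z + psi z).
Proof.
move=> [s1 c1 i1] [s2 c2 i2].
have [|sub cmp] := @support_sub (fun z => k * phi z + psi z) _ (compactU c1 c2).
  move=> z /not_orP[z1 z2].
  have -> : phi z = 0.
    by apply: contrapT => /eqP h; apply: z1; exact: subset_closure.
  have -> : psi z = 0.
    by apply: contrapT => /eqP h; apply: z2; exact: subset_closure.
  by rewrite mulr0 addr0.
split; [exact: smooth_linear|exact: cmp|].
by apply: subset_trans sub _; rewrite subUset.
Qed.

Lemma bump_test_function n (a b c d : R) : 0 < a -> b < 1 -> 0 < c -> d < 1 ->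
  test_function (tensor (bump n a b) (bump n c d)).
Proof.
move=> a0 b1 c0 d1.
have cK : compact (`[a, b]%classic `*` `[c, d]%classic : set (R * R)).
  by apply: compact_setX; exact: segment_compact.
have [|sub cmp] := @support_sub (tensor (bump n a b) (bump n c d)) _ cK.
  move=> [x y] /= /not_andP[h|h]; rewrite /tensor /=.
    rewrite (@bump_out _ n a b x) ?mul0r//.
    by apply/negP => /andP[h1 h2]; apply: h; rewrite /= in_itv/= !ltW.
  rewrite (@bump_out _ n c d y) ?mulr0//.
  by apply/negP => /andP[h1 h2]; apply: h; rewrite /= in_itv/= !ltW.
split; [by apply: tensor_smooth; exact: bump_smooth|exact: cmp|].
apply: subset_trans sub _ => -[x y] [] /=; rewrite !in_itv/= => /andP[? ?] /andP[? ?].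
by split; rewrite /= in_itv/=; apply/andP; split; lra.
Qed.

Section OneTestFunction.
Variables (phi : R * R -> R) (hphi : test_function phi).

Lemma tf_continuous : continuous phi.
Proof. by have [/(_ [::])[]] := hphi. Qed.

Lemma tf_derivable e z : coordinate e -> derivable phi z e.
Proof. by have [/(_ [::])[_ h1 h2] _ _] := hphi; case=> ->. Qed.

Lemma tf_partial_continuous e : coordinate e -> continuous (partial e phi).
Proof.
have [s _ _] := hphi.
by case=> ->; [have [c _ _] := s [:: true]; exact: c|have [c _ _] := s [:: false]; exact: c].
Qed.

Lemma tf_measurable : measurable_fun setT (phi : measurableTypeR R * measurableTypeR R -> R).
Proof. by apply: continuous_measurable2; exact: tf_continuous. Qed.

Lemma tf_partial_measurable e : coordinate e ->
  measurable_fun setT (partial e phi : measurableTypeR R * measurableTypeR R -> R).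
Proof. by move=> he; apply: continuous_measurable2; exact: tf_partial_continuous. Qed.

Lemma tf_out z : ~ support phi z -> phi z = 0.
Proof. by move=> h; apply: contrapT => /eqP h'; apply: h; exact: subset_closure. Qed.

Lemma tf_partial_out e z : ~ support phi z -> partial e phi z = 0.
Proof.
move=> h; rewrite /partial (@near_eq_derive _ _ _ phi (cst 0)) ?derive_cst//.
have op : open (~` support phi) by rewrite openC; exact: closed_closure.
have : nbhs z (~` support phi) by exact: open_nbhs_nbhs.
by apply: filterS => t; exact: tf_out.
Qed.

Lemma compact_support_bounded f : continuous f -> (forall z, ~ support phi z -> f z = 0) ->
  exists C, forall z, `|f z| <= C.
Proof.
move=> cf f0; have [_ cK _] := hphi.
have /compact_bounded[M [_ hM]] : compact (f @` support phi).
  by apply: continuous_compact => //; exact: continuous_subspaceT.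
exists (`|M| + 1) => z; have [Kz|nKz] := pselect (support phi z).
  by apply: (hM (`|M| + 1)); [rewrite ltr_pwDr// ler_norm|exists z].
by rewrite f0// normr0 addr_ge0.
Qed.

Lemma tf_bounded : exists C, forall z, `|phi z| <= C.
Proof. by apply: compact_support_bounded; [exact: tf_continuous|exact: tf_out]. Qed.

Lemma tf_partial_bounded e : coordinate e -> exists C, forall z, `|partial e phi z| <= C.
Proof.
move=> he; apply: compact_support_bounded; first exact: tf_partial_continuous.
by move=> z; exact: tf_partial_out.
Qed.

End OneTestFunction.

(** On a compact part of the square the coordinates stay away from 0, so that the
    weights are bounded below there. *)
Lemma compact_margin (K : set (R * R)) : compact K -> K `<=` Omega ->
  exists2 d : R, 0 < d & forall z, K z -> d <= z.1 /\ d <= z.2.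
Proof.
move=> cK KO.
have one (p : R * R -> R) : continuous p -> (forall z, K z -> 0 < p z) ->
    exists2 d : R, 0 < d & forall z, K z -> d <= p z.
  move=> cp p0.
  have cpK : compact (p @` K).
    by apply: continuous_compact => //; exact: continuous_subspaceT.
  have clK : closed (p @` K) by apply: compact_closed => //; exact: norm_hausdorff.
  have : nbhs (0 : R) (~` (p @` K)).
    apply: open_nbhs_nbhs; split; first by rewrite openC.
    by move=> [z /p0 + h]; rewrite h ltxx.
  rewrite -nbhs_ballE => -[e /= e0 he]; exists e => // z Kz.
  rewrite leNgt; apply/negP => ze; apply: (he (p z)); last by exists z.
  by rewrite /ball/= sub0r normrN gtr0_norm// p0.
have [d1 d10 h1] := one fst (fun z => cvg_fst) (fun z Kz => proj1 (andP (KO z Kz).1)).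
have [d2 d20 h2] := one snd (fun z => cvg_snd) (fun z Kz => proj1 (andP (KO z Kz).2)).
exists (Num.min d1 d2); first by rewrite lt_min d10.
by move=> z Kz; rewrite !ge_min h1// h2// orbT.
Qed.

End TestFunctions.

(** * Integration by parts *)

Section ByParts.
Context {R : realType}.
Local Notation plane := (measurableTypeR R * measurableTypeR R)%type.
Implicit Types (f g phi psi : R * R -> R).

Lemma muO_bounded_summable (f : plane -> R) C : measurable_fun setT f ->
  (forall z, `|f z| <= C) -> summable muO f.
Proof. exact: (summable_bounded muO_lty). Qed.

Lemma muO_slices0 (g : plane -> R) C : measurable_fun setT g -> (forall z, `|g z| <= C) ->
  (forall y, \int[@unif R]_x g (x, y) = 0) \/ (forall x, \int[@unif R]_y g (x, y) = 0) ->
  \int[muO]_z g z = 0.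
Proof.
move=> mg hC h0; rewrite /Rintegral muO_integral.
have ig : (unif \x unif)%E.-integrable setT (EFin \o g).
  apply: measurable_bounded_integrable => //.
    by have h := @muO_lty R; rewrite (muOE measurableT) in h.
  exists C; split; first exact: num_real.
  by move=> M CM x _ /=; rewrite (le_trans (hC x))// ltW.
case: h0 => h0.
  rewrite -(integral21_prod_meas1 ig) (eq_integral (cst 0%E)) ?integral0//.
  move=> y _; transitivity ((\int[@unif R]_x g (x, y))%:E); last by rewrite h0.
  rewrite EFin_Rint//.
  apply: (summable_bounded unif_lty (C := C)) => //.
  by apply: (measurableT_comp mg); exact: pair2_measurable.
rewrite -(integral12_prod_meas1 ig) (eq_integral (cst 0%E)) ?integral0//.
move=> x _; transitivity ((\int[@unif R]_y g (x, y))%:E); last by rewrite h0.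
rewrite EFin_Rint//.
apply: (summable_bounded unif_lty (C := C)) => //.
by apply: (measurableT_comp mg); exact: pair1_measurable.
Qed.

Lemma tf_boundary phi x y : test_function phi -> ~ Omega (x, y) -> phi (x, y) = 0.
Proof. by move=> [_ _ h] nO; apply: tf_out => /h. Qed.

Lemma slice_continuous1 f y : continuous f -> continuous (fun x => f (x, y)).
Proof.
move=> cf x; apply: (continuous_comp (f := fun x => (x, y)) (g := f)); last exact: cf.
exact: (@cvg_pair _ _ _ (nbhs x) (nbhs x) (nbhs y) _ _ _ id (cst y) cvg_id (cvg_cst _)).
Qed.

Lemma slice_continuous2 f x : continuous f -> continuous (fun y => f (x, y)).
Proof.
move=> cf y; apply: (continuous_comp (f := fun y => (x, y)) (g := f)); last exact: cf.
exact: (@cvg_pair _ _ _ (nbhs y) (nbhs x) (nbhs y) _ _ _ (cst x) id (cvg_cst _) cvg_id).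
Qed.

Lemma tf_slice_ex phi : test_function phi -> forall y x : R,
  is_derive x (1 : R) (fun s => phi (s, y)) (partial ex phi (x, y)).
Proof.
move=> h y x; apply/is_derive_slice_ex; apply: derivableP; apply: tf_derivable => //.
by left.
Qed.

Lemma tf_slice_ey phi : test_function phi -> forall x y : R,
  is_derive y (1 : R) (fun s => phi (x, s)) (partial ey phi (x, y)).
Proof.
move=> h x y; apply/is_derive_slice_ey; apply: derivableP; apply: tf_derivable => //.
by right.
Qed.

(** The derivative of a product of test functions has null integral on every slice. *)
Lemma tf_by_parts e phi psi : coordinate e -> test_function phi -> test_function psi ->
  \int[muO]_z (phi z * partial e psi z) = - \int[muO]_z (partial e phi z * psi z).
Proof.
move=> he hphi hpsi.
have [C1 b1] := tf_bounded hphi; have [C2 b2] := tf_bounded hpsi.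
have [C3 b3] := tf_partial_bounded hphi he; have [C4 b4] := tf_partial_bounded hpsi he.
have m1 := tf_measurable hphi; have m2 := tf_measurable hpsi.
have m3 := tf_partial_measurable hphi he; have m4 := tf_partial_measurable hpsi he.
have c1 := tf_continuous hphi; have c2 := tf_continuous hpsi.
have c3 := tf_partial_continuous hphi he; have c4 := tf_partial_continuous hpsi he.
pose g z := phi z * partial e psi z + psi z * partial e phi z.
have bg z : `|g z| <= C1 * C4 + C2 * C3.
  apply: le_trans (ler_normD _ _) _; rewrite !normrM.
  by apply: lerD; apply: ler_pM.
have cg : continuous g.
  by move=> z; apply: cvgD; apply: cvgM; [exact: c1|exact: c4|exact: c2|exact: c3].
have g0 : \int[muO]_z g z = 0.
  apply: (@muO_slices0 g (C1 * C4 + C2 * C3)) => //; first exact: continuous_measurable2.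
  have nO (t : R) : ~ (0 < 0 < t) by rewrite ltxx.
  have dM (f f' h h' : R -> R) : (forall u : R, is_derive u (1 : R) f (f' u)) ->
      (forall u : R, is_derive u (1 : R) h (h' u)) ->
      forall u : R, is_derive u (1 : R) (fun t => f t * h t) (f u * h' u + h u * f' u).
    by move=> df dh u; exact: (is_deriveM (df u) (dh u)).
  case: he => ee; [left=> y|right=> x].
    apply: (@unif_FTC0 _ (fun x => phi (x, y) * psi (x, y)) (fun x => g (x, y)) (C1 * C4 + C2 * C3)) => //.
    - move=> x; rewrite /g ee; apply: (dM (fun x => phi (x, y)) (fun x => partial ex phi (x, y))
        (fun x => psi (x, y)) (fun x => partial ex psi (x, y))); exact: tf_slice_ex.
    - exact: slice_continuous1.
    - rewrite !(tf_boundary hphi) ?mul0r// => -[]/=; rewrite in_itv/= ?ltxx ?andbF//.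
  apply: (@unif_FTC0 _ (fun y => phi (x, y) * psi (x, y)) (fun y => g (x, y)) (C1 * C4 + C2 * C3)) => //.
  - move=> y; rewrite /g ee; apply: (dM (fun y => phi (x, y)) (fun y => partial ey phi (x, y))
        (fun y => psi (x, y)) (fun y => partial ey psi (x, y))); exact: tf_slice_ey.
  - exact: slice_continuous2.
  - rewrite !(tf_boundary hphi) ?mul0r// => -[_]/=; rewrite in_itv/= ?ltxx ?andbF//.
have s1 : summable muO (fun z => phi z * partial e psi z).
  apply: (@muO_bounded_summable _ (C1 * C4)); first exact: measurable_funM.
  by move=> z; rewrite normrM; apply: ler_pM.
have s2 : summable muO (fun z => psi z * partial e phi z).
  apply: (@muO_bounded_summable _ (C2 * C3)); first exact: measurable_funM.
  by move=> z; rewrite normrM; apply: ler_pM.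
apply/eqP; rewrite -addr_eq0 -g0 /g (RintD s1 s2); apply/eqP; congr (_ + _).
by apply: Rint_eq => z; rewrite mulrC.
Qed.

Lemma compact_measurable2 (K : set (R * R)) : compact K -> measurable (K : set plane).
Proof.
move=> cK; rewrite -[K]setCK; apply: measurableC; apply: open_measurable2.
by rewrite openC; apply: compact_closed => //; exact: norm_hausdorff.
Qed.

Lemma summable_locally_integrable f : summable muO f -> locally_integrable_Omega f.
Proof.
move=> sf; split; first exact: summable_measurable sf.
move=> K cK _; apply: integrableS sf => //; exact: compact_measurable2.
Qed.

Lemma tf_weak_derivative e phi : coordinate e -> test_function phi ->
  weak_derivative e phi (partial e phi).
Proof.
move=> he hphi; split; last by move=> psi hpsi; exact: tf_by_parts.
apply: summable_locally_integrable; have [C hC] := tf_partial_bounded hphi he.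
by apply: (@muO_bounded_summable _ C) => //; exact: tf_partial_measurable.
Qed.

End ByParts.

(** * Functions with null integral over every rectangle *)

Section NullSets.
Context d (T : measurableType d) (R : realType) (mu : {measure set T -> \bar R}).
Variables (f : T -> R) (sf : summable mu f).

(** Sets of null charge for the signed measure of density [f]; they form a lambda
    system. *)
Definition charge_null : set (set T) :=
  [set E | measurable E /\ \int[mu]_z (f z * \1_E z) = 0].

Let mf : measurable_fun setT f. Proof. exact: summable_measurable sf. Qed.

Let indic01 (E : set T) z : 0 <= (\1_E z : R) <= 1.
Proof. by rewrite indicE; case: (_ \in _); rewrite lexx ler01. Qed.

Let m_indic (E : set T) : measurable E -> measurable_fun setT (fun z => f z * \1_E z).
Proof. by move=> mE; apply: measurable_funM => //; exact: measurable_indic. Qed.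

Let le_indic (E : set T) z : `|f z * \1_E z| <= `|f z|.
Proof.
by have /andP[h0 h1] := indic01 E z; rewrite normrM (ger0_norm h0) ler_piMr.
Qed.

Lemma summable_indic (E : set T) : measurable E -> summable mu (fun z => f z * \1_E z).
Proof.
by move=> mE; apply: (summable_le (m_indic mE) (summable_norm sf)); exact: le_indic.
Qed.

Lemma charge_null_setD : setSD_closed charge_null.
Proof.
move=> A B BA [mA A0] [mB B0]; split; first exact: measurableD.
transitivity (\int[mu]_z (f z * \1_A z) - \int[mu]_z (f z * \1_B z));
  last by rewrite A0 B0 subrr.
rewrite -(RintB (summable_indic mA) (summable_indic mB)); apply: Rint_eq => z.
rewrite !indicE in_setD; case: (boolP (z \in B)) => zB /=; rewrite ?andbT ?andbF.
  by rewrite (mem_set (BA _ (set_mem zB))) subrr mulr0.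
by rewrite mulr0 subr0.
Qed.

Lemma charge_null_ndseq : ndseq_closed charge_null.
Proof.
move=> F ndF hF.
have mF n : measurable (F n) by have [] := hF n.
have mU : measurable (\bigcup_n F n) by exact: bigcup_measurable.
split=> //.
have [|_ cv] := Rint_dominated (fun n => m_indic (mF n)) (m_indic mU) (summable_norm sf) _
    (fun n z => le_indic (F n) z).
  move=> z; have [[n _ Fnz]|nz] := pselect ((\bigcup_n F n) z).
    apply: (@cvg_near_cst _ _ _ _ _ _) => //.
    near=> k; have nk : (n <= k)%N by near: k; exact: nbhs_infty_ge.
    have /subsetPset/(_ z Fnz) Fkz := ndF _ _ nk.
    by rewrite !indicE (mem_set Fkz) mem_set//; exists n.
  rewrite (_ : (fun n => _) = cst (f z * \1_(\bigcup_n F n) z)); first exact: cvg_cst.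
  apply/funext => n; rewrite !indicE memNset; last by move=> h; apply: nz; exists n.
  by rewrite memNset.
rewrite (_ : (fun n => _) = cst 0) in cv; last first.
  by apply/funext => n; have [] := hF n.
by apply: (@norm_cvg_unique _ _ _ _ _ _ cv); exact: cvg_cst.
Unshelve. all: by end_near. Qed.

Lemma charge_null_ae : (forall E, measurable E -> charge_null E) ->
  {ae mu, forall z, f z = 0}.
Proof.
move=> h.
have mP : measurable [set z | 0 < f z].
  by rewrite -[X in measurable X]setTI; exact: measurable_fun_ltr.
have mN : measurable [set z | f z < 0].
  by rewrite -[X in measurable X]setTI; exact: measurable_fun_ltr.
have [_ P0] := h _ mP; have [_ N0] := h _ mN.
have aeP := Rint0_ae (summable_indic mP) _ P0.
have aeN := Rint0_ae (summableZ (-1) (summable_indic mN)) _ _.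
have hP : {ae mu, forall z, f z * \1_[set z | 0 < f z] z = 0}.
  apply: aeP => z; rewrite indicE; case: (boolP (z \in _)) => [|_]; last by rewrite mulr0.
  by rewrite inE /= mulr1 => /ltW.
have hN : {ae mu, forall z, -1 * (f z * \1_[set z | f z < 0] z) = 0}.
  apply: aeN => [z|]; last by rewrite (RintZ _ (summable_indic mN)) N0 mulr0.
  rewrite indicE; case: (boolP (z \in _)) => [|_]; last by rewrite !mulr0.
  by rewrite inE /= mulr1; lra.
apply: filterS2 hP hN => z.
rewrite !indicE; case: (ltgtP (f z) 0) => fz.
- by rewrite [_ \in [set z | f z < 0]]mem_set//=; lra.
- by rewrite [_ \in [set z | 0 < f z]]mem_set//=; lra.
- by [].
Qed.

End NullSets.

Section PlaneNullSets.
Context {R : realType}.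
Local Notation plane := (measurableTypeR R * measurableTypeR R)%type.

Lemma lambda_system_R (H : set (set R)) : H setT -> setSD_closed H -> ndseq_closed H ->
  (forall a b : R, H `]a, b[%classic) -> forall A : set (measurableTypeR R), measurable A -> H A.
Proof.
move=> HT HD Hnd Hab A.
have -> : measurable A = (@RGenOpens.G R).-sigma.-measurable A.
  by rewrite -RGenOpens.measurableE.
move: A; apply: (@lambda_system_subset _ (@RGenOpens.G R) _ setT H) => //.
- move=> _ _ [a [b ->]] [c [d0 ->]]; exists (Num.max a c), (Num.min b d0).
  by apply/seteqP; split=> x /=; rewrite !in_itv/= gt_max lt_min;
    [move=> [/andP[-> ->] /andP[-> ->]]|move=> /andP[/andP[-> ->] /andP[-> ->]]].
- by move=> _ [a [b ->]].
Qed.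

Lemma itvoo_bigcup : \bigcup_n `](- n%:R), n%:R[%classic = [set: R].
Proof.
apply/seteqP; split=> // x _; exists (Num.bound `|x|) => //=; rewrite in_itv/= -ltr_norml.
by apply: archi_boundP.
Qed.

Variables (f : plane -> R) (mu : {measure set plane -> \bar R}) (sf : summable mu f).
Hypothesis f_rect : forall a b c d : R,
  \int[mu]_z (f z * \1_(`]a, b[%classic `*` `]c, d[%classic) z) = 0.

Let null := charge_null mu f.

Let ndC (B : set R) : nondecreasing_seq (fun n => `](- n%:R), n%:R[%classic `*` B : set (R * R)).
Proof.
move=> m n mn; apply/subsetPset => -[x y] [/= + By]; rewrite !in_itv/= => /andP[h1 h2].
have := mn; rewrite -(ler_nat R) => h; split=> //=; rewrite ?in_itv/=; apply/andP; split; lra.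
Qed.

Let ndC' (B : set R) : nondecreasing_seq (fun n => B `*` `](- n%:R), n%:R[%classic : set (R * R)).
Proof.
move=> m n mn; apply/subsetPset => -[x y] [/= By +]; rewrite !in_itv/= => /andP[h1 h2].
have := mn; rewrite -(ler_nat R) => h; split=> //=; rewrite ?in_itv/=; apply/andP; split; lra.
Qed.

Let nullT1 (B : set R) : (forall a b : R, null (`]a, b[%classic `*` B)) -> null (setT `*` B).
Proof.
move=> h; rewrite -itvoo_bigcup.
have -> : \bigcup_n `](- n%:R), n%:R[%classic `*` B = \bigcup_n (`](- n%:R), n%:R[%classic `*` B) :> set (R * R).
  by apply/seteqP; split=> [[x y] [[n _ nx] By]|[x y] [n _ [nx By]]]; [exists n|split=> //; exists n].
by apply: (charge_null_ndseq sf); [exact: ndC|move=> i; exact: h].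
Qed.

Let nullT2 (B : set R) : (forall a b : R, null (B `*` `]a, b[%classic)) -> null (B `*` setT).
Proof.
move=> h; rewrite -itvoo_bigcup.
have -> : B `*` \bigcup_n `](- n%:R), n%:R[%classic = \bigcup_n (B `*` `](- n%:R), n%:R[%classic) :> set (R * R).
  by apply/seteqP; split=> [[x y] [By [n _ nx]]|[x y] [n _ [By nx]]]; [exists n|split=> //; exists n].
by apply: (charge_null_ndseq sf); [exact: ndC'|move=> i; exact: h].
Qed.

Let setXD1 (A B C : set R) : (A `\` B) `*` C = (A `*` C) `\` (B `*` C).
Proof.
apply/seteqP; split=> [[x y] [[/= ? nB] ?]|[x y] [[/= ? ?] nB]]; first by split=> // -[].
by split=> //; split=> // Bx; apply: nB.
Qed.

Let setXD2 (A B C : set R) : C `*` (A `\` B) = (C `*` A) `\` (C `*` B).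
Proof.
apply/seteqP; split=> [[x y] [/= ? [? nB]]|[x y] [[/= ? ?] nB]]; first by split=> // -[].
by split=> //; split=> // Bx; apply: nB.
Qed.

(** Two applications of the lambda-system theorem on the line, one for each factor,
    pass from rectangles to products of measurable sets, and a third one to all
    measurable sets. *)
Lemma rect_null_ae : {ae mu, forall z, f z = 0}.
Proof.
have n1 a b c d : null (`]a, b[%classic `*` `]c, d[%classic).
  by split; [apply: measurableX; exact: measurable_itv|exact: f_rect].
have n2 (A : set (measurableTypeR R)) c d : measurable A -> null (A `*` `]c, d[%classic).
  apply: (@lambda_system_R [set A | null (A `*` `]c, d[%classic)]) => /=.
  - exact: nullT1.
  - by move=> B C CB nB nC; rewrite /= setXD1; apply: (charge_null_setD sf) => //; exact: setSX.
  - move=> F ndF nF; rewrite /= setX_bigcupl; apply: (charge_null_ndseq sf) => //.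
    by move=> m n mn; apply/subsetPset; apply: setSX => //; apply/subsetPset/ndF.
  - by move=> a b; exact: n1.
have n3 (A B : set (measurableTypeR R)) : measurable A -> measurable B -> null (A `*` B).
  move=> mA; apply: (@lambda_system_R [set B | null (A `*` B)]) => /=.
  - by apply: nullT2 => a b; exact: n2.
  - by move=> B' C CB nB nC; rewrite /= setXD2; apply: (charge_null_setD sf) => //; exact: setSX.
  - move=> F ndF nF; rewrite /= setX_bigcupr; apply: (charge_null_ndseq sf) => //.
    by move=> m n mn; apply/subsetPset; apply: setSX => //; apply/subsetPset/ndF.
  - by move=> a b; exact: n2.
apply: (charge_null_ae sf); rewrite measurable_prod_measurableType.
apply: (@lambda_system_subset _ _ _ setT null) => //.
- move=> _ _ [A mA [B mB <-]] [C mC [D mD <-]]; rewrite -setXI.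
  by exists (A `&` C); [exact: measurableI|exists (B `&` D) => //; exact: measurableI].
- split=> //.
  + by rewrite -setXTT; exact: n3.
  + exact: charge_null_setD sf.
  + exact: charge_null_ndseq sf.
- by move=> _ [A mA [B mB <-]]; exact: n3.
Qed.

End PlaneNullSets.

(** * Uniqueness of weak derivatives *)

Section WeakDerivative.
Context {R : realType}.
Local Notation plane := (measurableTypeR R * measurableTypeR R)%type.
Implicit Types (u v w : plane -> R) (phi : R * R -> R).

Lemma summableMb (f g : plane -> R) C : summable muO f -> measurable_fun setT g ->
  (forall z, `|g z| <= C) -> summable muO (fun z => f z * g z).
Proof.
move=> sf mg gC; apply: (summable_le (g := fun z => C * `|f z|)).
- by apply: measurable_funM => //; exact: summable_measurable sf.
- by apply: summableZ; exact: summable_norm.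
- by move=> z; rewrite normrM mulrC ler_wpM2r.
Qed.

Lemma locally_summable w (K : set (R * R)) : locally_integrable_Omega w -> compact K ->
  K `<=` Omega -> summable muO (fun z => w z * \1_K z).
Proof.
move=> [mw iw] cK KO; have := iw K cK KO.
move/(integrable_mkcond (mu := muO) (EFin \o w) (compact_measurable2 cK)).
congr (_.-integrable _ _); apply/funext => z.
by rewrite patchE /= indicE; case: ifP => _; rewrite ?mulr1 ?mulr0.
Qed.

Lemma summable_test w phi : locally_integrable_Omega w -> test_function phi ->
  summable muO (fun z => w z * phi z).
Proof.
move=> lw hphi; have [_ cK KO] := hphi.
have sK := locally_summable lw cK KO; have [C hC] := tf_bounded hphi.
have := summableMb sK (tf_measurable hphi) hC; congr (summable muO); apply/funext => z.
rewrite indicE; case: (boolP (z \in _)) => h; first by rewrite mulr1.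
by rewrite notin_setE in h; rewrite (tf_out (phi := phi) h) !mulr0.
Qed.

(** Products of bumps converge to the indicator of the rectangle. *)
Lemma locally_integrable_rect0 w (a b c d : R) : locally_integrable_Omega w ->
  (forall phi, test_function phi -> \int[muO]_z (w z * phi z) = 0) ->
  0 < a -> b < 1 -> 0 < c -> d < 1 ->
  \int[muO]_z (w z * \1_(`]a, b[%classic `*` `]c, d[%classic) z) = 0.
Proof.
move=> lw hw a0 b1 c0 d1.
pose K : set (R * R) := `[a, b]%classic `*` `[c, d]%classic.
have cK : compact K by apply: compact_setX; exact: segment_compact.
have KO : K `<=` Omega.
  move=> [x y] [] /=; rewrite ?in_itv/= => /andP[? ?] /andP[? ?].
  by split; rewrite /= ?in_itv/=; apply/andP; split; lra.
have sK := locally_summable lw cK KO.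
have [mw _] := lw.
have tf n := bump_test_function n a0 b1 c0 d1.
have mQ : measurable (`]a, b[%classic `*` `]c, d[%classic : set plane).
  by apply: measurableX; exact: measurable_itv.
have [|||||_ cv] := @Rint_dominated _ _ _ muO
    (fun n z => w z * tensor (bump n a b) (bump n c d) z)
    (fun z => w z * \1_(`]a, b[%classic `*` `]c, d[%classic) z)
    (fun z => `|w z * \1_K z|).
- by move=> n; apply: measurable_funM => //; exact: tf_measurable.
- by apply: measurable_funM => //; exact: measurable_indic.
- exact: summable_norm.
- move=> [x y]; apply: cvgM; first exact: cvg_cst.
  rewrite indicE; case: (boolP ((x, y) \in _)).
    rewrite inE => -[/=]; rewrite ?in_itv/= => hx hy.
    rewrite -[X in _ --> X]mulr1; apply: cvgM; exact: bump_cvg.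
  rewrite notin_setE => /not_andP h; rewrite (_ : (fun n => _) = cst 0); first exact: cvg_cst.
  apply/funext => n; rewrite /tensor /=; case: h => h.
    by rewrite bump_out ?mul0r//; apply/negP => h'; apply: h; rewrite /= ?in_itv.
  by rewrite (@bump_out _ n c d) ?mulr0//; apply/negP => h'; apply: h; rewrite /= ?in_itv.
- move=> n [x y]; rewrite [leLHS]normrM [leRHS]normrM ler_wpM2l// indicE.
  have /andP[p1 p2] := bump_itv n a b x; have /andP[q1 q2] := bump_itv n c d y.
  case: (boolP ((x, y) \in _)) => h.
    by rewrite normr1 /tensor /= (ger0_norm (mulr_ge0 p1 q1)) (mulr_ile1 p1 q1 p2 q2).
  rewrite normr0 normr_le0 /tensor /= mulf_eq0.
  move: h; rewrite notin_setE => /not_andP[h|h]; apply/orP; [left|right]; apply/eqP;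
    by apply: bump_out; apply/negP => /andP[h1 h2]; apply: h; rewrite /= ?in_itv/= !ltW.
rewrite (_ : (fun n => _) = cst 0) in cv; last by apply/funext => n; rewrite hw.
by apply: (@norm_cvg_unique _ _ _ _ _ _ cv); exact: cvg_cst.
Qed.

(** The fundamental lemma of the calculus of variations: the integrals over
    rectangles inside the square vanish by [locally_integrable_rect0], and
    the squares [Q n] exhaust the domain. *)
Lemma test_null_ae w : locally_integrable_Omega w ->
  (forall phi, test_function phi -> \int[muO]_z (w z * phi z) = 0) ->
  {ae (@muO R), forall z, w z = 0}.
Proof.
move=> lw hw; have [mw _] := lw.
pose e n : R := n.+2%:R^-1.
pose Q n : set plane := `]e n, 1 - e n[%classic `*` `]e n, 1 - e n[%classic.
have e0 n : 0 < e n by rewrite invr_gt0.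
have mQ n : measurable (Q n) by apply: measurableX; exact: measurable_itv.
have sQ n : summable muO (fun z => w z * \1_(Q n) z).
  pose K : set (R * R) := `[e n, 1 - e n]%classic `*` `[e n, 1 - e n]%classic.
  have cK : compact K by apply: compact_setX; exact: segment_compact.
  have KO : K `<=` Omega.
    move=> [x y] [] /=; rewrite ?in_itv/= => /andP[? ?] /andP[? ?].
    by have := e0 n; split; rewrite /= ?in_itv/=; apply/andP; split; lra.
  apply: (summable_le _ (summable_norm (locally_summable lw cK KO))).
    by apply: measurable_funM => //; exact: measurable_indic.
  move=> z; rewrite !normrM ler_wpM2l// !indicE.
  case: (boolP (z \in Q n)); last by rewrite normr0.
  rewrite inE => -[h1 h2]; rewrite mem_set//.
  by split; apply: subset_itv_oo_cc.
have aeQ n : {ae (@muO R), forall z, w z * \1_(Q n) z = 0}.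
  apply: (rect_null_ae (sQ n)) => a b c d.
  rewrite -(locally_integrable_rect0 (a := Num.max a (e n)) (b := Num.min b (1 - e n))
    (c := Num.max c (e n)) (d := Num.min d (1 - e n)) lw hw); last 4 first.
  - by rewrite lt_max e0 orbT.
  - by rewrite gt_min; apply/orP; right; have := e0 n; lra.
  - by rewrite lt_max e0 orbT.
  - by rewrite gt_min; apply/orP; right; have := e0 n; lra.
  apply: Rint_eq => -[x y]; rewrite -mulrA; congr (_ * _).
  rewrite !indicE -natrM mulnb; congr ((nat_of_bool _)%:R).
  rewrite -in_setI; congr (_ \in _); apply/seteqP; split=> -[s t].
    move=> [[/= + +] [/= + +]]; rewrite ?in_itv/= => /andP[? ?] /andP[? ?] /andP[? ?] /andP[? ?].
    by split; rewrite /= ?in_itv/= gt_max lt_min; apply/andP; split; apply/andP; split.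
  move=> [/= + +]; rewrite ?in_itv/= !gt_max !lt_min => /andP[/andP[? ?] /andP[? ?]] /andP[/andP[? ?] /andP[? ?]].
  by split; split; rewrite /= ?in_itv/=; apply/andP; split.
have aeA : {ae (@muO R), forall z n, w z * \1_(Q n) z = 0} by apply/ae_foralln.
have PF : Filter (nbhs (almost_everywhere (@muO R))) by exact: ae_filter_ringOfSetsType.
apply: filterS2 (@ae_Omega R) aeA => -[x y] [/= + +] h.
rewrite ?in_itv/= => /andP[x0 x1] /andP[y0 y1].
(* The point lies in [Q n] as soon as [e n] is below its distance to the sides. *)
pose m := Num.min (Num.min x (1 - x)) (Num.min y (1 - y)).
have m0 : 0 < m by rewrite !lt_min x0 y0 !subr_gt0 x1 y1.
have [n _ hn] := near_infty_natSinv_lt (PosNum m0).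
have em : e n < m.
  apply: le_lt_trans (hn n (leqnn n)); rewrite /e lef_pV2 ?posrE// ler_nat ltnS//.
have := h n; rewrite indicE mem_set ?mulr1//.
move: em; rewrite /m !lt_min => /andP[/andP[? ?] /andP[? ?]].
by split; rewrite /= ?in_itv/=; apply/andP; split; lra.
Qed.

Lemma weak_derivative_unique e u w w' : weak_derivative e u w -> weak_derivative e u w' ->
  {ae (@muO R), forall z, w z = w' z}.
Proof.
move=> [lw hw] [lw' hw'].
have : {ae (@muO R), forall z, w z - w' z = 0}.
  apply: test_null_ae.
    have [mw iw] := lw; have [mw' iw'] := lw'; split; first exact: measurable_funB.
    move=> K cK KO; have := integrableB (compact_measurable2 cK) (iw K cK KO) (iw' K cK KO).
    by [].
  move=> phi hphi; have s1 := summable_test lw hphi; have s2 := summable_test lw' hphi.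
  rewrite (@Rint_eq _ _ _ muO _ (fun z => w z * phi z - w' z * phi z)); last first.
    by move=> z; rewrite mulrBl.
  rewrite (RintB s1 s2); have := hw _ hphi; have := hw' _ hphi.
  by move=> -> /eqP; rewrite eqr_opp => /eqP ->; rewrite subrr.
by apply: filterS => z /eqP; rewrite subr_eq0 => /eqP.
Qed.

Lemma wderivP e u w : weak_derivative e u w -> weak_derivative e u (wderiv e u).
Proof. by move=> h; exact: (@xgetPex _ (cst 0) [set w | weak_derivative e u w] (ex_intro _ w h)). Qed.

Lemma wderiv_ae e u w : weak_derivative e u w -> {ae (@muO R), forall z : plane, wderiv e u z = w z}.
Proof. by move=> h; apply: (@weak_derivative_unique e u) => //; exact: wderivP h. Qed.

Lemma summable_partial e u phi : coordinate e -> square_summable muO u -> test_function phi ->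
  summable muO (fun z => u z * partial e phi z).
Proof.
move=> he su hphi; have [C hC] := tf_partial_bounded hphi he.
apply: (summableMb _ (tf_partial_measurable hphi he) hC).
exact: (square_summable_summable muO_lty).
Qed.

Lemma weak_derivative_linear e (c : R) u v w w' : coordinate e ->
  square_summable muO u -> square_summable muO v ->
  weak_derivative e u w -> weak_derivative e v w' ->
  weak_derivative e (fun z => c * u z + v z) (fun z => c * w z + w' z).
Proof.
move=> he su sv [lw hw] [lw' hw']; split.
  have [mw iw] := lw; have [mw' iw'] := lw'; split.
    by apply: measurable_funD => //; exact: measurable_funM.
  move=> K cK KO; have mK := compact_measurable2 cK.
  by have := integrableD mK (integrableZl mK c (iw K cK KO)) (iw' K cK KO).
move=> phi hphi.
have s1 := summable_partial he su hphi; have s2 := summable_partial he sv hphi.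
have s3 := summable_test lw hphi; have s4 := summable_test lw' hphi.
rewrite (@Rint_eq _ _ _ muO _ (fun z => c * (u z * partial e phi z) + v z * partial e phi z)); last first.
  by move=> z; ring.
rewrite (@Rint_eq _ _ _ muO (fun z => _ * phi z) (fun z => c * (w z * phi z) + w' z * phi z)); last first.
  by move=> z; ring.
rewrite (RintD (summableZ c s1) s2) (RintD (summableZ c s3) s4) (RintZ c s1) (RintZ c s3).
by rewrite hw// hw'//; ring.
Qed.

Lemma weak_derivative_ae0 e u : coordinate e -> measurable_fun setT u ->
  {ae (@muO R), forall z, u z = 0} -> weak_derivative e u (cst 0).
Proof.
move=> he mu u0.
have s0 : summable muO (cst 0 : plane -> R).
  by apply: (summable_cst muO_lty).
split; first exact: summable_locally_integrable.
move=> phi hphi.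
transitivity (\int[@muO R]_z (0 : R)).
  apply: Rint_ae; [by apply: measurable_funM => //; exact: tf_partial_measurable|
    exact: measurable_cst|].
  by apply: filterS u0 => z ->; rewrite mul0r.
rewrite (@Rint_eq _ _ _ muO (fun z => _ * phi z) (fun z => 0)); last by move=> z; rewrite mul0r.
by rewrite Rintegral_cst// mul0r oppr0.
Qed.

End WeakDerivative.

(** * The weighted Sobolev norm *)

Section WeightedSobolev.
Context {R : realType} (a1 a2 : R).
Hypotheses (a10 : 0 <= a1) (a20 : 0 <= a2).
Local Notation plane := (measurableTypeR R * measurableTypeR R)%type.
Implicit Types (u v w : plane -> R) (phi : R * R -> R).

(** The weighted derivative, which is the quantity that belongs to L2. *)
Definition gradx u : plane -> R := fun z => z.2 `^ a1 * wderiv ex u z.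
Definition grady u : plane -> R := fun z => z.1 `^ a2 * wderiv ey u z.

Lemma measurable_weightx r : measurable_fun setT (fun z : plane => z.2 `^ r).
Proof. by apply: (measurableT_comp (measurable_powR r)); exact: measurable_snd. Qed.

Lemma measurable_weighty r : measurable_fun setT (fun z : plane => z.1 `^ r).
Proof. by apply: (measurableT_comp (measurable_powR r)); exact: measurable_fst. Qed.

Lemma coord_ex : coordinate (ex : R * R). Proof. by left. Qed.
Lemma coord_ey : coordinate (ey : R * R). Proof. by right. Qed.

Lemma weak_derivative_measurable e u w : weak_derivative e u w -> measurable_fun setT w.
Proof. by move=> [[]]. Qed.

(** The canonical representative [wderiv] can replace any weak derivative. *)
Lemma H1P u : H1 a1 a2 u <-> [/\ square_summable muO u,
  weak_derivative ex u (wderiv ex u) /\ square_summable muO (gradx u) &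
  weak_derivative ey u (wderiv ey u) /\ square_summable muO (grady u)].
Proof.
split; last first.
  move=> [/Lfun2P su [wx /Lfun2P sx] [wy /Lfun2P sy]]; split; first exact: su.
    by exists (wderiv ex u); [exact: wx|exact: sx].
  by exists (wderiv ey u); [exact: wy|exact: sy].
move=> [/Lfun2P su [w wx /Lfun2P sx] [w' wy /Lfun2P sy]]; split; first exact: su.
  split; first exact: wderivP wx.
  apply: square_summable_ae sx _.
    apply: measurable_funM; first exact: measurable_weightx.
    exact: weak_derivative_measurable (wderivP wx).
  by apply: filterS (wderiv_ae wx) => z; rewrite /gradx => ->.
split; first exact: wderivP wy.
apply: square_summable_ae sy _.
  apply: measurable_funM; first exact: measurable_weighty.
  exact: weak_derivative_measurable (wderivP wy).
by apply: filterS (wderiv_ae wy) => z; rewrite /grady => ->.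
Qed.

Lemma H1_linear (c : R) u v : H1 a1 a2 u -> H1 a1 a2 v ->
  [/\ H1 a1 a2 (fun z => c * u z + v z),
    {ae (@muO R), forall z : plane, gradx (fun z => c * u z + v z) z = c * gradx u z + gradx v z} &
    {ae (@muO R), forall z : plane, grady (fun z => c * u z + v z) z = c * grady u z + grady v z}].
Proof.
move=> /H1P[su [wux sux] [wuy suy]] /H1P[sv [wvx svx] [wvy svy]].
have wx := weak_derivative_linear c coord_ex su sv wux wvx.
have wy := weak_derivative_linear c coord_ey su sv wuy wvy.
have ax : {ae (@muO R), forall z : plane, gradx (fun z => c * u z + v z) z = c * gradx u z + gradx v z}.
  by apply: filterS (wderiv_ae wx) => z; rewrite /gradx => ->; ring.
have ay : {ae (@muO R), forall z : plane, grady (fun z => c * u z + v z) z = c * grady u z + grady v z}.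
  by apply: filterS (wderiv_ae wy) => z; rewrite /grady => ->; ring.
split=> //; apply/H1P; split; first exact: square_summableP.
  split; first exact: wderivP wx.
  apply: square_summable_ae (square_summableP c sux svx) ax.
  apply: measurable_funM; first exact: measurable_weightx.
  exact: weak_derivative_measurable (wderivP wx).
split; first exact: wderivP wy.
apply: square_summable_ae (square_summableP c suy svy) ay.
apply: measurable_funM; first exact: measurable_weighty.
exact: weak_derivative_measurable (wderivP wy).
Qed.

Lemma tf_partial_outside e phi z : test_function phi -> ~ Omega z -> partial e phi z = 0.
Proof. by move=> [_ _ h] nO; apply: tf_partial_out => /h. Qed.

Lemma weight_le1 (t r : R) : 0 <= r -> 0 < t < 1 -> t `^ r <= 1.
Proof.
move=> r0 /andP[t0 t1]; have e : 1 `^ r = 1 :> R by rewrite powR1.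
by rewrite -[leRHS]e; apply: ge0_ler_powR; rewrite ?nnegrE//; exact: ltW.
Qed.

Lemma tf_weighted_bound e phi (weight : R * R -> R) C : test_function phi ->
  (forall z, Omega z -> 0 <= weight z <= 1) -> (forall z, `|partial e phi z| <= C) ->
  forall z, `|weight z * partial e phi z| <= C.
Proof.
move=> hphi hw hC z; have [Oz|nOz] := pselect (Omega z).
  have /andP[w0 w1] := hw z Oz; rewrite normrM (ger0_norm w0).
  by apply: le_trans (hC z); rewrite ler_piMl.
by rewrite (tf_partial_outside _ hphi nOz) mulr0 normr0; exact: le_trans (hC z).
Qed.

Lemma tf_H1 phi : test_function phi -> H1 a1 a2 phi.
Proof.
move=> hphi; split.
- have [C hC] := tf_bounded hphi; apply/Lfun2P.
  by apply: (square_summable_bounded muO_lty (C := C)) => //; exact: tf_measurable.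
- exists (partial ex phi); first exact: tf_weak_derivative coord_ex hphi.
  have [C hC] := tf_partial_bounded hphi coord_ex; apply/Lfun2P.
  apply: (square_summable_bounded muO_lty (C := C)).
    apply: measurable_funM; [exact: measurable_weightx|exact: tf_partial_measurable coord_ex].
  apply: tf_weighted_bound hphi _ hC => -[x y] [_ /=]; rewrite ?in_itv/= => hy.
  by rewrite powR_ge0 weight_le1.
- exists (partial ey phi); first exact: tf_weak_derivative coord_ey hphi.
  have [C hC] := tf_partial_bounded hphi coord_ey; apply/Lfun2P.
  apply: (square_summable_bounded muO_lty (C := C)).
    apply: measurable_funM; [exact: measurable_weighty|exact: tf_partial_measurable coord_ey].
  apply: tf_weighted_bound hphi _ hC => -[x y] [/= + _]; rewrite ?in_itv/= => hx.
  by rewrite powR_ge0 weight_le1.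
Qed.

Lemma tf_gradx phi : test_function phi ->
  {ae (@muO R), forall z : plane, gradx phi z = z.2 `^ a1 * partial ex phi z}.
Proof.
move=> hphi; apply: filterS (wderiv_ae (tf_weak_derivative coord_ex hphi)) => z.
by rewrite /gradx => ->.
Qed.

Lemma tf_grady phi : test_function phi ->
  {ae (@muO R), forall z : plane, grady phi z = z.1 `^ a2 * partial ey phi z}.
Proof.
move=> hphi; apply: filterS (wderiv_ae (tf_weak_derivative coord_ey hphi)) => z.
by rewrite /grady => ->.
Qed.

Definition mass u v : R := \int[muO]_z (u z * v z).
Definition energy u v : R :=
  \int[muO]_z (gradx u z * gradx v z) + \int[muO]_z (grady u z * grady v z).

Lemma three_Lnorms (f g h : plane -> R) :
  square_summable muO f -> square_summable muO g -> square_summable muO h ->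
  (('N[muO]_2%:E[EFin \o f] ^+ 2 + 'N[muO]_2%:E[EFin \o g] ^+ 2
    + 'N[muO]_2%:E[EFin \o h] ^+ 2) `^ 2^-1)%E =
  (Num.sqrt (\int[muO]_z (f z * f z) +
    (\int[muO]_z (g z * g z) + \int[muO]_z (h z * h z))))%:E.
Proof.
have e (f' : plane -> R) : square_summable muO f' ->
    ('N[muO]_2%:E[EFin \o f'] ^+ 2 = (\int[muO]_z (f' z * f' z))%:E)%E.
  move=> [mf sf]; rewrite (sqr_Lnorm2 _ mf) -(EFin_Rint sf).
  by rewrite (@Rint_eq _ _ _ muO _ (fun z => f' z * f' z)).
have sq (f' : plane -> R) : 0 <= \int[muO]_z (f' z * f' z).
  by apply: Rint_ge0 => z; rewrite -expr2 sqr_ge0.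
move=> sf sg sh; rewrite (e _ sf) (e _ sg) (e _ sh) -!EFinD poweR12_sqrt.
  by rewrite /sqrte -addrA.
by rewrite lee_fin !addr_ge0.
Qed.

Lemma H1normE u : H1 a1 a2 u -> H1norm a1 a2 u = (Num.sqrt (mass u u + energy u u))%:E.
Proof. by move=> /H1P[su [_ sx] [_ sy]]; exact: (three_Lnorms su sx sy). Qed.

(** The norm is traded for its square, a form, with which the rest of the proof
    works. *)
Lemma H10P u : H10 a1 a2 u <-> H1 a1 a2 u /\ forall eps : R, 0 < eps ->
  exists2 phi, test_function phi &
    mass (fun z => u z - phi z) (fun z => u z - phi z) +
    energy (fun z => u z - phi z) (fun z => u z - phi z) < eps.
Proof.
have hB phi : H1 a1 a2 u -> test_function phi -> H1 a1 a2 (fun z => u z - phi z).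
  move=> hu /tf_H1 hphi; have [h _ _] := H1_linear (-1) hphi hu.
  by rewrite (_ : (fun z => _) = (fun z => -1 * phi z + u z))//; apply/funext => z; ring.
split=> -[hu happ]; split=> // eps eps0.
  have [|phi hphi] := happ (Num.sqrt eps); first by rewrite sqrtr_gt0.
  rewrite H1normE; last exact: hB.
  by rewrite lte_fin ltr_sqrt// => h; exists phi.
have [|phi hphi h] := happ (eps ^+ 2); first by rewrite exprn_gt0.
exists phi => //; rewrite H1normE; last exact: hB.
by rewrite lte_fin -[ltRHS]gtr0_norm// -sqrtr_sqr ltr_sqrt// exprn_gt0.
Qed.

End WeightedSobolev.

(** * Vector spaces of functions and closedness of weak derivatives *)

Section Submodule.
Context {R : realType} {T : Type}.
Implicit Types (P : (T -> R) -> Prop) (u v : T -> R).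

(** The two closure properties which make a class of functions a vector space; they
    are bundled so that the space below can be formed for any such class. *)
Definition linear_class P := P (fun=> 0) /\
  forall (c : R) u v, P u -> P v -> P (fun z => c * u z + v z).

Definition in_class P (hP : linear_class P) : {pred (T -> R^o)} := fun u => `[< P u >].

Variables (P : (T -> R) -> Prop) (hP : linear_class P).

Lemma in_class_submod : submod_closed (in_class hP).
Proof.
split; first by apply/asboolP; case: hP.
by move=> c u v /asboolP Pu /asboolP Pv; apply/asboolP; case: hP => _; exact.
Qed.

HB.instance Definition _ := GRing.isSubmodClosed.Build R (T -> R^o) (in_class hP) in_class_submod.

Record class_space := ClassSpace { class_fun :> T -> R^o; _ : class_fun \in in_class hP }.
HB.instance Definition _ := [isSub for class_fun].
HB.instance Definition _ := [Choice of class_space by <:].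
HB.instance Definition _ := [SubChoice_isSubLmodule of class_space by <:].

Lemma class_funP (u : class_space) : P u.
Proof. by case: u => v Pv /=; exact: (asboolW Pv). Qed.

Definition to_class u (Pu : P u) : class_space := ClassSpace (asboolT Pu : u \in in_class hP).

Lemma class_linear (c : R) (u v : class_space) :
  (c *: u + v : class_space) = (fun z => c * u z + v z) :> (T -> R).
Proof. by []. Qed.

Lemma class_sum n (c : 'I_n -> R) (u : 'I_n -> class_space) z :
  (\sum_i c i *: u i : class_space) z = \sum_i c i * u i z.
Proof.
apply: (big_ind2 (fun (x : class_space) y => x z = y)) => //.
by move=> x1 x2 y1 y2 <- <-.
Qed.

End Submodule.

Section WeakLimit.
Context {R : realType}.
Local Notation plane := (measurableTypeR R * measurableTypeR R)%type.

(** A weak derivative is tested against [partial e phi] and [phi / s], both of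
    which are bounded, so that both sides pass to the L2 limit. *)
Lemma weak_derivative_limit e (s : plane -> R) (u_ g_ : nat -> L2 (@muO R)) (u g : L2 (@muO R))
    (w_ : nat -> plane -> R) : coordinate e ->
  measurable_fun setT (fun z => (s z)^-1) -> (forall z, Omega z -> 0 < s z) ->
  (forall K, compact K -> K `<=` Omega -> exists C, forall z, K z -> (s z)^-1 <= C) ->
  (forall n, weak_derivative e (u_ n) (w_ n)) -> (forall n z, g_ n z = s z * w_ n z) ->
  fcvg (@inner _ _ _ muO) u_ u -> fcvg (@inner _ _ _ muO) g_ g ->
  weak_derivative e u (fun z => (s z)^-1 * g z).
Proof.
move=> he ms s0 sK hw gE cu cg.
have sg := L2_square_summable g; have [mg _] := sg.
have ig := square_summable_summable muO_lty sg.
split.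
  split; first exact: measurable_funM.
  move=> K cK KO; have [C hC] := sK K cK KO; have mK := compact_measurable2 cK.
  have igK : muO.-integrable K (EFin \o (fun z => C * g z)).
    by apply: integrableS (summableZ C ig).
  apply: (le_integrable mK _ _ igK).
    by apply/measurable_EFinP; apply: measurable_funTS; exact: measurable_funM.
  move=> z Kz /=; rewrite lee_fin !normrM ler_wpM2r// ger0_norm.
    by apply: le_trans (hC z Kz) _; exact: ler_norm.
  by rewrite invr_ge0 ltW// s0//; exact: KO.
move=> phi hphi.
have [D hD] := tf_partial_bounded hphi he.
have [D' hD'] := tf_bounded hphi.
have [_ cK KO] := hphi.
have [C hC] := sK _ cK KO.
have sd : square_summable muO (partial e phi).
  by apply: (square_summable_bounded muO_lty (C := D)) => //; exact: tf_partial_measurable.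
pose psi (z : plane) := (s z)^-1 * phi z.
have mpsi : measurable_fun setT psi.
  by apply: measurable_funM => //; exact: tf_measurable.
have psi_out z : ~ support phi z -> phi z = 0 by exact: (tf_out (phi := phi)).
have sp : square_summable muO psi.
  apply: (square_summable_bounded muO_lty (C := `|C| * D')) => // z.
  have [Kz|nKz] := pselect (support phi z); last first.
    by rewrite /psi psi_out// mulr0 normr0 mulr_ge0// (le_trans _ (hD' z)).
  rewrite normrM ler_pM// ger0_norm; first by apply: le_trans (hC z Kz) _; exact: ler_norm.
  by rewrite invr_ge0 ltW// s0//; exact: KO.
have hi := @inner_psd _ _ R (@muO R).
have c1 := fcvg_psdl (w := toL2 sd) hi cu.
have c2 := fcvg_psdl (w := toL2 sp) hi cg.
have e1 n : inner (u_ n) (toL2 sd) = - inner (g_ n) (toL2 sp).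
  have [_ h] := hw n; have := h phi hphi.
  rewrite /inner /= => ->; congr (- _); apply: Rint_eq => z.
  rewrite gE /psi.
  have [Kz|nKz] := pselect (support phi z); last by rewrite psi_out// !mulr0.
  have s1 : s z != 0 by rewrite gt_eqF// s0//; exact: KO.
  by move: (w_ n z) (phi z) (s z) s1 => a b t t0; field.
have c3 : (fun n => inner (u_ n) (toL2 sd)) @ \oo --> - inner g (toL2 sp).
  by under eq_fun do rewrite e1; exact: cvgN.
have := cvg_unique _ c1 c3; rewrite /inner /= => ->//.
by congr (- _); apply: Rint_eq => z; rewrite /psi; ring.
Qed.

Lemma weight_margin (p : R * R -> R) (r : R) : 0 <= r ->
  (forall K : set (R * R), compact K -> K `<=` Omega ->
    exists2 d : R, 0 < d & forall z, K z -> d <= p z) ->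
  forall K, compact K -> K `<=` Omega -> exists C, forall z, K z -> (p z `^ r)^-1 <= C.
Proof.
move=> r0 hp K cK KO; have [d d0 hd] := hp K cK KO.
exists (d `^ r)^-1 => z Kz; have hz := hd z Kz.
have dr : 0 < d `^ r by rewrite powR_gt0.
rewrite lef_pV2 ?posrE ?powR_gt0//; last exact: lt_le_trans hz.
by apply: ge0_ler_powR; rewrite ?nnegrE ?(ltW d0)// (le_trans (ltW d0)).
Qed.

End WeakLimit.

Section SobolevForms.
Context {R : realType} (a1 a2 : R).
Local Notation plane := (measurableTypeR R * measurableTypeR R)%type.

Section Forms.
Variables (P : (plane -> R) -> Prop) (hP : linear_class P).
Hypothesis PH1 : forall u, P u -> H1 a1 a2 u.
Local Notation X := (class_space hP).

Lemma class_square_summable (u : X) : square_summable muO u.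
Proof. have /PH1/H1P[h _ _] := class_funP u; exact: h. Qed.

Lemma class_gradx_summable (u : X) : square_summable muO (gradx a1 u).
Proof. have /PH1/H1P[_ [_ h] _] := class_funP u; exact: h. Qed.

Lemma class_grady_summable (u : X) : square_summable muO (grady a2 u).
Proof. have /PH1/H1P[_ _ [_ h]] := class_funP u; exact: h. Qed.

Lemma class_gradx_linear (c : R) (u v : X) :
  {ae (@muO R), forall z : plane, gradx a1 (c *: u + v : X) z = c * gradx a1 u z + gradx a1 v z}.
Proof. have [_ h _] := H1_linear c (PH1 (class_funP u)) (PH1 (class_funP v)); exact: h. Qed.

Lemma class_grady_linear (c : R) (u v : X) :
  {ae (@muO R), forall z : plane, grady a2 (c *: u + v : X) z = c * grady a2 u z + grady a2 v z}.
Proof. have [_ _ h] := H1_linear c (PH1 (class_funP u)) (PH1 (class_funP v)); exact: h. Qed.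

Lemma mass_psd : psd (fun u v : X => mass u v).
Proof.
apply: (@psd_pullback _ _ _ muO X (fun u => (u : plane -> R))).
  exact: class_square_summable.
by move=> c u v; apply: nearW.
Qed.

Definition energy_x (u v : plane -> R) : R := \int[muO]_z (gradx a1 u z * gradx a1 v z).
Definition energy_y (u v : plane -> R) : R := \int[muO]_z (grady a2 u z * grady a2 v z).

Lemma energy_x_psd : psd (fun u v : X => energy_x u v).
Proof.
apply: (@psd_pullback _ _ _ muO X (fun u => gradx a1 u)).
  exact: class_gradx_summable.
exact: class_gradx_linear.
Qed.

Lemma energy_y_psd : psd (fun u v : X => energy_y u v).
Proof.
apply: (@psd_pullback _ _ _ muO X (fun u => grady a2 u)).
  exact: class_grady_summable.
exact: class_grady_linear.
Qed.

Lemma energy_psd : psd (fun u v : X => energy a1 a2 u v).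
Proof. exact: (psdD energy_x_psd energy_y_psd). Qed.

End Forms.
End SobolevForms.

(** * Completeness of the weighted Sobolev space *)

Section PullbackConvergence.
Context d (T : measurableType d) (R : realType) (mu : {measure set T -> \bar R}).
Variables (X : lmodType R) (i : X -> T -> R).
Hypothesis si : forall u, square_summable mu (i u).
Hypothesis li : forall c u v, {ae mu, forall x, i (c *: u + v) x = c * i u x + i v x}.

Definition pullback (u : X) : L2 mu := toL2 (si u).

(** Distances in the form are distances in L2, although [i] is only linear almost
    everywhere. *)
Lemma pullback_sub u v (f : L2 mu) : {ae mu, forall x, i v x = f x} ->
  seminorm (fun u v => \int[mu]_x (i u x * i v x)) (u - v) =
  seminorm (@inner _ _ _ mu) (pullback u - f).
Proof.
move=> vf; congr (Num.sqrt _); have [m1 _] := si (u - v).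
apply: Rint_ae; first exact: measurable_funM.
  by have [m2 _] := L2_square_summable (pullback u - f); exact: measurable_funM.
have e : u - v = (-1) *: v + u by rewrite scaleN1r addrC.
apply: filterS2 vf (li (-1) v u) => x vf; rewrite -e => ->.
by rewrite vf (_ : (pullback u - f) x = i u x - f x)//; ring.
Qed.

Lemma pullback_fcauchy (x : nat -> X) :
  fcauchy (fun u v => \int[mu]_x (i u x * i v x)) x ->
  fcauchy (@inner _ _ _ mu) (fun n => pullback (x n)).
Proof.
move=> h e /h[N hN]; exists N => j k Nj Nk.
rewrite -(@pullback_sub (x j) (x k)); last by apply: nearW.
exact: hN.
Qed.

Lemma pullback_fcvg (x : nat -> X) l (f : L2 mu) : {ae mu, forall x, i l x = f x} ->
  fcvg (@inner _ _ _ mu) (fun n => pullback (x n)) f ->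
  fcvg (fun u v => \int[mu]_x (i u x * i v x)) x l.
Proof.
move=> lf h e /h[N hN]; exists N => j Nj.
by rewrite (@pullback_sub (x j) l f)//; exact: hN.
Qed.

End PullbackConvergence.

Lemma fcvgD (R : realType) (X : lmodType R) (b1 b2 : X -> X -> R) (x : nat -> X) l :
  psd b1 -> psd b2 -> fcvg b1 x l -> fcvg b2 x l -> fcvg (fun u v => b1 u v + b2 u v) x l.
Proof.
move=> h1 h2 c1 c2 e e0; have e2 : 0 < e / 2 by rewrite divr_gt0.
have [N1 hN1] := c1 _ e2; have [N2 hN2] := c2 _ e2.
exists (maxn N1 N2) => i; rewrite geq_max => /andP[/hN1 l1 /hN2 l2].
rewrite /seminorm -[ltRHS]gtr0_norm// -sqrtr_sqr ltr_sqrt ?exprn_gt0//.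
rewrite -(sqr_seminorm h1) -(sqr_seminorm h2).
have s1 := seminorm_ge0 b1 (x i - l); have s2 := seminorm_ge0 b2 (x i - l).
nra.
Qed.

Section FormClosure.
Context {R : realType} {X : lmodType R} (b : X -> X -> R) (D : X -> Prop).
Hypothesis hb : psd b.
Hypothesis D_linear : forall (c : R) u v, D u -> D v -> D (c *: u + v).

(** Membership in the closure of [D] for the seminorm of [b]. *)
Definition approximable (u : X) := forall eps : R, 0 < eps ->
  exists2 phi, D phi & b (u - phi) (u - phi) < eps.

Lemma psd_le2D u v : b (u + v) (u + v) <= 2 * b u u + 2 * b v v.
Proof. by rewrite -(psd_parallelogram hb) lerDl psd_ge0. Qed.

Lemma approximable_linear c u v : approximable u -> approximable v ->
  approximable (c *: u + v).
Proof.
move=> hu hv eps eps0.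
have c0 : 0 < 4 * (c ^+ 2 + 1) by rewrite mulr_gt0// ltr_wpDl// sqr_ge0.
have d0 : 0 < eps / (4 * (c ^+ 2 + 1)) by rewrite divr_gt0.
have [phi tphi hphi] := hu _ d0; have [psi tpsi hpsi] := hv _ d0.
exists (c *: phi + psi); first exact: (D_linear c tphi tpsi).
have -> : c *: u + v - (c *: phi + psi) = c *: (u - phi) + (v - psi).
  by rewrite scalerBr opprD addrACA.
apply: le_lt_trans (psd_le2D _ _) _.
rewrite (psdZl hb) (psdZr hb).
move: hphi hpsi; rewrite !ltr_pdivlMr//.
have := psd_ge0 hb (u - phi); have := psd_ge0 hb (v - psi).
move: (b (u - phi) _) (b (v - psi) _) => A B.
rewrite mulrA -expr2; have := sqr_ge0 c; move: (c ^+ 2) => t; nra.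
Qed.

Lemma approximable_closed (x : nat -> X) l : (forall n, approximable (x n)) ->
  fcvg b x l -> approximable l.
Proof.
move=> hx hl eps eps0; have e4 : 0 < eps / 4 by rewrite divr_gt0.
have s0 : 0 < Num.sqrt (eps / 4) by rewrite sqrtr_gt0.
have [N /(_ N (leqnn N))] := hl _ s0; rewrite (seminormB hb) ltr_sqrt// => h1.
have [phi tphi hphi] := hx N _ e4; exists phi => //.
have -> : l - phi = (l - x N) + (x N - phi) by rewrite addrA subrK.
apply: le_lt_trans (psd_le2D _ _) _; move: h1 hphi.
move: (b (l - x N) _) (b (x N - phi) _) => A B; lra.
Qed.

End FormClosure.

Section SobolevSpace.
Context {R : realType} (a1 a2 : R).
Hypotheses (a10 : 0 <= a1) (a20 : 0 <= a2).
Local Notation plane := (measurableTypeR R * measurableTypeR R)%type.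

Lemma test_function0 : test_function (fun=> 0 : R).
Proof.
have h := @bump_test_function R 0%N 4^-1 2^-1 4^-1 2^-1.
have {}h : test_function (tensor (bump 0%N 4^-1 2^-1) (bump 0%N 4^-1 (2^-1 : R))).
  by apply: h; lra.
have := test_function_linear (-1) h h.
by rewrite (_ : (fun z => _) = (fun=> 0))//; apply/funext => z; ring.
Qed.

Lemma H1_class : linear_class (H1 a1 a2).
Proof.
split; first exact: tf_H1 test_function0.
by move=> c u v hu hv; have [h _ _] := H1_linear c hu hv; exact: h.
Qed.

Local Notation Y := (class_space H1_class).
Let idH1 (u : plane -> R) (h : H1 a1 a2 u) : H1 a1 a2 u := h.

Definition H1_form (u v : plane -> R) : R := mass u v + energy a1 a2 u v.

Lemma H1_form_psd : psd (fun u v : Y => H1_form u v).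
Proof. exact: (psdD (mass_psd H1_class idH1) (energy_psd H1_class idH1)). Qed.

Local Notation form := (fun u v : Y => H1_form u v).
Local Notation smooth_in := (fun phi : Y => test_function phi).

Lemma H10_approximable (u : Y) : H10 a1 a2 u <-> approximable form smooth_in u.
Proof.
split=> [/(H10P a10 a20)[_ h] eps /h[phi hphi lt]|h].
  by exists (to_class H1_class (tf_H1 a10 a20 hphi)).
apply/(H10P a10 a20); split; first exact: class_funP.
by move=> eps /h[phi hphi lt]; exists phi.
Qed.

(** The function and its two weighted derivatives converge in L2, and a weak
    derivative is stable under such limits. *)
Lemma H1_complete (x : nat -> Y) : fcauchy (fun u v : Y => H1_form u v) x ->
  exists l : Y, fcvg (fun u v : Y => H1_form u v) x l.
Proof.
move=> hx.
have hm := mass_psd H1_class idH1; have hex := energy_x_psd H1_class idH1.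
have hey := energy_y_psd H1_class idH1.
have sm := class_square_summable (hP := H1_class) idH1.
have sx := class_gradx_summable (hP := H1_class) idH1.
have sy := class_grady_summable (hP := H1_class) idH1.
have lm c (u v : Y) : {ae (@muO R), forall z : plane, (c *: u + v : Y) z = c * u z + v z}.
  by apply: nearW.
have lx := class_gradx_linear (hP := H1_class) idH1.
have ly := class_grady_linear (hP := H1_class) idH1.
have parts (u : Y) : [/\ mass u u <= 1 * H1_form u u, energy_x a1 u u <= 1 * H1_form u u &
    energy_y a2 u u <= 1 * H1_form u u].
  have h1 : 0 <= mass u u := psd_ge0 hm u.
  have h2 : 0 <= energy_x a1 u u := psd_ge0 hex u.
  have h3 : 0 <= energy_y a2 u u := psd_ge0 hey u.
  have -> : H1_form u u = mass u u + (energy_x a1 u u + energy_y a2 u u) by reflexivity.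
  move: h1 h2 h3; move: (mass u u) (energy_x a1 u u) (energy_y a2 u u) => A B C A0 B0 C0.
  by split; lra.
have cm : fcauchy (fun u v : Y => mass u v) x.
  by apply: (fcauchy_le H1_form_psd ler01 _ hx) => u; have [h _ _] := parts u; exact: h.
have cx : fcauchy (fun u v : Y => energy_x a1 u v) x.
  by apply: (fcauchy_le H1_form_psd ler01 _ hx) => u; have [_ h _] := parts u; exact: h.
have cy : fcauchy (fun u v : Y => energy_y a2 u v) x.
  by apply: (fcauchy_le H1_form_psd ler01 _ hx) => u; have [_ _ h] := parts u; exact: h.
have [u [hu _]] := inner_complete muO_lty (pullback_fcauchy sm lm cm).
have [g [hg _]] := inner_complete muO_lty (pullback_fcauchy sx lx cx).
have [h [hh _]] := inner_complete muO_lty (pullback_fcauchy sy ly cy).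
have wx : weak_derivative ex u (fun z => (z.2 `^ a1)^-1 * g z).
  apply: (@weak_derivative_limit R ex (fun z => z.2 `^ a1) (fun n => pullback sm (x n))
    (fun n => pullback sx (x n)) u g (fun n => wderiv ex (x n))) => //.
  - exact: coord_ex.
  - rewrite (_ : (fun z : plane => _) = (fun z => z.2 `^ (- a1))); first exact: measurable_weightx.
    by apply/funext => z; rewrite powRN.
  - by move=> z [_ /=]; rewrite in_itv/= => /andP[z0 _]; rewrite powR_gt0.
  - apply: (weight_margin a10) => K cK KO; have [d d0 hd] := compact_margin cK KO.
    by exists d => // z /hd[].
  - by move=> n; have /H1P[_ [wxn _] _] := class_funP (x n); exact: wxn.
have wy : weak_derivative ey u (fun z => (z.1 `^ a2)^-1 * h z).
  apply: (@weak_derivative_limit R ey (fun z => z.1 `^ a2) (fun n => pullback sm (x n))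
    (fun n => pullback sy (x n)) u h (fun n => wderiv ey (x n))) => //.
  - exact: coord_ey.
  - rewrite (_ : (fun z : plane => _) = (fun z => z.1 `^ (- a2))); first exact: measurable_weighty.
    by apply/funext => z; rewrite powRN.
  - by move=> z [/= + _]; rewrite in_itv/= => /andP[z0 _]; rewrite powR_gt0.
  - apply: (weight_margin a20) => K cK KO; have [d d0 hd] := compact_margin cK KO.
    by exists d => // z /hd[].
  - by move=> n; have /H1P[_ _ [wyn _]] := class_funP (x n); exact: wyn.
have gx : {ae (@muO R), forall z : plane, gradx a1 u z = g z}.
  apply: filterS2 (wderiv_ae wx) (@ae_Omega R) => z e [_ /=].
  rewrite in_itv/= => /andP[z0 _]; rewrite /gradx e mulrA divff ?mul1r//.
  by rewrite gt_eqF// powR_gt0.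
have gy : {ae (@muO R), forall z : plane, grady a2 u z = h z}.
  apply: filterS2 (wderiv_ae wy) (@ae_Omega R) => z e [/= + _].
  rewrite in_itv/= => /andP[z0 _]; rewrite /grady e mulrA divff ?mul1r//.
  by rewrite gt_eqF// powR_gt0.
have Hu : H1 a1 a2 u.
  apply/H1P; split; first exact: L2_square_summable.
    split; first exact: wderivP wx.
    apply: square_summable_ae (L2_square_summable g) gx.
    apply: measurable_funM; first exact: measurable_weightx.
    exact: weak_derivative_measurable (wderivP wx).
  split; first exact: wderivP wy.
  apply: square_summable_ae (L2_square_summable h) gy.
  apply: measurable_funM; first exact: measurable_weighty.
  exact: weak_derivative_measurable (wderivP wy).
pose l := to_class H1_class Hu; have El : (l : plane -> R) = u by [].
have gx' : {ae (@muO R), forall z : plane, gradx a1 l z = g z} by rewrite El; exact: gx.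
have gy' : {ae (@muO R), forall z : plane, grady a2 l z = h z} by rewrite El; exact: gy.
have cm' : fcvg (fun u v : Y => mass u v) x l.
  by apply: (pullback_fcvg lm _ hu); rewrite El; apply: nearW.
have cx' : fcvg (fun u v : Y => energy_x a1 u v) x l := pullback_fcvg lx gx' hg.
have cy' : fcvg (fun u v : Y => energy_y a2 u v) x l := pullback_fcvg ly gy' hh.
by exists l; exact: (fcvgD hm (energy_psd H1_class idH1) cm' (fcvgD hex hey cx' cy')).
Qed.

End SobolevSpace.

(** * The closure of the test functions *)

Lemma psd_sum_sqr (R : realType) (X : lmodType R) (I : finType) (l : I -> X -> R) :
  (forall i, functional (l i)) -> psd (fun u v => \sum_i l i u * l i v).
Proof.
move=> hl; split.
- by move=> u v; apply: eq_bigr => i _; rewrite mulrC.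
- move=> c u v w; rewrite mulr_sumr -big_split/=; apply: eq_bigr => i _.
  by rewrite hl; ring.
- by move=> u; apply: sumr_ge0 => i _; rewrite -expr2 sqr_ge0.
Qed.

Lemma psdZ (R : realType) (X : lmodType R) (b : X -> X -> R) (k : R) : 0 <= k -> psd b ->
  psd (fun u v => k * b u v).
Proof.
move=> k0 hb; split=> [u v|c u v w|u]; first by rewrite (psdC hb).
  by rewrite (psdP hb); ring.
by rewrite mulr_ge0// psd_ge0.
Qed.

(** An inequality between continuous forms extends from a dense set; this is how the
    estimates for test functions reach the whole space. *)
Lemma dense_le (R : realType) (X : lmodType R) (b b1 b2 : X -> X -> R) (D : X -> Prop) (C1 C2 : R) :
  psd b -> psd b1 -> psd b2 -> 0 <= C1 -> 0 <= C2 ->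
  (forall u, b1 u u <= C1 * b u u) -> (forall u, b2 u u <= C2 * b u u) ->
  (forall u, approximable b D u) -> (forall u, D u -> b1 u u <= b2 u u) ->
  forall u, b1 u u <= b2 u u.
Proof.
move=> hb h1 h2 C10 C20 le1 le2 hD hle u.
have ex n : exists phi, D phi /\ seminorm b (phi - u) < n.+1%:R^-1.
  have n0 : 0 < n.+1%:R^-1 :> R by rewrite invr_gt0.
  have [phi Dphi h] := hD u _ (exprn_gt0 2 n0); exists phi; split=> //.
  by rewrite seminormB// /seminorm -[ltRHS]gtr0_norm// -sqrtr_sqr ltr_sqrt// exprn_gt0.
pose x n := projT1 (cid (ex n)).
have Dx n : D (x n) by have [] := projT2 (cid (ex n)).
have cx : fcvg b x u.
  move=> e e0; exists (Num.bound e^-1) => i Ni.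
  have [_ h] := projT2 (cid (ex i)); apply: lt_trans h _.
  rewrite invf_plt ?posrE//; apply: lt_le_trans (archi_boundP _) _; first by rewrite invr_ge0 ltW.
  by rewrite ler_nat (leq_trans Ni).
have c1 := fcvg_psd h1 (fcvg_le hb C10 le1 cx).
have c2 := fcvg_psd h2 (fcvg_le hb C20 le2 cx).
have h : forall n, b1 (x n) (x n) <= b2 (x n) (x n) by move=> n; exact: hle.
rewrite -(cvg_lim (@Rhausdorff R) c1) -(cvg_lim (@Rhausdorff R) c2).
apply: ler_lim; [by apply/cvg_ex; eexists; exact: c1|by apply/cvg_ex; eexists; exact: c2|].
by apply: nearW.
Qed.

Section SobolevSpace0.
Context {R : realType} (a1 a2 : R).
Hypotheses (a10 : 0 <= a1) (a20 : 0 <= a2).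
Local Notation plane := (measurableTypeR R * measurableTypeR R)%type.
Local Notation Y := (class_space (H1_class a10 a20)).
Local Notation form1 := (fun u v : Y => H1_form a1 a2 u v).
Local Notation smooth1 := (fun phi : Y => test_function phi).

Lemma smooth1_linear (c : R) (u v : Y) : test_function u -> test_function v ->
  test_function (c *: u + v : Y).
Proof. exact: test_function_linear. Qed.

Lemma tf_H10 phi : test_function phi -> H10 a1 a2 phi.
Proof.
move=> hphi; pose u : Y := to_class (H1_class a10 a20) (tf_H1 a10 a20 hphi).
have : H10 a1 a2 u.
  apply/H10_approximable => eps eps0; exists u; first exact: hphi.
  by rewrite subrr; have -> : H1_form a1 a2 (0 : Y) (0 : Y) = 0 by exact: (psd0l (H1_form_psd a10 a20)).
exact.
Qed.

Lemma H10_H1 u : H10 a1 a2 u -> H1 a1 a2 u.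
Proof. by case. Qed.

Lemma H10_class : linear_class (H10 a1 a2).
Proof.
split; first exact: tf_H10 (test_function0).
move=> c u v hu hv.
pose u' : Y := to_class (H1_class a10 a20) (H10_H1 hu).
pose v' : Y := to_class (H1_class a10 a20) (H10_H1 hv).
have au : approximable form1 smooth1 u' by apply/H10_approximable; exact: hu.
have av : approximable form1 smooth1 v' by apply/H10_approximable; exact: hv.
have := @approximable_linear _ _ _ _ (H1_form_psd a10 a20) smooth1_linear c _ _ au av.
by move/H10_approximable; exact.
Qed.

(** The space [H10] as a vector space. *)
Definition sobolev0 := class_space H10_class.
Local Notation X := sobolev0.

Definition sobolev_mass (u v : X) : R := mass u v.
Definition sobolev_energy (u v : X) : R := energy a1 a2 u v.
Definition sobolev_form (u v : X) : R := sobolev_mass u v + sobolev_energy u v.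
Definition smooth0 (u : X) : Prop := test_function u.

Lemma sobolev_mass_psd : psd sobolev_mass.
Proof. exact: (mass_psd H10_class H10_H1). Qed.

Lemma sobolev_energy_psd : psd sobolev_energy.
Proof. exact: (energy_psd H10_class H10_H1). Qed.

Lemma sobolev_form_psd : psd sobolev_form.
Proof. exact: (psdD sobolev_mass_psd sobolev_energy_psd). Qed.

Definition to_H1 (u : X) : Y := to_class (H1_class a10 a20) (H10_H1 (class_funP u)).

Lemma to_H1_sub (u v : X) : to_H1 (u - v) = to_H1 u - to_H1 v.
Proof. exact: val_inj. Qed.

Lemma sobolev_formE (u : X) : sobolev_form u u = H1_form a1 a2 (to_H1 u) (to_H1 u).
Proof. by []. Qed.

Lemma smooth_dense (u : X) : approximable sobolev_form smooth0 u.
Proof.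
move=> eps eps0.
have : H10 a1 a2 (to_H1 u) by exact: class_funP u.
move=> /H10_approximable/(_ eps eps0)[phi hphi lt].
pose f : X := to_class H10_class (tf_H10 hphi).
exists f; first exact: hphi.
rewrite sobolev_formE to_H1_sub (_ : to_H1 f = phi)//; exact: val_inj.
Qed.

Lemma sobolev_form_complete (x : nat -> X) : fcauchy sobolev_form x ->
  exists l, fcvg sobolev_form x l.
Proof.
move=> hx.
have hx' : fcauchy form1 (to_H1 \o x).
  move=> e /hx[N hN]; exists N => i j Ni Nj; have := hN i j Ni Nj.
  by rewrite /seminorm sobolev_formE to_H1_sub.
have [l hl] := H1_complete hx'.
have al : approximable form1 smooth1 l.
  apply: (approximable_closed (H1_form_psd a10 a20) _ hl) => n.
  by apply/H10_approximable; exact: class_funP (x n).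
have Hl : H10 a1 a2 l by apply/H10_approximable.
pose l0 : X := to_class H10_class Hl.
exists l0 => e /hl[N hN]; exists N => i Ni; have := hN i Ni.
rewrite /seminorm sobolev_formE to_H1_sub (_ : to_H1 l0 = l)//; exact: val_inj.
Qed.

Lemma mass_null_ae (u : X) : sobolev_mass u u = 0 -> {ae (@muO R), forall z : plane, u z = 0}.
Proof.
move=> h; have su := class_square_summable (hP := H10_class) H10_H1 u.
have : {ae (@muO R), forall z : plane, u z * u z = 0}.
  apply: (Rint0_ae (square_summableM su su)) => // z; by rewrite -expr2 sqr_ge0.
by apply: filterS => z /eqP; rewrite mulf_eq0 orbb => /eqP.
Qed.

Lemma sobolev_null (u : X) : sobolev_mass u u = 0 -> sobolev_energy u u = 0.
Proof.
move=> /mass_null_ae h.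
have [mu _] := class_square_summable (hP := H10_class) H10_H1 u.
have ex0 := wderiv_ae (weak_derivative_ae0 (@coord_ex R) mu h).
have ey0 := wderiv_ae (weak_derivative_ae0 (@coord_ey R) mu h).
have [mx _] := class_gradx_summable (hP := H10_class) H10_H1 u.
have [my _] := class_grady_summable (hP := H10_class) H10_H1 u.
have m0 : measurable_fun setT ((fun=> 0) : plane -> R) by exact: measurable_cst.
have i0 : \int[@muO R]_z (0 : R) = 0 by rewrite Rintegral_cst// mul0r.
have e1 : energy_x a1 u u = 0.
  apply: (eq_trans (@Rint_ae _ _ _ (@muO R) _ _ (measurable_funM mx mx) m0 _) i0).
  apply: filterS ex0 => z e; have g0 : gradx a1 u z = 0 by rewrite /gradx e mulr0.
  by change (gradx a1 u z * gradx a1 u z = 0); rewrite g0 mulr0.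
have e2 : energy_y a2 u u = 0.
  apply: (eq_trans (@Rint_ae _ _ _ (@muO R) _ _ (measurable_funM my my) m0 _) i0).
  apply: filterS ey0 => z e; have g0 : grady a2 u z = 0 by rewrite /grady e mulr0.
  by change (grady a2 u z * grady a2 u z = 0); rewrite g0 mulr0.
have -> : sobolev_energy u u = energy_x a1 u u + energy_y a2 u u by [].
by rewrite e1 e2 addr0.
Qed.

Lemma unif_itv (a b : R) : 0 <= a -> a < b -> b <= 1 -> (0 < @unif R `]a, b[%classic)%E.
Proof.
move=> a0 ab b1.
have h : (0 < lebesgue_measure (`]a, b[%classic `&` `]0%R, 1%R[%classic))%E.
  rewrite (_ : _ `&` _ = `]a, b[%classic); last first.
    apply/seteqP; split=> [t []//|t tab]; split=> //; move: tab; rewrite /= !in_itv/=.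
    by move=> /andP[t1 t2]; rewrite (le_lt_trans a0)//= (lt_le_trans t2).
  by rewrite lebesgue_measure_itv/= lte_fin ab lte_fin subr_gt0.
rewrite -unifE in h; [exact: h|exact: measurable_itv].
Qed.

Lemma rect_ae_witness (a b c d : R) (Q : plane -> Prop) : 0 <= a -> a < b -> b <= 1 ->
  0 <= c -> c < d -> d <= 1 -> {ae (@muO R), forall z : plane, Q z} ->
  exists2 z : plane, Q z & (a < z.1 < b) && (c < z.2 < d).
Proof.
move=> a0 ab b1 c0 cd d1 [N [mN N0 sub]].
apply: contrapT => /forall2NP h.
have : (muO (`]a, b[%classic `*` `]c, d[%classic : set plane) <= muO N)%E.
  apply: le_measure; rewrite ?inE//; first by apply: measurableX; exact: measurable_itv.
  move=> z [/= z1 z2]; apply: sub => /= Qz; have [nQ|nz] := h z; first exact: nQ Qz.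
  by apply: nz; move: z1 z2; rewrite ?in_itv/= => -> ->.
rewrite N0.
have mQ : measurable (`]a, b[%classic `*` `]c, d[%classic : set plane).
  by apply: measurableX; exact: measurable_itv.
move=> le0; have {le0} := le_trans (eq_ind _ (fun x => (x <= _)%E) le0 _ (muOE mQ)) (lexx _).
rewrite product_measure1E; try exact: measurable_itv.
by rewrite leNgt mule_gt0// unif_itv.
Qed.

(** Bumps supported in disjoint vertical strips. *)
Lemma sobolev_infinite n : exists f : 'I_n -> X, independent sobolev_mass f.
Proof.
pose a (k : nat) : R := k.+1%:R / n.+2%:R.
have n0 : 0 < n.+2%:R :> R by rewrite ltr0n.
have aS k : a k < a k.+1 by rewrite ltr_pM2r ?invr_gt0// ltr_nat.
have amono k l : (k <= l)%N -> a k <= a l by move=> kl; rewrite ler_pM2r ?invr_gt0// ler_nat ltnS.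
have a0 k : 0 < a k by rewrite divr_gt0// ltr0n.
have a1' (k : 'I_n) : a k.+1 < 1 by rewrite ltr_pdivrMr// mul1r ltr_nat !ltnS; exact: ltn_ord.
have q1 : (0 : R) < 4^-1 by lra.
have q2 : (4^-1 : R) < 2^-1 by lra.
have q3 : (2^-1 : R) < 1 by lra.
pose g (k : 'I_n) := tensor (bump 0%N (a k) (a k.+1)) (bump 0%N 4^-1 2^-1).
have tg k : test_function (g k) by apply: bump_test_function.
pose f k : X := to_class H10_class (tf_H10 (tg k)).
exists f => c /mass_null_ae h k.
have [z hz /andP[z1 z2]] := rect_ae_witness (ltW (a0 k)) (aS k) (ltW (a1' k))
  (ltW q1) q2 (ltW q3) h.
move: hz; rewrite class_sum (bigD1 k)//= big1 => [|j jk].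
  rewrite addr0 => /eqP; rewrite mulf_eq0 => /orP[/eqP//|/eqP h0].
  have : 0 < bump 0%N (a k) (a k.+1) z.1 * bump 0%N 4^-1 2^-1 z.2.
    by rewrite mulr_gt0// bump_gt0.
  by move: h0; rewrite /g /tensor => ->; rewrite ltxx.
rewrite /g /tensor (@bump_out _ _ (a j) (a j.+1) z.1) ?mul0r ?mulr0//.
apply/negP => /andP[w1 w2]; move: z1 => /andP[z1 z1'].
have [jk'|kj|e] := ltngtP j k.
- by have := lt_trans z1 w2; rewrite ltNge amono.
- by have := lt_trans w1 z1'; rewrite ltNge amono.
- by move: jk; rewrite (val_inj e) eqxx.
Qed.

End SobolevSpace0.

(** * From oscillation on a cell to a Poincare inequality *)

Section CellLemma.
Context d (T : measurableType d) (R : realType) (mu : {measure set T -> \bar R}).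
Variables (f h : T -> R) (Q : set T) (eta : R).
Hypotheses (sf : square_summable mu f) (sh : summable mu h) (muT : (mu setT < +oo)%E).
Hypotheses (h0 : forall z, 0 <= h z) (eta0 : 0 <= eta) (mQ : measurable Q).
Hypothesis osc : forall z z', Q z -> Q z' -> (f z - f z') ^+ 2 <= eta * (h z + h z').

Let I z : R := \1_Q z.
Let mI : measurable_fun setT I. Proof. exact: measurable_indic. Qed.
Let I01 z : I z = 0 \/ I z = 1 /\ Q z.
Proof.
rewrite /I indicE; case: (boolP (z \in Q)) => [/set_mem Qz|_]; by [right|left].
Qed.
Let sI : summable mu I.
Proof.
apply: (summable_bounded muT (C := 1)) => // z.
by have [->|[->]] := I01 z; rewrite ?normr0 ?normr1.
Qed.
Let summable_indic g : summable mu g -> summable mu (fun z => g z * I z).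
Proof.
move=> sg; apply: (summable_le _ (summable_norm sg)).
  by exact: measurable_funM (summable_measurable sg) mI.
move=> z; have [->|[-> _]] := I01 z; last by rewrite mulr1 /= lexx.
by rewrite mulr0 normr0 /= normr_ge0.
Qed.

(** Integrating the oscillation bound over [z] and [z'] in the cell gives
    [2 q F2 - 2 F1^2 <= 2 eta q H], where [q] is the measure of the cell. *)
Lemma cell_poincare : \int[mu]_z (f z ^+ 2 * I z) <=
  eta * \int[mu]_z (h z * I z) + (\int[mu]_z I z)^-1 * (\int[mu]_z (f z * I z)) ^+ 2.
Proof.
have [mf sf2] := sf; have sf1 := square_summable_summable muT sf.
set F2 := \int[mu]_z (f z ^+ 2 * I z); set F1 := \int[mu]_z (f z * I z).
set H := \int[mu]_z (h z * I z); set q := \int[mu]_z I z.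
have s2 := summable_indic sf2; have s1 := summable_indic sf1; have s3 := summable_indic sh.
have I0 z : 0 <= I z by have [->|[->]] := I01 z.
have q0 : 0 <= q by exact: Rint_ge0.
have H0 : 0 <= H by apply: Rint_ge0 => z; rewrite mulr_ge0.
have lin a b c : \int[mu]_z (a * (f z ^+ 2 * I z) + (b * (f z * I z) + c * I z)) =
    a * F2 + (b * F1 + c * q).
  have t1 := summableZ a s2; have t2 := summableZ b s1; have t3 := summableZ c sI.
  by rewrite (RintD t1 (summableD t2 t3)) (RintD t2 t3) !RintZ.
have slin a b c : summable mu (fun z => a * (f z ^+ 2 * I z) + (b * (f z * I z) + c * I z)).
  exact: (summableD (summableZ a s2) (summableD (summableZ b s1) (summableZ c sI))).
have hlin c e : \int[mu]_z (c * (h z * I z) + e * I z) = c * H + e * q.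
  by rewrite (RintD (summableZ c s3) (summableZ e sI)) !RintZ.
have shlin c e : summable mu (fun z => c * (h z * I z) + e * I z).
  exact: (summableD (summableZ c s3) (summableZ e sI)).
have one z' : Q z' -> F2 + (- 2 * f z' * F1 + f z' ^+ 2 * q) <= eta * H + eta * h z' * q.
  move=> Qz'; rewrite -[F2]mul1r -lin -hlin; apply: Rint_le => // z.
  have [->|[-> Qz]] := I01 z; first by rewrite !mulr0 !addr0.
  by have := osc Qz Qz'; rewrite !mulr1 sqrrB; lra.
have two : q * F2 + (- 2 * F1 * F1 + q * F2) <= eta * H * q + eta * q * H.
  have e1 : \int[mu]_z (q * (f z ^+ 2 * I z) + (- 2 * F1 * (f z * I z) + F2 * I z)) <=
      \int[mu]_z (eta * q * (h z * I z) + eta * H * I z).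
    apply: Rint_le => // z; have [->|[-> Qz]] := I01 z; first by rewrite !mulr0 !addr0.
    by have := one z Qz; rewrite !mulr1; lra.
  by move: e1; rewrite lin hlin; lra.
have [q1|q1] := eqVneq q 0.
  have F20 : F2 = 0.
    transitivity (\int[mu]_z (0 : R)); last by rewrite Rintegral_cst// mul0r.
    apply: Rint_ae; [by apply: measurable_funM => //; exact: measurable_funX|
      exact: measurable_cst|].
    by apply: filterS (Rint0_ae sI I0 q1) => z ->; rewrite mulr0.
  by rewrite F20 q1 invr0 mul0r addr0 mulr_ge0.
have qp : 0 < q by rewrite lt_neqAle eq_sym q1.
rewrite -(ler_pM2l qp) mulrDr (mulrA q q^-1) divff// mul1r.
move: two; rewrite expr2; lra.
Qed.

End CellLemma.

Section BoundedFubini.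
Context {R : realType}.
Local Notation plane := (measurableTypeR R * measurableTypeR R)%type.
Variables (g : plane -> R) (C : R).
Hypotheses (mg : measurable_fun setT g) (g0 : forall z, 0 <= g z) (gC : forall z, g z <= C).

Lemma slice1_summable y : summable (@unif R) (fun x => g (x, y)).
Proof.
apply: (summable_bounded unif_lty (C := C)) => [|x]; last by rewrite ger0_norm.
by apply: (measurableT_comp mg); exact: pair2_measurable.
Qed.

Lemma slice2_summable x : summable (@unif R) (fun y => g (x, y)).
Proof.
apply: (summable_bounded unif_lty (C := C)) => [|y]; last by rewrite ger0_norm.
by apply: (measurableT_comp mg); exact: pair1_measurable.
Qed.

Lemma slice_integral1_measurable : measurable_fun setT (fun y => \int[@unif R]_x g (x, y)).
Proof.
apply: (measurableT_comp (f := fine)) => //.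
apply: (@measurable_fun_fubini_tonelli_G _ _ _ _ _ (@unif R) (EFin \o g)).
  exact/measurable_EFinP.
by move=> z; rewrite /= lee_fin.
Qed.

Lemma slice_integral2_measurable : measurable_fun setT (fun x => \int[@unif R]_y g (x, y)).
Proof.
apply: (measurableT_comp (f := fine)) => //.
apply: (@measurable_fun_fubini_tonelli_F _ _ _ _ _ (@unif R) (EFin \o g)).
  exact/measurable_EFinP.
by move=> z; rewrite /= lee_fin.
Qed.

Let unifT : \int[@unif R]_x C = C.
Proof. by rewrite Rintegral_cst//= probability_setT/= mulr1. Qed.

Lemma slice_integral1_itv y : 0 <= \int[@unif R]_x g (x, y) <= C.
Proof.
rewrite Rint_ge0//= -[leRHS]unifT; apply: Rint_le => //; first exact: slice1_summable.
exact: (summable_cst unif_lty).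
Qed.

Lemma slice_integral2_itv x : 0 <= \int[@unif R]_y g (x, y) <= C.
Proof.
rewrite Rint_ge0//= -[leRHS]unifT; apply: Rint_le => //; first exact: slice2_summable.
exact: (summable_cst unif_lty).
Qed.

Lemma bounded_fubini1 : \int[muO]_z g z = \int[@unif R]_y \int[@unif R]_x g (x, y).
Proof.
rewrite /Rintegral muO_tonelli2; [|exact/measurable_EFinP|by move=> z; rewrite lee_fin].
congr fine; apply: eq_integral => y _; rewrite -EFin_Rint//; exact: slice1_summable.
Qed.

Lemma bounded_fubini2 : \int[muO]_z g z = \int[@unif R]_x \int[@unif R]_y g (x, y).
Proof.
rewrite /Rintegral muO_tonelli1; [|exact/measurable_EFinP|by move=> z; rewrite lee_fin].
congr fine; apply: eq_integral => y _; rewrite -EFin_Rint//; exact: slice2_summable.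
Qed.

End BoundedFubini.

Section ProductIntegral.
Context {R : realType}.
Local Notation plane := (measurableTypeR R * measurableTypeR R)%type.

Lemma integral_tensor (f g : R -> R) C D : measurable_fun setT f -> measurable_fun setT g ->
  (forall x, 0 <= f x <= C) -> (forall x, 0 <= g x <= D) ->
  \int[@muO R]_z (f z.1 * g z.2) = \int[@unif R]_x f x * \int[@unif R]_x g x.
Proof.
move=> mf mg hf hg.
have sg : summable (@unif R) g.
  apply: (summable_bounded unif_lty (C := D)) => // x.
  by have /andP[g0 gD] := hg x; rewrite ger0_norm.
have sf : summable (@unif R) f.
  apply: (summable_bounded unif_lty (C := C)) => // x.
  by have /andP[g0 gD] := hf x; rewrite ger0_norm.
rewrite (@bounded_fubini2 R _ (C * D)).
- transitivity (\int[@unif R]_x ((\int[@unif R]_y g y) * f x)).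
    by apply: Rint_eq => x; rewrite (RintZ (f x) sg) mulrC.
  by rewrite RintZ// mulrC.
- by apply: measurable_funM; [exact: (measurableT_comp mf measurable_fst)|
    exact: (measurableT_comp mg measurable_snd)].
- by move=> z; have /andP[? _] := hf z.1; have /andP[? _] := hg z.2; rewrite mulr_ge0.
- by move=> z; have /andP[? ?] := hf z.1; have /andP[? ?] := hg z.2; rewrite ler_pM.
Qed.

End ProductIntegral.

(** * Pointwise estimates for test functions *)

(** Writes [r] as [r^(1 - 2 a) * r^(2 a)]: a path of length [r] at height [y >= r]
    gains a positive power of [r] after paying for the weight [y^(2 a)]. *)
Lemma ler_powR_weight (R : realType) (r y a g : R) : 0 < r <= 1 -> r <= y -> 0 <= a ->
  g + 2 * a <= 1 -> r <= r `^ g * y `^ (2 * a).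
Proof.
move=> /andP[r0 r1] ry a0 ga.
have e : r = r `^ (1 - 2 * a) * r `^ (2 * a).
  by rewrite -powRD ?subrK ?powRr1 ?(ltW r0)//; apply/implyP => _; rewrite gt_eqF.
rewrite [leLHS]e ler_pM ?powR_ge0//.
  by apply: ger_powR; [rewrite r0 r1|lra].
by apply: ge0_ler_powR; rewrite ?nnegrE ?mulr_ge0 ?(ltW r0)// (le_trans (ltW r0)).
Qed.

Lemma sqr_powR (R : realType) (x a : R) : (x `^ a) ^+ 2 = x `^ (2 * a).
Proof. by rewrite -powR_mulrn ?powR_ge0// -powRrM mulrC. Qed.

Section TestFunctionEstimates.
Context {R : realType} (a1 a2 g : R).
Hypotheses (a10 : 0 <= a1) (a20 : 0 <= a2) (g0 : 0 <= g).
Hypotheses (ga1 : g + 2 * a1 <= 1) (ga2 : g + 2 * a2 <= 1).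
Local Notation plane := (measurableTypeR R * measurableTypeR R)%type.
Variables (phi : R * R -> R) (hphi : test_function phi).

(** The energy of the horizontal slice at height [y], without its weight. *)
Definition slope_x (y : R) : R := \int[@unif R]_s (partial ex phi (s, y) ^+ 2).
Definition slope_y (x : R) : R := \int[@unif R]_s (partial ey phi (x, s) ^+ 2).
Definition density_x (y : R) : R := y `^ (2 * a1) * slope_x y.
Definition density_y (x : R) : R := x `^ (2 * a2) * slope_y x.
(** A function of the point whose integral is the energy and which controls the
    squared oscillation of [phi]. *)
Definition density (z : plane) : R := density_x z.2 + density_y z.1.

Let sqr_bound e : coordinate e -> exists C, forall z, 0 <= partial e phi z ^+ 2 <= C.
Proof.
move=> he; have [C hC] := tf_partial_bounded hphi he; exists (C ^+ 2) => z.
by rewrite sqr_ge0 -real_normK ?num_real// lerXn2r ?nnegrE// (le_trans _ (hC z)).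
Qed.

Let msqr e : coordinate e -> measurable_fun setT (fun z : plane => partial e phi z ^+ 2).
Proof. by move=> he; apply: measurable_funX; exact: tf_partial_measurable. Qed.

Lemma slope_x_ge0 y : 0 <= slope_x y.
Proof. by apply: Rint_ge0 => s; exact: sqr_ge0. Qed.

Lemma slope_y_ge0 x : 0 <= slope_y x.
Proof. by apply: Rint_ge0 => s; exact: sqr_ge0. Qed.

Lemma density_x_ge0 y : 0 <= density_x y.
Proof. by rewrite mulr_ge0 ?powR_ge0 ?slope_x_ge0. Qed.

Lemma density_y_ge0 y : 0 <= density_y y.
Proof. by rewrite mulr_ge0 ?powR_ge0 ?slope_y_ge0. Qed.

Lemma density_ge0 z : 0 <= density z.
Proof. by rewrite addr_ge0 ?density_x_ge0 ?density_y_ge0. Qed.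

Lemma density_x_le z : density_x z.2 <= density z.
Proof. by rewrite /density lerDl; exact: density_y_ge0. Qed.

Lemma density_y_le z : density_y z.1 <= density z.
Proof. by rewrite /density lerDr; exact: density_x_ge0. Qed.

Lemma density_x_measurable : measurable_fun setT density_x.
Proof.
apply: measurable_funM; first exact: measurable_powR.
exact: (@slice_integral1_measurable R _ (msqr (@coord_ex R)) (fun z => sqr_ge0 _)).
Qed.

Lemma density_y_measurable : measurable_fun setT density_y.
Proof.
apply: measurable_funM; first exact: measurable_powR.
exact: (@slice_integral2_measurable R _ (msqr (@coord_ey R)) (fun z => sqr_ge0 _)).
Qed.

Lemma density_x_bounded : exists C, forall y, 0 <= density_x y <= C.
Proof.
have [C hC] := sqr_bound (@coord_ex R).
have C0 : 0 <= C by have /andP[h1 h2] := hC (0, 0); exact: le_trans h2.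
exists C => y; rewrite density_x_ge0/=.
have /andP[s0 sC] : 0 <= slope_x y <= C.
  apply: (@slice_integral1_itv R _ C (msqr (@coord_ex R))) => z; first exact: sqr_ge0.
  by have /andP[] := hC z.
have [yO|yO] := boolP (0 < y < 1).
  by apply: le_trans sC; rewrite ler_piMl// weight_le1// mulr_ge0.
rewrite /density_x (_ : slope_x y = 0) ?mulr0//.
transitivity (\int[@unif R]_s (0 : R)); last by rewrite Rintegral_cst// mul0r.
apply: Rint_eq => s; rewrite (tf_partial_outside ex hphi) ?expr0n// => -[_ /=].
by rewrite in_itv/= (negbTE yO).
Qed.

Lemma density_y_bounded : exists C, forall x, 0 <= density_y x <= C.
Proof.
have [C hC] := sqr_bound (@coord_ey R).
have C0 : 0 <= C by have /andP[h1 h2] := hC (0, 0); exact: le_trans h2.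
exists C => x; rewrite density_y_ge0/=.
have /andP[s0 sC] : 0 <= slope_y x <= C.
  apply: (@slice_integral2_itv R _ C (msqr (@coord_ey R))) => z; first exact: sqr_ge0.
  by have /andP[] := hC z.
have [xO|xO] := boolP (0 < x < 1).
  by apply: le_trans sC; rewrite ler_piMl// weight_le1// mulr_ge0.
rewrite /density_y (_ : slope_y x = 0) ?mulr0//.
transitivity (\int[@unif R]_s (0 : R)); last by rewrite Rintegral_cst// mul0r.
apply: Rint_eq => s; rewrite (tf_partial_outside ey hphi) ?expr0n// => -[/=].
by rewrite in_itv/= (negbTE xO).
Qed.

Lemma weight_tf_bounded e (w : plane -> R) : coordinate e -> measurable_fun setT w ->
  (forall z, Omega z -> 0 <= w z <= 1) ->
  measurable_fun setT (fun z : plane => (w z * partial e phi z) ^+ 2) /\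
  exists C, forall z, (w z * partial e phi z) ^+ 2 <= C.
Proof.
move=> he mw hw; split.
  by apply: measurable_funX; apply: measurable_funM => //; exact: tf_partial_measurable.
have [C hC] := tf_partial_bounded hphi he; exists (C ^+ 2) => z.
have h := tf_weighted_bound hphi hw hC z.
by rewrite -real_normK ?num_real// lerXn2r ?nnegrE// (le_trans _ h).
Qed.

Lemma energy_x_density : energy_x a1 phi phi = \int[@unif R]_y density_x y.
Proof.
have hw z : Omega z -> 0 <= z.2 `^ a1 <= 1.
  by move=> [_ /=]; rewrite in_itv/= => hz; rewrite powR_ge0 weight_le1.
have [mw [C hC]] := weight_tf_bounded (@coord_ex R) (measurable_weightx a1) hw.
transitivity (\int[@muO R]_z ((z.2 `^ a1 * partial ex phi z) ^+ 2)).
  have /H1P[_ [_ [mx _]] _] := tf_H1 a10 a20 hphi.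
  apply: (@Rint_ae _ _ _ (@muO R) _ _ (measurable_funM mx mx) mw).
  by apply: filterS (tf_gradx a1 hphi) => z e; rewrite /= e expr2.
rewrite (@bounded_fubini1 R _ C mw (fun z => sqr_ge0 _) hC); apply: Rint_eq => y.
rewrite /density_x -sqr_powR -RintZ; last first.
  have [D hD] := sqr_bound (@coord_ex R).
  apply: (@slice1_summable R _ D (msqr (@coord_ex R))) => z; first exact: sqr_ge0.
  by have /andP[] := hD z.
by apply: Rint_eq => x; rewrite exprMn.
Qed.

Lemma energy_y_density : energy_y a2 phi phi = \int[@unif R]_x density_y x.
Proof.
have hw z : Omega z -> 0 <= z.1 `^ a2 <= 1.
  by move=> [/= + _]; rewrite in_itv/= => hz; rewrite powR_ge0 weight_le1.
have [mw [C hC]] := weight_tf_bounded (@coord_ey R) (measurable_weighty a2) hw.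
transitivity (\int[@muO R]_z ((z.1 `^ a2 * partial ey phi z) ^+ 2)).
  have /H1P[_ _ [_ [mx _]]] := tf_H1 a10 a20 hphi.
  apply: (@Rint_ae _ _ _ (@muO R) _ _ (measurable_funM mx mx) mw).
  by apply: filterS (tf_grady a2 hphi) => z e; rewrite /= e expr2.
rewrite (@bounded_fubini2 R _ C mw (fun z => sqr_ge0 _) hC); apply: Rint_eq => x.
rewrite /density_y -sqr_powR -RintZ; last first.
  have [D hD] := sqr_bound (@coord_ey R).
  apply: (@slice2_summable R _ D (msqr (@coord_ey R))) => z; first exact: sqr_ge0.
  by have /andP[] := hD z.
by apply: Rint_eq => y; rewrite exprMn.
Qed.

Lemma density_measurable : measurable_fun setT density.
Proof.
apply: measurable_funD; first exact: (measurableT_comp density_x_measurable measurable_snd).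
exact: (measurableT_comp density_y_measurable measurable_fst).
Qed.

Lemma density_summable : summable muO density.
Proof.
have [C hC] := density_x_bounded; have [D hD] := density_y_bounded.
apply: (summable_bounded muO_lty (C := C + D)); first exact: density_measurable.
move=> z; rewrite ger0_norm ?density_ge0// lerD//.
  by have /andP[] := hC z.2.
by have /andP[] := hD z.1.
Qed.

Lemma energy_density : \int[@muO R]_z density z = energy a1 a2 phi phi.
Proof.
have [C hC] := density_x_bounded; have [D hD] := density_y_bounded.
have one (x : R) : 0 <= (1 : R) <= 1 by rewrite ler01 lexx.
have m1 : measurable_fun setT ((fun=> 1) : R -> R) by exact: measurable_cst.
have u1 : \int[@unif R]_x (1 : R) = 1 by rewrite Rintegral_cst//= probability_setT/= mulr1.
have e1 := integral_tensor m1 density_x_measurable one hC; rewrite u1 mul1r in e1.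
have e2 := integral_tensor density_y_measurable m1 hD one; rewrite u1 mulr1 in e2.
have s1 : summable muO (fun z : plane => 1 * density_x z.2).
  apply: (summable_bounded muO_lty (C := C)).
    by apply: measurable_funM => //; exact: (measurableT_comp density_x_measurable measurable_snd).
  by move=> z; rewrite mul1r ger0_norm ?density_x_ge0//; have /andP[] := hC z.2.
have s2 : summable muO (fun z : plane => density_y z.1 * 1).
  apply: (summable_bounded muO_lty (C := D)).
    by apply: measurable_funM => //; exact: (measurableT_comp density_y_measurable measurable_fst).
  by move=> z; rewrite mulr1 ger0_norm ?density_y_ge0//; have /andP[] := hD z.1.
apply: (eq_trans _ (congr2 +%R (eq_trans e1 (esym energy_x_density))
  (eq_trans e2 (esym energy_y_density)))).
apply: (eq_trans _ (RintD s1 s2)).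
by apply: Rint_eq => z; rewrite mul1r mulr1.
Qed.

Lemma slice_osc_x y s x : 0 <= s <= 1 -> 0 <= x <= 1 ->
  (phi (x, y) - phi (s, y)) ^+ 2 <= `|x - s| * slope_x y.
Proof.
have [C hC] := tf_partial_bounded hphi (@coord_ex R).
move=> hs hx; apply: (unif_oscillation (tf_slice_ex hphi y) _ (C := C)) => //.
by apply: slice_continuous1; exact: tf_partial_continuous (@coord_ex R).
Qed.

Lemma slice_osc_y x s y : 0 <= s <= 1 -> 0 <= y <= 1 ->
  (phi (x, y) - phi (x, s)) ^+ 2 <= `|y - s| * slope_y x.
Proof.
have [C hC] := tf_partial_bounded hphi (@coord_ey R).
move=> hs hx; apply: (unif_oscillation (tf_slice_ey hphi x) _ (C := C)) => //.
by apply: slice_continuous2; exact: tf_partial_continuous (@coord_ey R).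
Qed.

Lemma tf_sqr_le_x x y : 0 <= x <= 1 -> phi (x, y) ^+ 2 <= x * slope_x y.
Proof.
move=> hx; have := @slice_osc_x y 0 x; rewrite lexx ler01 => /(_ isT hx).
rewrite (@tf_boundary _ phi 0 y)// ?subr0; last by move=> [/=]; rewrite in_itv/= ltxx.
by have /andP[x0 _] := hx; rewrite ger0_norm.
Qed.

Lemma tf_sqr_le_y x y : 0 <= y <= 1 -> phi (x, y) ^+ 2 <= y * slope_y x.
Proof.
move=> hy; have := @slice_osc_y x 0 y; rewrite lexx ler01 => /(_ isT hy).
rewrite (@tf_boundary _ phi x 0)// ?subr0; last by move=> [_ /=]; rewrite in_itv/= ltxx.
by have /andP[y0 _] := hy; rewrite ger0_norm.
Qed.

Lemma slope_x_density r y : 0 < r <= 1 -> r <= y -> r * slope_x y <= r `^ g * density_x y.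
Proof.
by move=> hr ry; rewrite /density_x mulrA ler_wpM2r ?slope_x_ge0// ler_powR_weight.
Qed.

Lemma slope_y_density r x : 0 < r <= 1 -> r <= x -> r * slope_y x <= r `^ g * density_y x.
Proof.
by move=> hr rx; rewrite /density_y mulrA ler_wpM2r ?slope_y_ge0// ler_powR_weight.
Qed.

Let OmegaE (z : R * R) : Omega z -> (0 < z.1 < 1) && (0 < z.2 < 1).
Proof. by move=> [/=]; rewrite !in_itv/= => -> ->. Qed.

(** Near a side of the square the value of [phi] itself is small: it is reached from
    the vertical side when [x <= y] and from the horizontal side otherwise, so that
    the length of the path never exceeds the coordinate that enters the weight. *)
Lemma tf_boundary_layer (z : plane) r : Omega z -> 0 < r <= 1 -> z.1 <= r \/ z.2 <= r ->
  phi z ^+ 2 <= r `^ g * density z.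
Proof.
case: z => x y /OmegaE/=/andP[/andP[x0 x1] /andP[y0 y1]] /andP[r0 r1] hr.
have mono t : 0 < t -> t <= r -> t `^ g <= r `^ g.
  by move=> t0 tr; apply: ge0_ler_powR; rewrite ?nnegrE// ltW.
have [xy|yx] := leP x y.
  have xr : x <= r by case: hr => // yr; exact: le_trans xy yr.
  apply: le_trans (tf_sqr_le_x _ _) _; first by rewrite !ltW.
  apply: le_trans (slope_x_density _ xy) _; first by rewrite x0 ltW.
  rewrite /density/= ler_pM ?powR_ge0 ?density_x_ge0 ?mono//.
  by rewrite lerDl density_y_ge0.
have yr : y <= r by case: hr => // xr; exact: le_trans (ltW yx) xr.
apply: le_trans (tf_sqr_le_y _ _) _; first by rewrite !ltW.
apply: le_trans (slope_y_density _ (ltW yx)) _; first by rewrite y0 ltW.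
rewrite /density/= ler_pM ?powR_ge0 ?density_y_ge0 ?mono//.
by rewrite lerDr density_x_ge0.
Qed.

(** Away from the sides a horizontal step followed by a vertical one joins the two
    points at the price of their weights; in the layer near the sides both values
    are small. *)
Lemma tf_oscillation (z z' : plane) r : Omega z -> Omega z' -> 0 < r <= 1 ->
  `|z.1 - z'.1| <= r -> `|z.2 - z'.2| <= r -> (z.1 < r) = (z'.1 < r) -> (z.2 < r) = (z'.2 < r) ->
  (phi z - phi z') ^+ 2 <= 2 * r `^ g * (density z + density z').
Proof.
move=> Oz Oz' hr d1 d2 c1 c2.
have sq (a b : R) : (a + b) ^+ 2 <= 2 * (a ^+ 2 + b ^+ 2).
  by have := sqr_ge0 (a - b); rewrite sqrrB sqrrD; lra.
rewrite -mulrA mulrDr; have [/orP near|] := boolP ((z.1 < r) || (z.2 < r)).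
  have near' : z'.1 <= r \/ z'.2 <= r by rewrite c1 c2 in near; case: near => /ltW; [left|right].
  have {}near : z.1 <= r \/ z.2 <= r by case: near => /ltW; [left|right].
  apply: le_trans (sq _ (- phi z')) _; rewrite sqrrN ler_pM2l// lerD//.
    exact: tf_boundary_layer.
  exact: tf_boundary_layer.
rewrite negb_or -!leNgt => /andP[x1 y1].
have /OmegaE := Oz; have /OmegaE := Oz'.
case: z z' {Oz Oz'} x1 y1 d1 d2 c1 c2 => [x y] [x' y'] /= rx ry d1 d2 c1 c2.
move=> /andP[/andP[x'0 x'1] /andP[y'0 y'1]] /andP[/andP[x0 x1] /andP[y0 y1]].
have rx' : r <= x' by rewrite leNgt -c1 -leNgt.
have [ix ix'] : 0 <= x <= 1 /\ 0 <= x' <= 1 by rewrite (ltW x0) (ltW x'0) !ltW.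
have [iy iy'] : 0 <= y <= 1 /\ 0 <= y' <= 1 by rewrite (ltW y0) (ltW y'0) !ltW.
have h1 : (phi (x, y) - phi (x', y)) ^+ 2 <= r `^ g * density_x y.
  apply: le_trans (slice_osc_x _ ix' ix) _.
  by apply: le_trans (slope_x_density hr ry); rewrite ler_wpM2r ?slope_x_ge0.
have h2 : (phi (x', y) - phi (x', y')) ^+ 2 <= r `^ g * density_y x'.
  apply: le_trans (slice_osc_y _ iy' iy) _.
  by apply: le_trans (slope_y_density hr rx'); rewrite ler_wpM2r ?slope_y_ge0.
have -> : phi (x, y) - phi (x', y') = (phi (x, y) - phi (x', y)) + (phi (x', y) - phi (x', y')).
  by ring.
apply: le_trans (sq _ _) _; rewrite ler_pM2l//; apply: lerD.
  by apply: (le_trans h1); apply: ler_wpM2l; [exact: powR_ge0|exact: (density_x_le (x, y))].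
by apply: (le_trans h2); apply: ler_wpM2l; [exact: powR_ge0|exact: (density_y_le (x', y'))].
Qed.

Lemma tf_poincare : mass phi phi <= energy a1 a2 phi phi.
Proof.
rewrite -energy_density.
have [C hC] := tf_bounded hphi.
have sphi : square_summable muO phi.
  by apply: (square_summable_bounded muO_lty (C := C)) => //; exact: tf_measurable.
apply: Rint_le; [exact: square_summableM|exact: density_summable|].
move=> z; rewrite -expr2; have [Oz|nOz] := pselect (Omega z); last first.
  by case: z nOz => x y nO; rewrite (tf_boundary hphi nO) expr0n density_ge0.
have := @tf_boundary_layer z 1 Oz; rewrite powR1 mul1r ltr01 lexx => /(_ isT); apply.
by have /andP[/andP[_ /ltW]] := OmegaE Oz; left.
Qed.

(** The bounds [x * slope_x y] and [y * slope_y x] of [phi^2] are multiplied; after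
    exchanging the factors [x] and [y], each is absorbed by the weight of the other
    slope. *)
Lemma tf_quartic : \int[@muO R]_z (phi z ^+ 4) <= energy_x a1 phi phi * energy_y a2 phi phi.
Proof.
have [C hC] := density_x_bounded; have [D hD] := density_y_bounded.
have [K hK] := tf_bounded hphi.
have e := eq_trans (integral_tensor density_y_measurable density_x_measurable hD hC)
  (congr2 *%R (esym energy_y_density) (esym energy_x_density)).
rewrite mulrC -e; apply: Rint_le.
- apply: (summable_bounded muO_lty (C := K ^+ 4)).
    by apply: measurable_funX; exact: tf_measurable.
  by move=> z; rewrite normrX lerXn2r ?nnegrE// (le_trans _ (hK z)).
- apply: (summable_bounded muO_lty (C := D * C)).
    apply: measurable_funM; first exact: (measurableT_comp density_y_measurable measurable_fst).
    exact: (measurableT_comp density_x_measurable measurable_snd).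
  move=> z; have /andP[d1 d2] := hD z.1; have /andP[d3 d4] := hC z.2.
  by rewrite (ger0_norm (mulr_ge0 d1 d3)); exact: (ler_pM d1 d3 d2 d4).
move=> -[x y]/=; have [Oz|nOz] := pselect (Omega (x, y)); last first.
  by rewrite (tf_boundary hphi nOz) expr0n mulr_ge0 ?density_x_ge0 ?density_y_ge0.
have /andP[/andP[/= x0 x1] /andP[y0 y1]] := OmegaE Oz.
rewrite (_ : 4%N = (2 * 2)%N)// exprM expr2.
have h1 : phi (x, y) ^+ 2 <= x * slope_x y by apply: tf_sqr_le_x; rewrite !ltW.
have h2 : phi (x, y) ^+ 2 <= y * slope_y x by apply: tf_sqr_le_y; rewrite !ltW.
have w (t a : R) : 0 < t -> t < 1 -> 0 <= a -> g + 2 * a <= 1 -> t <= t `^ (2 * a).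
  move=> t0 t1 a0 ga; have ht : 0 < t <= 1 by rewrite t0 ltW.
  have a_le : 0 + 2 * a <= 1 by apply: le_trans ga; rewrite lerD2r.
  by have := ler_powR_weight ht (lexx t) a0 a_le; rewrite powRr0 mul1r.
have k1 : x * slope_y x <= density_y x := ler_wpM2r (slope_y_ge0 x) (w x a2 x0 x1 a20 ga2).
have k2 : y * slope_x y <= density_x y := ler_wpM2r (slope_x_ge0 y) (w y a1 y0 y1 a10 ga1).
have k3 := ler_pM (mulr_ge0 (ltW x0) (slope_y_ge0 x)) (mulr_ge0 (ltW y0) (slope_x_ge0 y)) k1 k2.
apply: le_trans k3; apply: le_trans (ler_pM (sqr_ge0 _) (sqr_ge0 _) h1 h2) _.
by move: (slope_x y) (slope_y x) => A B; rewrite le_eqVlt; apply/orP; left; apply/eqP; ring.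
Qed.

End TestFunctionEstimates.

(** * Poincare and Rellich inequalities *)

Lemma summable_Rint_sum d (T : measurableType d) (R : realType) (mu : {measure set T -> \bar R})
    (I : Type) (s : seq I) (F : I -> T -> R) : (mu setT < +oo)%E ->
  (forall i, summable mu (F i)) -> summable mu (fun z => \sum_(i <- s) F i z) /\
  \int[mu]_z (\sum_(i <- s) F i z) = \sum_(i <- s) \int[mu]_z F i z.
Proof.
move=> muT sF; elim: s => [|i s [IH1 IH2]].
  rewrite (_ : (fun z => \sum_(i <- [::]) F i z) = (fun=> 0)); last first.
    by apply/funext => z; rewrite big_nil.
  by split; [exact: summable_cst|rewrite big_nil Rintegral_cst// mul0r].
rewrite (_ : (fun z => \sum_(i <- i :: s) F i z) = (fun z => F i z + \sum_(i <- s) F i z)).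
  by split; [exact: summableD|rewrite RintD// IH2 big_cons].
by apply/funext => z; rewrite big_cons.
Qed.

Section Grid.
Context {R : realType} (N : nat).
Local Notation plane := (measurableTypeR R * measurableTypeR R)%type.

(** Cells are fibres of this map, so that their indicators sum to 1. *)
Definition cell_index (t : R) : 'I_N.+1 := inord (Num.truncn (t * N.+1%:R)).
Definition cell (c : 'I_N.+1 * 'I_N.+1) : set plane :=
  [set z | Omega z /\ (cell_index z.1, cell_index z.2) = c].

Let n0 : 0 < N.+1%:R :> R. Proof. by rewrite ltr0n. Qed.

Lemma cell_indexE (t : R) (i : 'I_N.+1) : 0 < t < 1 ->
  (cell_index t = i) <-> (i%:R <= t * N.+1%:R < i.+1%:R).
Proof.
move=> /andP[t0 t1].
have tn0 : 0 <= t * N.+1%:R by rewrite mulr_ge0// ltW.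
have lt : (Num.truncn (t * N.+1%:R) < N.+1)%N.
  rewrite -(ltr_nat R); have /andP[h _] := truncn_itv tn0; apply: le_lt_trans h _.
  by rewrite gtr_pMl.
split=> [<-|h]; first by rewrite /cell_index inordK//; exact: truncn_itv.
by apply: val_inj; rewrite /= inordK// (truncn_def h).
Qed.

Lemma cell_index_near (s t : R) : 0 < s < 1 -> 0 < t < 1 -> cell_index s = cell_index t ->
  `|s - t| <= N.+1%:R^-1 /\ (s < N.+1%:R^-1) = (t < N.+1%:R^-1).
Proof.
move=> hs ht e; have := (cell_indexE _ hs).1 e; have := (cell_indexE _ ht).1 erefl.
have lt1 (u : R) : (u < N.+1%:R^-1) = (u * N.+1%:R < 1) by rewrite -(ltr_pdivlMr _ _ n0) div1r.
move: (cell_index t) => i h1 h2; split.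
  rewrite -div1r (ler_pdivlMr _ _ n0) -[X in _ * X](gtr0_norm n0) -normrM mulrBl ler_norml.
  by move: h1 h2; rewrite -[i.+1%:R]natr1; lra.
rewrite !lt1; have [i0|i0] := posnP i.
  by move: h1 h2; rewrite i0 => /andP[_ ->] /andP[_ ->].
have : (1 : R) <= i%:R by rewrite ler1n.
by move: h1 h2; lra.
Qed.

Lemma measurable_cell c : measurable (cell c).
Proof.
case: c => i j.
have -> : cell (i, j) = Omega `&` (`[i%:R / N.+1%:R, i.+1%:R / N.+1%:R[%classic `*`
    `[j%:R / N.+1%:R, j.+1%:R / N.+1%:R[%classic).
  apply/seteqP; split=> -[x y] [Oz h]; split=> //; move: h.
    have [/=] := Oz; rewrite !in_itv/= => hx hy [/(cell_indexE _ hx) ex /(cell_indexE _ hy) ey].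
    by rewrite !ler_pdivrMr// !ltr_pdivlMr.
  have [/=] := Oz; rewrite !in_itv/= => hx hy; rewrite !ler_pdivrMr// !ltr_pdivlMr//.
  by move=> [/(cell_indexE _ hx) -> /(cell_indexE _ hy) ->].
apply: measurableI; first exact: measurable_Omega.
by apply: measurableX; exact: measurable_itv.
Qed.

Lemma sum_cells (z : plane) : Omega z -> \sum_c (\1_(cell c) z : R) = 1.
Proof.
move=> Oz; rewrite (bigD1 (cell_index z.1, cell_index z.2))//= big1 => [|c cz].
  by rewrite indicE mem_set// addr0.
rewrite indicE memNset//= => -[_ e]; by rewrite e eqxx in cz.
Qed.

Lemma Rint_cells (f : plane -> R) : summable muO f ->
  \int[@muO R]_z f z = \sum_c \int[@muO R]_z (f z * \1_(cell c) z).
Proof.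
move=> sf.
have sfc c : summable muO (fun z => f z * \1_(cell c) z).
  apply: (summableMb sf (C := 1)); first exact: measurable_indic (measurable_cell c).
  by move=> z; rewrite indicE; case: (_ \in _); rewrite ?normr0 ?normr1.
have [s1 <-] := summable_Rint_sum (index_enum ('I_N.+1 * 'I_N.+1)%type) muO_lty sfc.
apply: Rint_ae; [exact: summable_measurable sf|exact: summable_measurable s1|].
have PF : Filter (nbhs (almost_everywhere (@muO R))) by exact: ae_filter_ringOfSetsType.
apply: filterS (@ae_Omega R) => z Oz; by rewrite -mulr_sumr sum_cells// mulr1.
Qed.

Lemma cell_integral_bound (f : plane -> R) c : square_summable muO f ->
  (\int[@muO R]_z \1_(cell c) z)^-1 * (\int[@muO R]_z (f z * \1_(cell c) z)) ^+ 2 <= mass f f.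
Proof.
move=> sf; set q := \int[muO]_z _.
have mI : measurable_fun setT (\1_(cell c) : plane -> R) := measurable_indic (measurable_cell c).
have sI : square_summable muO (\1_(cell c) : plane -> R).
  apply: (square_summable_bounded muO_lty (C := 1)) => // z.
  by rewrite indicE; case: (_ \in _); rewrite ?normr0 ?normr1.
have q0 : 0 <= q by apply: Rint_ge0 => z; rewrite indicE ler0n.
have m0 : 0 <= mass f f by apply: Rint_ge0 => z; rewrite -expr2 sqr_ge0.
have := Rint_cauchy_schwarz sf sI.
have -> : \int[@muO R]_z (f z ^+ 2) = mass f f by apply: Rint_eq => z; rewrite expr2.
have -> : \int[@muO R]_z (\1_(cell c) z ^+ 2) = q.
  by apply: Rint_eq => z; rewrite indicE; case: (_ \in _); rewrite ?expr1n ?expr0n.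
have [q1|q1] := eqVneq q 0; first by rewrite q1 invr0 mul0r.
have qp : 0 < q by rewrite lt_neqAle eq_sym q1.
by move=> h; rewrite mulrC ler_pdivrMr.
Qed.

End Grid.

Lemma exponent_ge0 (R : realType) (a : R) : 0 < a < 2^-1 -> 0 <= a.
Proof. by case/andP => /ltW. Qed.

Section SobolevRellich.
Context {R : realType} (a1 a2 : R).
Hypotheses (ha1 : 0 < a1 < 2^-1) (ha2 : 0 < a2 < 2^-1).
Local Notation plane := (measurableTypeR R * measurableTypeR R)%type.

Local Notation a10 := (exponent_ge0 ha1).
Local Notation a20 := (exponent_ge0 ha2).
Local Notation g := (1 - 2 * Num.max a1 a2).
Let ga1 : g + 2 * a1 <= 1.
Proof. have : a1 <= Num.max a1 a2 by rewrite le_max lexx. lra. Qed.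
Let ga2 : g + 2 * a2 <= 1.
Proof. have : a2 <= Num.max a1 a2 by rewrite le_max lexx orbT. lra. Qed.
Let g0 : 0 < g.
Proof.
have : Num.max a1 a2 < 2^-1 by rewrite gt_max; case/andP: ha1 => _ ->; case/andP: ha2 => _ ->.
by lra.
Qed.

Local Notation X := (sobolev0 a10 a20).
Local Notation m := (@sobolev_mass R a1 a2 a10 a20).
Local Notation a := (@sobolev_energy R a1 a2 a10 a20).
Local Notation form := (@sobolev_form R a1 a2 a10 a20).
Local Notation smooth := (@smooth0 R a1 a2 a10 a20).

(** [cell_poincare] summed over the grid. *)
Lemma tf_cells_bound (phi : R * R -> R) (N : nat) : test_function phi ->
  mass phi phi <= 2 * N.+1%:R^-1 `^ g * energy a1 a2 phi phi +
    \sum_c (\int[@muO R]_z \1_(@cell R N c) z)^-1 *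
      (\int[@muO R]_z (phi z * \1_(@cell R N c) z)) ^+ 2.
Proof.
move=> hphi; have [C hC] := tf_bounded hphi.
have sphi : square_summable muO phi.
  by apply: (square_summable_bounded muO_lty (C := C)) => //; exact: tf_measurable.
have sd := density_summable a10 a20 hphi.
have r0 : 0 < (N.+1%:R^-1 : R) <= 1.
  by apply/andP; split; [rewrite invr_gt0 ltr0n|rewrite invf_le1 ?ltr0n// ler1n].
have eta0 : 0 <= 2 * N.+1%:R^-1 `^ g by rewrite mulr_ge0// powR_ge0.
have -> : mass phi phi = \int[@muO R]_z (phi z ^+ 2) by apply: Rint_eq => z; rewrite expr2.
rewrite (Rint_cells N sphi.2) -(energy_density a10 a20 hphi) (Rint_cells N sd).
rewrite mulr_sumr -big_split/=; apply: ler_sum => c _.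
apply: (cell_poincare sphi sd muO_lty _ eta0 (measurable_cell c)) => [z|z z' [Oz ez] [Oz' ez']].
  exact: density_ge0.
have e := etrans ez (esym ez'); have e1 := congr1 fst e; have e2 := congr1 snd e.
have /andP[hx hy] : (0 < z.1 < 1) && (0 < z.2 < 1) by case: Oz => /=; rewrite !in_itv/= => -> ->.
have /andP[hx' hy'] : (0 < z'.1 < 1) && (0 < z'.2 < 1).
  by case: Oz' => /=; rewrite !in_itv/= => -> ->.
have [d1 c1] := cell_index_near hx hx' e1; have [d2 c2] := cell_index_near hy hy' e2.
exact: (tf_oscillation a10 a20 (ltW g0) ga1 ga2 hphi Oz Oz' r0 d1 d2 c1 c2).
Qed.

Lemma sobolev_mass_le_form u : m u u <= 1 * form u u.
Proof. by rewrite mul1r /sobolev_form lerDl; exact: (psd_ge0 (sobolev_energy_psd a10 a20)). Qed.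

Lemma sobolev_energy_le_form u : a u u <= 1 * form u u.
Proof. by rewrite mul1r /sobolev_form lerDr; exact: (psd_ge0 (sobolev_mass_psd a10 a20)). Qed.

Lemma sobolev_poincare u : m u u <= a u u.
Proof.
apply: (dense_le (sobolev_form_psd a10 a20) (sobolev_mass_psd a10 a20) (sobolev_energy_psd a10 a20)
  ler01 ler01 sobolev_mass_le_form sobolev_energy_le_form (smooth_dense (a20 := a20))) => phi hphi.
exact: (tf_poincare a10 a20 (ltW g0) ga1 ga2 hphi).
Qed.

(** The average over the cell, normalized so that its square is the term that
    appears in [cell_poincare]. *)
Definition cell_mean (N : nat) (c : 'I_N.+1 * 'I_N.+1) (u : X) : R :=
  Num.sqrt (\int[@muO R]_z \1_(@cell R N c) z)^-1 * \int[@muO R]_z (u z * \1_(@cell R N c) z).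

Lemma cell_mean_functional N c : functional (@cell_mean N c).
Proof.
move=> k u v; rewrite /cell_mean.
have su (w : X) : summable muO (fun z => w z * \1_(@cell R N c) z).
  have sw := class_square_summable (hP := H10_class a10 a20) (@H10_H1 R a1 a2) w.
  apply: (summableMb (square_summable_summable muO_lty sw) (C := 1)).
    exact: measurable_indic (measurable_cell c).
  by move=> z; rewrite indicE; case: (_ \in _); rewrite ?normr0 ?normr1.
have -> : \int[@muO R]_z ((k *: u + v : X) z * \1_(@cell R N c) z) =
    k * \int[@muO R]_z (u z * \1_(@cell R N c) z) + \int[@muO R]_z (v z * \1_(@cell R N c) z).
  rewrite -(RintZ k (su u)) -(RintD (summableZ k (su u)) (su v)).
  by apply: Rint_eq => z; rewrite class_linear mulrDl mulrA.
by ring.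
Qed.

Lemma sqr_cell_mean N c u : @cell_mean N c u ^+ 2 =
  (\int[@muO R]_z \1_(@cell R N c) z)^-1 * (\int[@muO R]_z (u z * \1_(@cell R N c) z)) ^+ 2.
Proof.
rewrite exprMn sqr_sqrtr// invr_ge0; apply: Rint_ge0 => z; rewrite indicE; exact: ler0n.
Qed.

Lemma cell_mean_le N c u : @cell_mean N c u ^+ 2 <= m u u.
Proof.
rewrite sqr_cell_mean; apply: cell_integral_bound.
exact: (class_square_summable (hP := H10_class a10 a20) (@H10_H1 R a1 a2) u).
Qed.

(** [t = (e / 2)^(1 / g)] solves [2 t^g = e]. *)
Lemma fine_grid (e : R) : 0 < e -> exists N : nat, 2 * N.+1%:R^-1 `^ g <= e.
Proof.
move=> e0; pose t := (e / 2) `^ g^-1.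
have e2 : 0 < e / 2 by rewrite divr_gt0.
have t0 : 0 < t by rewrite powR_gt0.
exists (Num.bound t^-1); rewrite mulrC -ler_pdivlMr//.
have -> : e / 2 = t `^ g by rewrite /t -powRrM mulVf ?gt_eqF// powRr1// ltW.
apply: ge0_ler_powR; rewrite ?nnegrE ?(ltW g0) ?(ltW t0) ?invr_ge0//.
rewrite invf_ple ?posrE//; apply: ltW; apply: lt_le_trans (archi_boundP _) _.
  by rewrite invr_ge0 ltW.
by rewrite ler_nat.
Qed.

Lemma sobolev_rellich : rellich m a.
Proof.
move=> e /fine_grid[N hN]; exists ('I_N.+1 * 'I_N.+1)%type, (@cell_mean N) => [c|u].
  split; first exact: cell_mean_functional.
  by exists 1 => u; rewrite mul1r (le_trans (cell_mean_le c u))// sobolev_poincare.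
have e0 : 0 <= e by apply: le_trans hN; rewrite mulr_ge0// powR_ge0.
have hl : psd (fun u v => \sum_c @cell_mean N c u * @cell_mean N c v).
  by apply: psd_sum_sqr; exact: cell_mean_functional.
have hb := psdD (psdZ e0 (sobolev_energy_psd a10 a20)) hl.
have bound (w : X) : e * a w w + \sum_c @cell_mean N c w * @cell_mean N c w <=
    (e + #|{: 'I_N.+1 * 'I_N.+1}|%:R) * form w w.
  rewrite mulrDl lerD//.
    by apply: ler_wpM2l => //; rewrite -[leRHS]mul1r sobolev_energy_le_form.
  have hc c : @cell_mean N c w * @cell_mean N c w <= form w w.
    rewrite -expr2 -[leRHS]mul1r; exact: le_trans (cell_mean_le c w) (sobolev_mass_le_form w).
  by apply: le_trans (ler_sum _ (fun c _ => hc c)) _; rewrite sumr_const mulr_natl.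
have C0 : 0 <= e + #|{: 'I_N.+1 * 'I_N.+1}|%:R by rewrite addr_ge0.
have h := dense_le (sobolev_form_psd a10 a20) (sobolev_mass_psd a10 a20) hb ler01 C0
  sobolev_mass_le_form bound (smooth_dense (a20 := a20)).
have -> : \sum_c @cell_mean N c u ^+ 2 = \sum_c @cell_mean N c u * @cell_mean N c u.
  by apply: eq_bigr => c _; rewrite expr2.
apply: h => phi hphi; apply: le_trans (tf_cells_bound N hphi) _.
apply: lerD.
  by apply: ler_wpM2r => //; exact: (psd_ge0 (sobolev_energy_psd a10 a20) phi).
by apply: ler_sum => c _; rewrite -expr2 sqr_cell_mean.
Qed.

Lemma sobolev_energy_space : energy_space m a.
Proof.
split; [exact: sobolev_mass_psd|exact: sobolev_energy_psd| |exact: sobolev_null| |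
  exact: sobolev_rellich|exact: sobolev_infinite].
  by exists 1 => // u; rewrite mul1r; exact: sobolev_poincare.
move=> x hx.
(* By the Poincare inequality the energy alone is equivalent to the full form. *)
have le2 (u : X) : form u u <= 2 * a u u.
  by rewrite /sobolev_form mulr_natl mulr2n lerD2r; exact: sobolev_poincare.
have [l hl] := sobolev_form_complete (fcauchy_le (sobolev_energy_psd a10 a20) (ler0n _ 2) le2 hx).
exists l; exact: (fcvg_le (sobolev_form_psd a10 a20) ler01 sobolev_energy_le_form hl).
Qed.

End SobolevRellich.

(** * The class of potentials *)

Section Admissible.
Context {R : realType} (p M : R).
Hypotheses (M0 : 0 < M) (p2 : 2 < p).
Local Notation plane := (measurableTypeR R * measurableTypeR R)%type.
Implicit Types (V : plane -> R).

Let p0 : 0 < p. Proof. by apply: lt_trans p2. Qed.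

(** The power [p / 2] turns the bound on the norm of exponent [p] into a bound on a
    sum of squares, to which the L2 tools apply. *)
Definition half_power V (z : plane) : R := `|V z| `^ (p / 2).

Lemma sqr_half_power V z : half_power V z ^+ 2 = `|V z| `^ p.
Proof. by rewrite /half_power sqr_powR; congr (_ `^ _); field. Qed.

Lemma half_power_measurable V : measurable_fun setT V -> measurable_fun setT (half_power V).
Proof.
move=> mV; apply: (measurableT_comp (measurable_powR _)).
exact: measurableT_comp mV.
Qed.

(** The class of potentials, written with real-valued integrals only. *)
Definition admissible V := [/\ measurable_fun setT V, {ae (@muO R), forall z : plane, 0 <= V z},
  square_summable muO (half_power V) &
  \int[@muO R]_z (half_power V z ^+ 2) <= M `^ p].

Lemma S_classP V : S_class p M V <-> admissible V.
Proof.
have integE : measurable_fun setT V -> ('N[muO]_p%:E[EFin \o V] `^ p)%E =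
    (\int[muO]_z (half_power V z ^+ 2)%:E)%E.
  move=> mV; rewrite poweR_Lnorm ?gt_eqF//; apply: eq_integral => z _ /=.
  by rewrite ?poweR_EFin sqr_half_power.
have sumP : measurable_fun setT V -> square_summable muO (half_power V) <->
    (\int[muO]_z (half_power V z ^+ 2)%:E < +oo)%E.
  move=> mV; have mh := half_power_measurable mV; split=> [[_ h]|h].
    by apply/(summable_ge0P _ _ _).1 => // [|z]; [exact: measurable_funX|exact: sqr_ge0].
  split=> //.
  by apply/(summable_ge0P _ _ _).2 => // [|z]; [exact: measurable_funX|exact: sqr_ge0].
split=> [[LV V0 VM]|[mV V0 sV VM]].
  have mV : measurable_fun setT V by move: LV; rewrite inE => /andP[/[!inE]].
  have le : (\int[muO]_z (half_power V z ^+ 2)%:E <= (M `^ p)%:E)%E.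
    rewrite -integE// -poweR_EFin; apply: gt0_ler_poweR => //; first exact: ltW.
      by rewrite in_itv/= Lnorm_ge0 leey.
    by rewrite in_itv/= lee_fin (ltW M0) leey.
  have sV : square_summable muO (half_power V).
    by apply/(sumP mV); apply: le_lt_trans le _; rewrite ltry.
  split=> //; rewrite -lee_fin EFin_Rint//; exact: sV.2.
have le : ('N[muO]_p%:E[EFin \o V] `^ p <= (M `^ p)%:E)%E.
  by rewrite (integE mV) -EFin_Rint ?lee_fin//; exact: sV.2.
have le' : ('N[muO]_p%:E[EFin \o V] <= M%:E)%E.
  have pp : p * p^-1 = 1 by rewrite divff// gt_eqF.
  move: le; set x := ('N[muO]_p%:E[EFin \o V])%E; have x0 : (0 <= x)%E by exact: Lnorm_ge0.
  move=> le; rewrite -[x]poweRe1// -(powRr1 (ltW M0)) -pp poweRrM powRrM -poweR_EFin.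
  apply: gt0_ler_poweR => //; first by rewrite invr_ge0 ltW.
    by rewrite in_itv/= poweR_ge0 leey.
  by rewrite in_itv/= lee_fin powR_ge0 leey.
split=> //; rewrite inE; apply/andP; split; rewrite inE//=.
by rewrite /finite_norm; apply: le_lt_trans le' _; rewrite ltry.
Qed.

Lemma sqr_le_power (t : R) : 0 <= t -> t ^+ 2 <= 1 + t `^ p.
Proof.
move=> t0; have tp := powR_ge0 t p; have [t1|/ltW t1] := leP t 1.
  have : t ^+ 2 <= 1 by rewrite expr_le1.
  lra.
have : t `^ 2 <= t `^ p by apply: ler_powR => //; exact: ltW.
by rewrite powR_mulrn//; lra.
Qed.

Lemma admissible_L2 V : admissible V -> square_summable muO V /\
  \int[@muO R]_z (V z ^+ 2) <= 1 + M `^ p.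
Proof.
move=> [mV _ [mh sh] hM].
have s1 := summableD (summable_cst (@muO_lty R) 1) sh.
have le z : V z ^+ 2 <= 1 + half_power V z ^+ 2.
  by rewrite sqr_half_power -real_normK ?num_real// sqr_le_power.
have sV : square_summable muO V.
  split=> //; apply: (summable_le _ s1); first exact: measurable_funX.
  by move=> z; rewrite ger0_norm ?sqr_ge0.
split=> //; apply: (le_trans (Rint_le sV.2 s1 le)).
rewrite (RintD (summable_cst (@muO_lty R) 1) sh) lerD// Rintegral_cst//.
have := @muO_setT R; by move=> /= ->; rewrite /= mulr1.
Qed.

(** Where the potential exceeds [k], its square is a small multiple of its power
    [p]; this is where [p > 2] enters. *)
Lemma tail_le_power (k t : R) : 0 < k -> k < t -> t ^+ 2 <= (k `^ (p - 2))^-1 * t `^ p.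
Proof.
move=> k0 kt; have t0 := lt_trans k0 kt.
have -> : t `^ p = t ^+ 2 * t `^ (p - 2).
  rewrite -(powR_mulrn 2 (ltW t0)) -powRD; first by congr (_ `^ _); ring.
  by apply/implyP => _; rewrite gt_eqF.
rewrite mulrCA ler_peMr ?sqr_ge0// mulrC ler_pdivlMr ?powR_gt0// mul1r.
by apply: ge0_ler_powR; rewrite ?nnegrE ?ltW// subr_gt0.
Qed.

End Admissible.

(** * The form of a potential *)

Section FormBound.
Context {R : realType} (a1 a2 p M : R).
Hypotheses (ha1 : 0 < a1 < 2^-1) (ha2 : 0 < a2 < 2^-1) (M0 : 0 < M) (p2 : 2 < p).
Local Notation plane := (measurableTypeR R * measurableTypeR R)%type.
Implicit Types (V rho : plane -> R).

Local Notation a10 := (exponent_ge0 ha1).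
Local Notation a20 := (exponent_ge0 ha2).
Local Notation X := (sobolev0 a10 a20).
Local Notation m := (@sobolev_mass R a1 a2 a10 a20).
Local Notation a := (@sobolev_energy R a1 a2 a10 a20).
Local Notation form := (@sobolev_form R a1 a2 a10 a20).

Lemma tail_threshold (eps : R) : 0 < eps ->
  exists2 k : R, 0 < k & (k `^ (p - 2))^-1 * M `^ p <= eps ^+ 2.
Proof.
move=> e0; pose t := M `^ p / eps ^+ 2.
have t0 : 0 < t by rewrite divr_gt0 ?powR_gt0 ?exprn_gt0.
have q0 : p - 2 != 0 by rewrite gt_eqF// subr_gt0.
exists (t `^ (p - 2)^-1); first by rewrite powR_gt0.
rewrite -powRrM mulVf// (powRr1 (ltW t0)) /t invf_div.
have Mp : M `^ p != 0 by rewrite gt_eqF// powR_gt0.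
by rewrite mulfVK.
Qed.

(** Cauchy-Schwarz between the square of the tail, which is small by
    [tail_le_power], and [phi^4], which is controlled by [tf_quartic]. *)
Lemma tf_tail_bound (V phi : plane -> R) (k eps : R) : admissible p M V -> test_function phi ->
  0 < k -> 0 < eps -> (k `^ (p - 2))^-1 * M `^ p <= eps ^+ 2 ->
  let T z := if k < `|V z| then `|V z| else 0 in
  summable muO (fun z => T z * phi z ^+ 2) /\
  \int[@muO R]_z (T z * phi z ^+ 2) <= eps * energy a1 a2 phi phi.
Proof.
move=> aV hphi k0 e0 hk T.
have [mV V0 [mh sh] hM] := aV.
have [C hC] := tf_bounded hphi.
have mnV : measurable_fun setT (fun z => `|V z|) by exact: measurableT_comp mV.
have mT : measurable_fun setT T.
  apply: measurable_fun_if => //.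
  - by apply: measurable_fun_ltr => //; exact: measurable_cst.
  - exact: measurable_funTS.
pose c := (k `^ (p - 2))^-1.
have c0 : 0 <= c by rewrite invr_ge0 powR_ge0.
(* [T] is the part of the potential above the threshold [k]. *)
have Tle z : T z ^+ 2 <= c * half_power p V z ^+ 2.
  rewrite sqr_half_power /T; case: ifP => h; first exact: tail_le_power.
  by rewrite expr0n mulr_ge0// powR_ge0.
have sT : square_summable muO T.
  split=> //; apply: (summable_le _ (summableZ c sh)); first exact: measurable_funX.
  by move=> z; rewrite ger0_norm ?sqr_ge0.
have sphi2 : square_summable muO (fun z => phi z ^+ 2).
  apply: (square_summable_bounded muO_lty (C := C ^+ 2)).
    by apply: measurable_funX; exact: tf_measurable.
  by move=> z; rewrite normrX lerXn2r ?nnegrE// (le_trans _ (hC z)).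
have sTphi := square_summableM sT sphi2; split; first exact: sTphi.
have hT : \int[@muO R]_z (T z ^+ 2) <= eps ^+ 2.
  apply: le_trans (Rint_le sT.2 (summableZ c sh) Tle) _.
  by rewrite (RintZ c sh); apply: le_trans hk; exact: ler_wpM2l.
have [ga10 ga20] : 0 + 2 * a1 <= 1 /\ 0 + 2 * a2 <= 1.
  by case/andP: ha1 => _ h1; case/andP: ha2 => _ h2; split; lra.
have hq := tf_quartic a10 a20 (lexx 0) ga10 ga20 hphi.
have ex0 : 0 <= energy_x a1 phi phi by apply: Rint_ge0 => z; rewrite -expr2 sqr_ge0.
have ey0 : 0 <= energy_y a2 phi phi by apply: Rint_ge0 => z; rewrite -expr2 sqr_ge0.
have EE : energy a1 a2 phi phi = energy_x a1 phi phi + energy_y a2 phi phi by [].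
have cs := Rint_cauchy_schwarz sT sphi2.
have e4 : \int[@muO R]_z ((phi z ^+ 2) ^+ 2) = \int[@muO R]_z (phi z ^+ 4).
  by apply: Rint_eq => z; rewrite -exprM.
have i0 : 0 <= \int[@muO R]_z (T z * phi z ^+ 2).
  by apply: Rint_ge0 => z; rewrite mulr_ge0 ?sqr_ge0// /T; case: ifP.
have q0 : 0 <= \int[@muO R]_z ((phi z ^+ 2) ^+ 2).
  by apply: Rint_ge0 => z; exact: sqr_ge0.
have T0 : 0 <= \int[@muO R]_z (T z ^+ 2) by apply: Rint_ge0 => z; exact: sqr_ge0.
rewrite -e4 in hq.
move: EE ex0 ey0 cs hT i0 q0 T0 hq => ->.
move: (energy_x a1 phi phi) (energy_y a2 phi phi) (\int[muO]_z (T z * _)).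
move: (\int[muO]_z (T z ^+ 2)) (\int[muO]_z ((phi z ^+ 2) ^+ 2)) => S Q E F I E0 F0 cs hT I0 Q0 S0 hq.
have le : I ^+ 2 <= (eps * (E + F)) ^+ 2.
  apply: (le_trans cs); rewrite exprMn; apply: ler_pM => //.
  by apply: (le_trans hq); have := sqr_ge0 E; have := sqr_ge0 F; have := mulr_ge0 E0 F0; rewrite sqrrD; lra.
have b0 : 0 <= eps * (E + F) by rewrite mulr_ge0 ?addr_ge0// ltW.
by rewrite -ler_sqr// nnegrE.
Qed.

Lemma tf_form_bound (V rho phi : plane -> R) (k eps : R) : admissible p M V -> test_function phi ->
  0 < k -> 0 < eps -> (k `^ (p - 2))^-1 * M `^ p <= eps ^+ 2 ->
  measurable_fun setT rho -> (forall z, rho z ^+ 2 <= `|V z|) ->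
  \int[@muO R]_z ((rho z * phi z) ^+ 2) <= k * mass phi phi + eps * energy a1 a2 phi phi.
Proof.
move=> aV hphi k0 e0 hk mr hr.
have [sT hT] := tf_tail_bound aV hphi k0 e0 hk.
have [C hC] := tf_bounded hphi.
have sphi : square_summable muO phi.
  by apply: (square_summable_bounded muO_lty (C := C)) => //; exact: tf_measurable.
have -> : mass phi phi = \int[@muO R]_z (phi z ^+ 2) by apply: Rint_eq => z; rewrite expr2.
apply: (@le_trans _ _ (\int[@muO R]_z (k * phi z ^+ 2 +
    (if k < `|V z| then `|V z| else 0) * phi z ^+ 2))); last first.
  by rewrite (RintD (summableZ k sphi.2) sT) (RintZ k sphi.2) lerD2l.
have le z : (rho z * phi z) ^+ 2 <= k * phi z ^+ 2 +
    (if k < `|V z| then `|V z| else 0) * phi z ^+ 2.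
  rewrite exprMn -mulrDl ler_wpM2r ?sqr_ge0//; apply: (le_trans (hr z)).
  by case: ltP => h; rewrite ?addr0// lerDr ltW.
have s := summableD (summableZ k sphi.2) sT.
apply: Rint_le => //; apply: (summable_le _ s).
  by apply: measurable_funX; apply: measurable_funM => //; exact: tf_measurable.
by move=> z; rewrite ger0_norm ?sqr_ge0.
Qed.

Lemma weighted_square_summable rho (L : R) (u : X) : measurable_fun setT rho ->
  (forall z, `|rho z| <= L) -> square_summable muO (fun z => rho z * u z).
Proof.
move=> mr hr; have [mu su] := class_square_summable (hP := H10_class a10 a20) (@H10_H1 R a1 a2) u.
apply: (@square_summable_le _ _ _ muO _ (fun z : plane => L * (u z : R))).
- exact: measurable_funM.
- split; first exact: measurable_funM.
  have := summableZ (L ^+ 2) su; congr summable; apply/funext => z; by rewrite exprMn.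
- by move=> z; rewrite !normrM ler_wpM2r//; apply: le_trans (hr z) _; exact: ler_norm.
Qed.

(** A bounded multiplier defines a form that is continuous for the mass, so that
    density applies; unbounded potentials are reached by truncation. *)
Lemma bounded_form_bound V rho (L k eps : R) (u : X) : admissible p M V ->
  0 < k -> 0 < eps -> (k `^ (p - 2))^-1 * M `^ p <= eps ^+ 2 ->
  measurable_fun setT rho -> (forall z, `|rho z| <= L) -> (forall z, rho z ^+ 2 <= `|V z|) ->
  \int[@muO R]_z ((rho z * u z) ^+ 2) <= k * m u u + eps * a u u.
Proof.
move=> aV k0 e0 hk mr hL hr.
have hb : psd (fun u v : X => \int[@muO R]_z ((rho z * u z) * (rho z * v z))).
  apply: (@psd_pullback _ _ _ muO X (fun u z => rho z * u z)).
    by move=> w; exact: weighted_square_summable mr hL.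
  by move=> c v w; apply: nearW => z; rewrite class_linear; ring.
have hm := sobolev_mass_psd a10 a20; have ha := sobolev_energy_psd a10 a20.
have hk' := psdD (psdZ (ltW k0) hm) (psdZ (ltW e0) ha).
have L0 : 0 <= L ^+ 2 by exact: sqr_ge0.
have le1 (w : X) : \int[@muO R]_z ((rho z * w z) * (rho z * w z)) <= L ^+ 2 * form w w.
  apply: (@le_trans _ _ (L ^+ 2 * m w w)); last first.
    by apply: ler_wpM2l => //; rewrite -[leRHS]mul1r; exact: sobolev_mass_le_form.
  have sw := class_square_summable (hP := H10_class a10 a20) (@H10_H1 R a1 a2) w.
  have sr := weighted_square_summable w mr hL.
  have sww := square_summableM sw sw.
  have e : L ^+ 2 * m w w = \int[@muO R]_z (L ^+ 2 * (w z * w z)).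
    exact: (esym (RintZ (L ^+ 2) sww)).
  rewrite e; apply: Rint_le; [exact: square_summableM|exact: summableZ|] => z.
  rewrite -!expr2 exprMn ler_wpM2r ?sqr_ge0//.
  by rewrite -real_normK ?num_real// lerXn2r ?nnegrE// (le_trans _ (hL z)).
have le2 (w : X) : k * m w w + eps * a w w <= (k + eps) * form w w.
  rewrite mulrDl; apply: lerD; apply: ler_wpM2l; rewrite ?(ltW k0) ?(ltW e0)// -[leRHS]mul1r.
    exact: sobolev_mass_le_form.
  exact: sobolev_energy_le_form.
have ke0 : 0 <= k + eps by rewrite addr_ge0// ltW.
have h := dense_le (sobolev_form_psd a10 a20) hb hk' L0 ke0 le1 le2 (smooth_dense (a20 := a20)).
have -> : \int[@muO R]_z ((rho z * u z) ^+ 2) = \int[@muO R]_z ((rho z * u z) * (rho z * u z)).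
  by apply: Rint_eq => z; rewrite expr2.
apply: h => phi hphi.
have := tf_form_bound aV hphi k0 e0 hk mr hr.
by rewrite (_ : \int[@muO R]_z _ = \int[@muO R]_z ((rho z * phi z) * (rho z * phi z)))//;
  apply: Rint_eq => z; rewrite expr2.
Qed.

(** [Num.sqrt] vanishes on negative numbers, so that the form of a potential is
    positive even on the null set where the potential may be negative. *)
Definition root V (z : plane) : R := Num.sqrt (V z).

Lemma root_measurable V : measurable_fun setT V -> measurable_fun setT (root V).
Proof.
move=> mV; apply: measurableT_comp mV; apply: continuous_measurable_fun.
exact: sqrt_continuous.
Qed.

Lemma sqr_root_le V z : root V z ^+ 2 <= `|V z|.
Proof.
rewrite /root; have [V0|V0] := leP 0 (V z); first by rewrite sqr_sqrtr// ger0_norm.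
by rewrite ltr0_sqrtr// expr0n /= normr_ge0.
Qed.

(** Fatou along the truncations [min (root V) n]. *)
Lemma potential_bound V (k eps : R) (u : X) : admissible p M V ->
  0 < k -> 0 < eps -> (k `^ (p - 2))^-1 * M `^ p <= eps ^+ 2 ->
  square_summable muO (fun z => root V z * u z) /\
  \int[@muO R]_z ((root V z * u z) ^+ 2) <= k * m u u + eps * a u u.
Proof.
move=> aV k0 e0 hk; have [mV _ _ _] := aV; have mr := root_measurable mV.
have [mu _] := class_square_summable (hP := H10_class a10 a20) (@H10_H1 R a1 a2) u.
(* The truncations are eventually equal to [root V z] at each point. *)
pose rho n (z : plane) := Num.min (root V z) n%:R.
have r0 z : 0 <= root V z by exact: sqrtr_ge0.
have rho0 n z : 0 <= rho n z by rewrite le_min r0 ler0n.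
have mrho n : measurable_fun setT (rho n).
  by apply: measurable_minr => //; exact: measurable_cst.
have rhoL n z : `|rho n z| <= n%:R by rewrite ger0_norm// ge_min lexx orbT.
apply: (@fatou_sqr _ _ _ (@muO R) (fun n z => rho n z * u z)).
- by move=> n; exact: measurable_funM.
- exact: measurable_funM.
- by move=> n; exact: weighted_square_summable (mrho n) (rhoL n).
- apply: nearW => z; apply: cvgM; last exact: cvg_cst.
  apply: cvg_near_cst; exists (Num.bound (root V z)) => // n /= hn; apply/eqP.
  rewrite /rho eq_minl//; apply: ltW; apply: lt_le_trans (archi_boundP (r0 z)) _.
  by rewrite ler_nat.
- apply: nearW => n; apply: bounded_form_bound aV k0 e0 hk (mrho n) (rhoL n) _ => z.
  apply: le_trans (sqr_root_le V z); rewrite lerXn2r ?nnegrE//.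
  by rewrite ge_min lexx.
Qed.

Definition potential_form V (u v : X) : R := \int[@muO R]_z ((root V z * u z) * (root V z * v z)).

Lemma root_square_summable V (u : X) : admissible p M V ->
  square_summable muO (fun z => root V z * u z).
Proof.
move=> aV; have [k k0 hk] := tail_threshold ltr01.
by have [h _] := potential_bound u aV k0 ltr01 hk.
Qed.

Lemma potential_form_psd V : admissible p M V -> psd (potential_form V).
Proof.
move=> aV; apply: (@psd_pullback _ _ _ muO X (fun u z => root V z * u z)).
  by move=> w; exact: root_square_summable.
by move=> c v w; apply: nearW => z; rewrite class_linear; ring.
Qed.

Lemma potential_infinitesimal :
  uniformly_infinitesimal m a [set potential_form V | V in admissible p M].
Proof.
move=> eps e0; have [k k0 hk] := tail_threshold e0; exists k; first exact: ltW.
move=> _ u [V aV <-]; have [_ h] := potential_bound u aV k0 e0 hk.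
apply: le_trans h; rewrite le_eqVlt; apply/orP; left; apply/eqP.
by apply: Rint_eq => z; rewrite expr2.
Qed.

End FormBound.

(** * Stability of the class of potentials under limits *)

Lemma powR_midpoint (R : realType) (p x y : R) : 1 <= p -> 0 <= x -> 0 <= y ->
  (2^-1 * x + 2^-1 * y) `^ p <= 2^-1 * x `^ p + 2^-1 * y `^ p.
Proof.
move=> p1 x0 y0; rewrite {2 4}(_ : 2^-1 = 1 - 2^-1); last by lra.
by apply: (convex_powR p1 (Itv01 _ _)) => //=;
  rewrite ?inE/= ?in_itv/= ?x0 ?y0// ?invr_ge0// invf_le1 ?ler1n.
Qed.

Lemma ler_average (R : realType) (x y z : R) : x <= z -> y <= z -> 2^-1 * x + 2^-1 * y <= z.
Proof. by lra. Qed.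

(** At a positive limit the power is an exponential of a logarithm; at 0 it is
    dominated by the base. *)
Lemma cvg_powR (R : realType) (x : R^nat) (l r : R) : 1 <= r -> (forall n, 0 <= x n) -> 0 <= l ->
  x @ \oo --> l -> (fun n => x n `^ r) @ \oo --> l `^ r.
Proof.
move=> r1 x0; rewrite le_eqVlt => /orP[/eqP <-|l0] xl; last first.
  have near_pos : \forall n \near \oo, 0 < x n by exact: (cvgr_gt l).
  have lim : (fun n => expR (r * ln (x n))) @ \oo --> expR (r * ln l).
    apply: continuous_cvg; first exact: continuous_expR.
    apply: cvgM; first exact: cvg_cst.
    by apply: (@continuous_cvg _ _ _ _ _ x (@ln R)) => //; exact: continuous_ln.
  have E t : 0 < t -> t `^ r = expR (r * ln t) by move=> t0; rewrite /powR gt_eqF.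
  rewrite E//; apply: cvg_trans lim; apply: near_eq_cvg.
  by apply: filterS near_pos => n /E.
rewrite powR0; last by rewrite gt_eqF// (lt_le_trans ltr01).
apply/cvgrPdist_lt => e e0; have /cvgrPdist_lt h := xl.
have me : 0 < Num.min e 1 by rewrite lt_min e0 ltr01.
apply: filterS (h _ me) => n; rewrite !sub0r !normrN !ger0_norm ?powR_ge0//.
rewrite lt_min => /andP[xe x1]; apply: le_lt_trans xe.
have := x0 n; rewrite le_eqVlt => /orP[/eqP <-|xp].
  by rewrite powR0// gt_eqF// (lt_le_trans ltr01).
by apply: ge1r_powR => //; rewrite xp ltW.
Qed.

(** A uniform bound on the forms reduces their pointwise convergence to a dense
    set. *)
Lemma dense_form_cvg (R : realType) (X : lmodType R) (b : X -> X -> R) (D : X -> Prop)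
    (U : set_system nat) {UF : ProperFilter U} (q_ : nat -> X -> X -> R) (q : X -> X -> R) (K : R) :
  psd b -> psd q -> (forall n, psd (q_ n)) -> 0 <= K ->
  (forall u, q u u <= K * b u u) -> (forall n u, q_ n u u <= K * b u u) ->
  (forall u, approximable b D u) ->
  (forall u, D u -> (fun n => q_ n u u) @ U --> q u u) ->
  forall u, (fun n => q_ n u u) @ U --> q u u.
Proof.
move=> hb hq hq_ K0 leq leq_ dense hD u; apply/cvgrPdist_lt => e e0.
pose S := seminorm b u; have S0 : 0 <= S by exact: seminorm_ge0.
have den : 0 < 3 * (K + 1) * (2 * S + 1).
  by rewrite !mulr_gt0// ltr_wpDl// mulr_ge0.
pose d := Num.min 1 (e / (3 * (K + 1) * (2 * S + 1))).
have d0 : 0 < d by rewrite lt_min ltr01 divr_gt0.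
have d1 : d <= 1 by rewrite ge_min lexx.
have de : d * (3 * (K + 1) * (2 * S + 1)) <= e.
  by rewrite -ler_pdivlMr// ge_min lexx orbT.
have [phi Dphi hphi] := dense u _ (exprn_gt0 2 d0).
have close : seminorm b (u - phi) < d.
  by rewrite /seminorm -[ltRHS]gtr0_norm// -sqrtr_sqr ltr_sqrt// exprn_gt0.
have Sphi : seminorm b phi <= S + d.
  have := ler_seminormB hb phi u; rewrite seminormB// ler_norml => /andP[_ h].
  by have := le_trans h (ltW close); rewrite -/S; lra.
have one (c : X -> X -> R) : psd c -> (forall w, c w w <= K * b w w) ->
    `|c u u - c phi phi| < e / 3.
  move=> hc lec; apply: le_lt_trans (ler_sqr_psdB hc _ _) _.
  have le w : seminorm c w <= Num.sqrt K * seminorm b w by exact: ler_seminorm.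
  apply: le_lt_trans (ler_pM (seminorm_ge0 _ _) (addr_ge0 (seminorm_ge0 _ _) (seminorm_ge0 _ _))
    (le _) (lerD (le _) (le _))) _.
  rewrite -mulrDr mulrACA -expr2 sqr_sqrtr//.
  have h1 : seminorm b (u - phi) * (seminorm b u + seminorm b phi) <= d * (2 * S + 1).
    apply: ler_pM; rewrite ?addr_ge0 ?seminorm_ge0 ?(ltW close)//.
    by move: Sphi d1; rewrite -/S; lra.
  apply: le_lt_trans (ler_wpM2l K0 h1) _.
  have t0 : 0 < d * (2 * S + 1) by rewrite mulr_gt0// ltr_wpDl// mulr_ge0.
  have e3 : 3 * ((K + 1) * (d * (2 * S + 1))) <= e by apply: le_trans de; rewrite le_eqVlt; apply/orP; left; apply/eqP; ring.
  by move: t0 e3; move: (d * _) => t t0 e3; rewrite ltr_pdivlMr//; lra.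
have /cvgrPdist_lt/(_ (e / 3)) := hD phi Dphi.
rewrite divr_gt0// => /(_ isT); apply: filterS => n h.
have h1 := one q hq leq; have h2 := one (q_ n) (hq_ n) (leq_ n).
have -> : q u u - q_ n u u = (q u u - q phi phi) + (q phi phi - q_ n phi phi)
  - (q_ n u u - q_ n phi phi) by ring.
apply: le_lt_trans (ler_normB _ _) _.
have := ler_normD (q u u - q phi phi) (q phi phi - q_ n phi phi).
lra.
Qed.

Section Closure.
Context {R : realType} (p M : R).
Hypotheses (M0 : 0 < M) (p2 : 2 < p).
Local Notation plane := (measurableTypeR R * measurableTypeR R)%type.
Implicit Types (V W : plane -> R).

Let p0 : 0 < p. Proof. by apply: lt_trans p2. Qed.

Lemma admissible_midpoint V W : admissible p M V -> admissible p M W ->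
  admissible p M (fun z => 2^-1 * (V z + W z)).
Proof.
move=> [mV V0 [mhV sV] hV] [mW W0 [mhW sW] hW].
have mm : measurable_fun setT (fun z => 2^-1 * (V z + W z)).
  by apply: measurable_funM => //; exact: measurable_funD.
have s := summableD (summableZ 2^-1 sV) (summableZ 2^-1 sW).
have le z : half_power p (fun z => 2^-1 * (V z + W z)) z ^+ 2 <=
    2^-1 * half_power p V z ^+ 2 + 2^-1 * half_power p W z ^+ 2.
  rewrite !sqr_half_power; have p1 : 1 <= p by apply: ltW; apply: lt_trans p2; rewrite ltr1n.
  apply: le_trans (powR_midpoint p1 (normr_ge0 (V z)) (normr_ge0 (W z))).
  apply: ge0_ler_powR; rewrite ?nnegrE ?(ltW p0)// ?addr_ge0 ?mulr_ge0//.
  by rewrite normrM gtr0_norm// -mulrDr ler_wpM2l// ler_normD.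
have sm : square_summable muO (half_power p (fun z => 2^-1 * (V z + W z))).
  have mh := half_power_measurable p mm; split=> //.
  apply: (summable_le _ s); first exact: measurable_funX.
  by move=> z; rewrite ger0_norm ?sqr_ge0.
split; [exact: mm| |exact: sm|].
  by apply: filterS2 V0 W0 => z h1 h2; rewrite mulr_ge0// addr_ge0.
apply: (le_trans (Rint_le sm.2 s le)).
rewrite (RintD (summableZ 2^-1 sV) (summableZ 2^-1 sW)) (RintZ 2^-1 sV) (RintZ 2^-1 sW).
exact: ler_average hV hW.
Qed.

Lemma admissible_midhull (v : nat -> L2 (@muO R)) (x : L2 (@muO R)) :
  (forall n, admissible p M (v n)) -> midhull v setT x -> admissible p M x.
Proof.
move=> hv; elim=> [n _|y z _ hy _ hz]; first exact: hv.
exact: admissible_midpoint hy hz.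
Qed.

(** A subsequence converges almost everywhere, so Fatou applies to the powers. *)
Lemma admissible_closed (W : nat -> L2 (@muO R)) (V : L2 (@muO R)) :
  (forall n, admissible p M (W n)) -> fcvg (@inner _ _ _ muO) W V -> admissible p M V.
Proof.
move=> hW WV; have hi := @inner_psd _ _ R (@muO R).
have cW : fcauchy (@inner _ _ _ muO) W.
  move=> e e0; have e2 : 0 < e / 2 by rewrite divr_gt0.
  have [N hN] := WV _ e2; exists N => i j Ni Nj.
  have -> : W i - W j = (W i - V) + (V - W j) by rewrite addrA subrK.
  apply: le_lt_trans (seminormD hi _ _) _.
  by rewrite (seminormB hi V) [ltRHS](splitr e); apply: ltrD; exact: hN.
have [l [Wl [s sn aes]]] := inner_complete muO_lty cW.
have Vl0 : inner (V - l) (V - l) = 0.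
  have s0 : seminorm (@inner _ _ _ muO) (V - l) <= 0.
    apply/ler_addgt0Pr => e e0; rewrite add0r; have e2 : 0 < e / 2 by rewrite divr_gt0.
    have [N1 h1] := WV _ e2; have [N2 h2] := Wl _ e2.
    have -> : V - l = (V - W (maxn N1 N2)) + (W (maxn N1 N2) - l) by rewrite addrA subrK.
    apply: le_trans (seminormD hi _ _) _.
    rewrite (seminormB hi V) [leRHS](splitr e); apply: lerD; apply: ltW.
      exact: h1 _ (leq_maxl N1 N2).
    exact: h2 _ (leq_maxr N1 N2).
  have s1 := seminorm_ge0 (@inner _ _ _ muO) (V - l).
  have s2 : seminorm (@inner _ _ _ muO) (V - l) = 0 by apply/eqP; rewrite eq_le s0 s1.
  by rewrite -(sqr_seminorm hi) s2 expr0n.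
have sVl := L2_square_summable (V - l).
have Vl : {ae (@muO R), forall z : plane, V z = l z}.
  have PF : Filter (nbhs (almost_everywhere (@muO R))) by exact: ae_filter_ringOfSetsType.
  have := Rint0_ae (square_summableM sVl sVl) _ Vl0.
  move=> /(_ (fun z => _)) h; apply: filterS (h _) => [z /eqP|z]; last first.
    by rewrite -expr2 sqr_ge0.
  by rewrite mulf_eq0 orbb => /eqP/subr0_eq.
have mV : measurable_fun setT V by have [] := L2_square_summable V.
have aeV : {ae (@muO R), forall z : plane, (fun n => W (s n) z) @ \oo --> V z}.
  by apply: filterS2 aes Vl => z h ->.
have V0 : {ae (@muO R), forall z : plane, 0 <= V z}.
  have W0 : {ae (@muO R), forall z : plane, forall n, 0 <= W (s n) z}.
    by apply: ae_foralln => n; have [_ h _ _] := hW (s n).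
  apply: filterS2 aeV W0 => z h h0; rewrite -(cvg_lim (@Rhausdorff R) h).
  by apply: limr_ge; [apply/cvg_ex; eexists; exact: h|apply: nearW].
have p1 : 1 <= p / 2 by rewrite ler_pdivlMr// mul1r ltW.
have [] := @fatou_sqr _ _ _ (@muO R) (fun n => half_power p (W (s n))) (half_power p V) (M `^ p).
- by move=> n; apply: half_power_measurable; have [] := hW (s n).
- exact: half_power_measurable.
- by move=> n; have [] := hW (s n).
- apply: filterS aeV => z h; apply: cvg_powR => //.
  exact: cvg_norm.
- by apply: nearW => n; have [] := hW (s n).
by move=> sV hV; split.
Qed.

End Closure.

(** * The eigenvalues of one potential *)

Section Spectrum.
Context {R : realType} (a1 a2 p M : R).
Hypotheses (ha1 : 0 < a1 < 2^-1) (ha2 : 0 < a2 < 2^-1) (M0 : 0 < M) (p2 : 2 < p).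
Local Notation plane := (measurableTypeR R * measurableTypeR R)%type.
Local Notation a10 := (exponent_ge0 ha1).
Local Notation a20 := (exponent_ge0 ha2).
Local Notation X := (sobolev0 a10 a20).
Local Notation m := (@sobolev_mass R a1 a2 a10 a20).
Local Notation a := (@sobolev_energy R a1 a2 a10 a20).
Local Notation q V := (@potential_form R a1 a2 ha1 ha2 V).
Local Notation form := (@sobolev_form R a1 a2 a10 a20).

Let to_X u (hu : H10 a1 a2 u) : X := to_class (H10_class a10 a20) hu.

Lemma class_L2 (u : X) : square_summable muO u.
Proof. exact: (class_square_summable (hP := H10_class a10 a20) (@H10_H1 R a1 a2) u). Qed.

Section OnePotential.
Variables (V : plane -> R) (aV : admissible p M V).

Let mV : measurable_fun setT V. Proof. by case: aV. Qed.
Let V0 : {ae (@muO R), forall z : plane, 0 <= V z}. Proof. by case: aV. Qed.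

Lemma sqr_root_ae : {ae (@muO R), forall z : plane, root V z * root V z = V z}.
Proof. by apply: filterS V0 => z Vz; rewrite -expr2 sqr_sqrtr. Qed.

(** The integral of [V u^2] is finite for every [u] in the space, by the form
    bound. *)
Lemma H0_H10 u : H0 a1 a2 V u <-> H10 a1 a2 u.
Proof.
split=> [[]//|hu]; split=> //.
have [mu _] := class_L2 (to_X hu).
have [_ s] := root_square_summable M0 p2 (to_X hu) aV.
have -> : (\int[@muO R]_z (V z * u z ^+ 2)%:E = \int[@muO R]_z ((root V z * u z) ^+ 2)%:E)%E.
  have m1 : measurable_fun setT (fun z : plane => V z * u z ^+ 2).
    by apply: measurable_funM => //; exact: measurable_funX.
  have m2 := summable_measurable s.
  apply: ae_eq_integral => //; try exact/measurable_EFinP.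
  by apply: filterS sqr_root_ae => z e _; rewrite -e exprMn -expr2.
by rewrite -EFin_Rint// ltry.
Qed.

Lemma potential_formE (u v : X) : q V u v = \int[@muO R]_z (V z * u z * v z) /\
  summable muO (fun z : plane => V z * u z * v z).
Proof.
have su := root_square_summable M0 p2 u aV; have sv := root_square_summable M0 p2 v aV.
have suv := square_summableM su sv.
have [mu _] := class_L2 u; have [mv _] := class_L2 v.
have m1 : measurable_fun setT (fun z : plane => V z * u z * v z).
  by apply: measurable_funM => //; exact: measurable_funM.
have ae : {ae (@muO R), forall z : plane, V z * u z * v z = (root V z * u z) * (root V z * v z)}.
  by apply: filterS sqr_root_ae => z <-; ring.
split; last exact: summable_ae m1 suv ae.
by apply: esym; exact: (Rint_ae m1 (summable_measurable suv) ae).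
Qed.

Lemma weak_formE (u v : X) :
  \int[@muO R]_z (z.2 `^ (2 * a1) * wderiv ex u z * wderiv ex v z
    + z.1 `^ (2 * a2) * wderiv ey u z * wderiv ey v z + V z * u z * v z) = a u v + q V u v.
Proof.
have sx (w : X) := class_gradx_summable (hP := H10_class a10 a20) (@H10_H1 R a1 a2) w.
have sy (w : X) := class_grady_summable (hP := H10_class a10 a20) (@H10_H1 R a1 a2) w.
have sxx := square_summableM (sx u) (sx v); have syy := square_summableM (sy u) (sy v).
have [e sV] := potential_formE u v.
have E : a u v = \int[@muO R]_z (gradx a1 u z * gradx a1 v z)
  + \int[@muO R]_z (grady a2 u z * grady a2 v z) by [].
rewrite E e -(RintD sxx syy) -(RintD (summableD sxx syy) sV).
apply: Rint_eq => z; rewrite /gradx /grady -!sqr_powR !expr2.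
move: (z.2 `^ a1) (z.1 `^ a2) (wderiv ex u z) (wderiv ex v z) (wderiv ey u z) (wderiv ey v z).
by move=> *; ring.
Qed.

Lemma in_eigenspaceP (lam : R) (u : X) :
  in_eigenspace a1 a2 V lam u <-> eigenvector m (fun u v => a u v + q V u v) lam u.
Proof.
split=> [[_ h] v|h]; first by rewrite -weak_formE; apply: h; apply/H0_H10; exact: class_funP v.
split; first by apply/H0_H10; exact: class_funP u.
move=> v /H0_H10 hv; have := h (to_X hv); rewrite -weak_formE; exact.
Qed.

Lemma lin_indepP n (f : 'I_n -> X) : lin_indep (fun i => f i : plane -> R) <-> independent m f.
Proof.
split=> h c hc; apply: h.
  by apply: filterS (mass_null_ae hc) => z; rewrite class_sum.
have PF : Filter (nbhs (almost_everywhere (@muO R))) by exact: ae_filter_ringOfSetsType.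
have [ms _] := class_L2 (\sum_i c i *: f i).
apply: (eq_trans (@Rint_ae _ _ _ (@muO R) _ (fun=> 0) _ _ _)).
- by apply: measurable_funM.
- exact: measurable_cst.
- by apply: filterS hc => z; rewrite class_sum => ->; rewrite mulr0.
- by rewrite Rintegral_cst// mul0r.
Qed.

Lemma multiplicity_geP (lam : R) n : multiplicity_ge a1 a2 V lam n <->
  mult_ge m (fun u v => a u v + q V u v) lam n.
Proof.
split=> [[u hu eu]|[f hf ef]]; last first.
  by exists (fun i => f i : plane -> R); [exact/lin_indepP|move=> i; exact/in_eigenspaceP].
have hu10 i : H10 a1 a2 (u i) by apply/H0_H10; exact: (eu i).1.
exists (fun i => to_X (hu10 i)); first exact/lin_indepP.
by move=> i; apply/in_eigenspaceP; exact: eu i.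
Qed.

End OnePotential.

Let potentials := [set q V | V in admissible p M].
Let potentials_psd b : potentials b -> psd b.
Proof. by move=> [V aV <-]; exact: (potential_form_psd ha1 ha2 M0 p2 aV). Qed.
Let potentials_infinitesimal : uniformly_infinitesimal m a potentials :=
  potential_infinitesimal ha1 ha2 M0 p2.

Lemma schrodinger_energy_space V : admissible p M V ->
  energy_space m (fun u v => a u v + q V u v).
Proof.
move=> aV; apply: (energy_spaceD (sobolev_energy_space ha1 ha2) potentials_psd
  potentials_infinitesimal); by exists V.
Qed.

Lemma schrodinger_eigenbasis V : admissible p M V ->
  exists lam e, eigenbasis m (fun u v => a u v + q V u v) lam e.
Proof. by move=> /schrodinger_energy_space/eigenbasis_exists. Qed.

Lemma eigenbasis_eigenvalue_sequence V lam e : admissible p M V ->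
  eigenbasis m (fun u v => a u v + q V u v) lam e -> eigenvalue_sequence a1 a2 V lam.
Proof.
move=> aV eb; split; first exact: eb_nondecreasing eb.
have [hm ha _ _ _ _ _] := schrodinger_energy_space aV.
move=> mu n; apply: iff_trans (eigenbasis_mult hm ha eb mu n); exact: multiplicity_geP.
Qed.

Lemma fundamental_gapP V lam e g : admissible p M V ->
  eigenbasis m (fun u v => a u v + q V u v) lam e ->
  fundamental_gap a1 a2 V g <-> g = lam 1%N - lam 0%N.
Proof.
move=> aV eb; have es := eigenbasis_eigenvalue_sequence aV eb.
split=> [[lam' es' ->]|->]; last by exists lam.
by have [-> ->] := lists_multiplicities_first_two es' es.
Qed.

End Spectrum.

(** * Existence of a minimizing potential *)

Section Minimizer.
Context {R : realType} (a1 a2 p M : R).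
Hypotheses (ha1 : 0 < a1 < 2^-1) (ha2 : 0 < a2 < 2^-1) (M0 : 0 < M) (p2 : 2 < p).
Local Notation plane := (measurableTypeR R * measurableTypeR R)%type.
Local Notation a10 := (exponent_ge0 ha1).
Local Notation a20 := (exponent_ge0 ha2).
Local Notation X := (sobolev0 a10 a20).
Local Notation m := (@sobolev_mass R a1 a2 a10 a20).
Local Notation a := (@sobolev_energy R a1 a2 a10 a20).
Local Notation q V := (@potential_form R a1 a2 ha1 ha2 V).
Local Notation form := (@sobolev_form R a1 a2 a10 a20).

Lemma tf_square_square_summable phi : test_function phi ->
  square_summable muO (fun z : plane => phi z ^+ 2).
Proof.
move=> hphi; have [C hC] := tf_bounded hphi.
apply: (square_summable_bounded muO_lty (C := C ^+ 2)).
  by apply: measurable_funX; exact: tf_measurable.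
by move=> z; rewrite normrX lerXn2r ?nnegrE// (le_trans _ (hC z)).
Qed.

(** The square of a test function is a fixed element of L2, against which weak
    convergence can be tested. *)
Lemma potential_form_weak_cvg (U : set_system nat) (PU : ProperFilter U)
    (v : nat -> L2 (@muO R)) (V : L2 (@muO R)) :
  (forall n, admissible p M (v n)) -> admissible p M V ->
  (forall f, (fun n => inner (v n) f) @ U --> inner V f) ->
  forall u, (fun n => q (v n) u u) @ U --> q V u u.
Proof.
move=> av aV hv.
(* Any value of [eps] gives a bound by the Sobolev form; 1 is chosen. *)
have [K K0 hK] := potential_infinitesimal ha1 ha2 M0 p2 (@ltr01 R).
have bound W : admissible p M W -> forall u, q W u u <= (K + 1) * form u u.
  move=> aW u; apply: (le_trans (hK _ u (ex_intro2 _ _ W aW erefl))).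
  rewrite mulrDl; apply: lerD.
    by apply: ler_wpM2l => //; rewrite -[leRHS]mul1r; exact: sobolev_mass_le_form.
  by rewrite [leLHS]mul1r; exact: sobolev_energy_le_form.
have K10 : 0 <= K + 1 by rewrite addr_ge0.
have psdq W : admissible p M W -> psd (q W) by exact: (potential_form_psd ha1 ha2 M0 p2).
apply: (dense_form_cvg (sobolev_form_psd a10 a20) (psdq _ aV) (fun n => psdq _ (av n)) K10
  (bound _ aV) (fun n => bound _ (av n)) (smooth_dense (a20 := a20))) => phi hphi.
pose f := toL2 (tf_square_square_summable hphi).
have E (W : L2 (@muO R)) : admissible p M W -> q W phi phi = inner W f.
  move=> aW; have [-> _] := potential_formE M0 p2 aW phi phi.
  by apply: Rint_eq => z; rewrite -mulrA -expr2.
have -> : (fun n => q (v n) phi phi) = (fun n => inner (v n) f).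
  by apply/funext => n; exact: (E (v n) (av n)).
by rewrite (E V aV); exact: hv.
Qed.

Definition attained_gaps := \bigcup_(V in S_class p M) fundamental_gap a1 a2 V.

Lemma attained_gap_ge0 g : attained_gaps g -> 0 <= g.
Proof. by move=> [V _ [lam [nd _] ->]]; rewrite subr_ge0; exact: nd. Qed.

Lemma zero_admissible : admissible p M (fun=> 0).
Proof.
have p0 : p != 0 by rewrite gt_eqF// (lt_trans _ p2).
have E : half_power p (fun=> 0 : R) = (fun=> 0) :> (plane -> R).
  apply/funext => z; rewrite /half_power normr0 powR0//.
  by rewrite mulf_neq0// invr_neq0.
split; [exact: measurable_cst|exact: nearW| |].
  rewrite E; apply: (square_summable_bounded muO_lty (C := 0)); first exact: measurable_cst.
  by move=> z; rewrite normr0.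
rewrite (_ : \int[muO]_z _ = 0) ?powR_ge0//.
transitivity (\int[@muO R]_z (0 : R)); last by rewrite Rintegral_cst// mul0r.
by apply: Rint_eq => z; rewrite E expr0n.
Qed.

Lemma attained_gaps_nonempty : attained_gaps !=set0.
Proof.
have a0 := zero_admissible; have [lam [e eb]] := schrodinger_eigenbasis ha1 ha2 M0 p2 a0.
exists (lam 1%N - lam 0%N), (fun=> 0); first exact/(S_classP M0 p2).
exact/(fundamental_gapP M0 p2 _ a0 eb).
Qed.

Lemma minimizing_sequence : exists2 V : nat -> plane -> R, forall n, admissible p M (V n) &
  exists2 g : R^nat, forall n, fundamental_gap a1 a2 (V n) (g n) &
    g @ \oo --> inf attained_gaps.
Proof.
have hinf : has_inf attained_gaps.
  by split; [exact: attained_gaps_nonempty|exists 0 => g /attained_gap_ge0].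
have /choice[g hg] (n : nat) : exists g, attained_gaps g /\ g < inf attained_gaps + n.+1%:R^-1.
  have n0 : 0 < n.+1%:R^-1 :> R by rewrite invr_gt0.
  by have [g Gg lt] := inf_adherent n0 hinf; exists g.
have /choice[V hV] (n : nat) : exists V, admissible p M V /\ fundamental_gap a1 a2 V (g n).
  by have [[V /(S_classP M0 p2) aV gV] _] := hg n; exists V.
exists V; first by move=> n; have [] := hV n.
exists g; first by move=> n; have [] := hV n.
have lim : (fun n => inf attained_gaps + n.+1%:R^-1) @ \oo --> inf attained_gaps.
  rewrite -[X in _ --> X]addr0; apply: cvgD; [exact: cvg_cst|exact: cvg_harmonic].
apply: (squeeze_cvgr _ (cvg_cst _) lim); apply: nearW => n; apply/andP; split.
  by apply: ge_inf; [exact: hinf.2|have [] := hg n].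
by apply: ltW; have [] := hg n.
Qed.

(** The weak limit of a minimizing sequence, along an ultrafilter finer than the
    tails, is admissible, and [gap_stability] bounds its gap. *)
Lemma minimal_gap : exists2 V, admissible p M V &
  exists2 g, fundamental_gap a1 a2 V g & g <= inf attained_gaps.
Proof.
have [Vn aVn [g gapn ginf]] := minimizing_sequence.
have sVn n : square_summable muO (Vn n) by have [] := admissible_L2 p2 (aVn n).
pose v n : L2 (@muO R) := toL2 (sVn n).
have [U [UF sU]] := ultraFilterLemma (@eventually_filter).
have PU : ProperFilter U := @ultra_proper _ _ UF.
have vC n : inner (v n) (v n) <= 1 + M `^ p.
  have [_ h] := admissible_L2 p2 (aVn n); apply: le_trans h.
  by rewrite le_eqVlt; apply/orP; left; apply/eqP; apply: Rint_eq => z; rewrite expr2.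
have complete (x : nat -> L2 (@muO R)) : fcauchy (@inner _ _ _ muO) x ->
    exists l, fcvg (@inner _ _ _ muO) x l.
  by move=> /(inner_complete muO_lty)[l [hl _]]; exists l.
have [V [Vweak [W WV hW]]] := weak_limit (@inner_psd _ _ R (@muO R)) complete UF vC.
have av n : admissible p M (v n) by exact: aVn.
have aW j : admissible p M (W j) := admissible_midhull p2 av (hW j).
have aV : admissible p M V := admissible_closed p2 aW WV.
have /choice[lam_ hlam] n : exists lam, exists e,
    eigenbasis m (fun x y => a x y + q (v n) x y) lam e.
  exact: (schrodinger_eigenbasis ha1 ha2 M0 p2 (av n)).
have /choice[e_ heb] := hlam.
have [lam [e eb]] := schrodinger_eigenbasis ha1 ha2 M0 p2 aV.
exists V; first exact: aV.
exists (lam 1%N - lam 0%N); first exact/(fundamental_gapP M0 p2 _ aV eb).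
apply: (gap_stability (sobolev_energy_space ha1 ha2)
  (Q := [set q V | V in admissible p M]) _ (potential_infinitesimal ha1 ha2 M0 p2) UF _ _
  (potential_form_weak_cvg PU av aV Vweak) heb eb).
- by move=> _ [W' aW' <-]; exact: (potential_form_psd ha1 ha2 M0 p2 aW').
- by move=> n; exists (v n : plane -> R); [exact: av|].
- by exists V.
have gE n : g n = lam_ n 1%N - lam_ n 0%N.
  by apply/(fundamental_gapP M0 p2 _ (av n) (heb n)); exact: gapn.
under eq_fun do rewrite -gE.
by move=> A /ginf; exact: sU.
Qed.

End Minimizer.

Theorem theorem5p1 (R : realType) (a1 a2 M p : R)
    (ha1 : 0 < a1 < 2^-1) (ha2 : 0 < a2 < 2^-1) (hM : 0 < M) (hp : 2 < p) :
  exists2 Vs, S_class p M Vs &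
  exists2 g : R, fundamental_gap a1 a2 Vs g &
    g%:E = ereal_inf
      [set h%:E | h in \bigcup_(V in S_class p M) fundamental_gap a1 a2 V].
Proof.
have [V aV [g gV ginf]] := minimal_gap ha1 ha2 hM hp.
have SV : S_class p M V by apply/(S_classP hM hp).
have Gg : attained_gaps a1 a2 p M g by exists V.
exists V; first exact: SV.
exists g; first exact: gV.
apply/eqP; rewrite eq_le; apply/andP; split; last by apply: ereal_inf_lbound; exists g.
apply: le_ereal_inf_tmp => _ [h Gh <-]; rewrite lee_fin; apply: (le_trans ginf).
by apply: ge_inf => //; exists 0 => k /attained_gap_ge0.
Qed.
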